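(* Consider any Sturm dodecahedron $\mathbb{D}$, i.e. any 3-cell template whose underlying cell complex is the solid dodecahedron. Then the pole distance $\delta$ and the face count $\eta$ of the smaller (Western) hemisphere satisfy $$1\leq \eta\leq\delta\leq 2,$$ and all these cases do occur (that is, each of $(\eta,\delta)=(1,1),(1,2),(2,2)$ is realized by some Sturm dodecahedron). For $\eta=\delta=2$, the poles $\mathbf{N},\mathbf{S}$ are located asymmetrically at edge distance $\delta=2$ via the unique shared edge of the two Western pentagon faces (that is, they are joined by a path of two edges one of which is this shared edge). Their edge distance along the meridian circle, which has edge circumference eight, is three.
   Context: A finite regular CW-complex $\mathcal{C}=\bigcup_{v\in\mathcal{E}}c_v$ is a finite disjoint union of open cells $c_v$, labeled by barycenters $v\in\mathcal{E}$, whose characteristic maps $\overline{B}_v\to\overline{c}_v$ are homeomorphisms (including on the boundary) and such that each boundary $\partial c_v$ is a subcomplex of the skeleton of lower dimension. Cells of dimension 0, 1, 2 are called vertices, edges, faces. A bipolar orientation of the 1-skeleton is an orientation of all edges without directed cycles and with exactly one ''source'' vertex $\mathbf{N}$ (North pole) and exactly one ''sink'' vertex $\mathbf{S}$ (South pole). A finite regular cell complex $\mathcal{C}$ is called a 3-cell template if all of the following hold. (i) $\mathcal{C}=\mathrm{clos}\,c_{\mathcal{O}}=S^2\,\dot\cup\,c_{\mathcal{O}}$ is the closure of a single 3-cell $c_{\mathcal{O}}$. (ii) The 1-skeleton $\mathcal{C}^1$ carries a bipolar orientation from a pole vertex $\mathbf{N}$ to a pole vertex $\mathbf{S}$, with two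 directed meridian paths $\mathbf{WE}$ and $\mathbf{EW}$ from $\mathbf{N}$ to $\mathbf{S}$, disjoint except for the poles. The meridians decompose the boundary sphere $S^2=\partial c_{\mathcal{O}}$ into two remaining (open) hemisphere components $\mathbf{W}$ (West) and $\mathbf{E}$ (East). (iii) At end points on the meridians other than the poles $\mathbf{N},\mathbf{S}$, edges in $\mathbf{W}$ are directed towards the meridians and edges in $\mathbf{E}$ are directed away from the meridians. (iv) Let $\mathbf{NE}$ be the unique face in $\mathbf{W}$ containing the first edge of $\mathbf{WE}$ in its boundary, and $\mathbf{SW}$ the unique face in $\mathbf{E}$ containing the last edge of $\mathbf{WE}$ in its boundary. Then the boundaries of $\mathbf{NE}$ and $\mathbf{SW}$ share at least one edge of $\mathbf{WE}$. Similarly, let $\mathbf{NW}$ be the unique face in $\mathbf{W}$ adjacent to the first edge of $\mathbf{EW}$, and $\mathbf{SE}$ the unique face in $\mathbf{E}$ adjacent to the last edge of $\mathbf{EW}$. Then their boundaries share at least one edge of $\mathbf{EW}$. The solid dodecahedron is the regular cell complex of a 3-cell whose boundary sphere complex is the boundary complex of the convex regular dodecahedron (20 vertices, 30 edges, 12 pentagonal faces). The pole distance $\delta$ is the edge distance of $\mathbf{N}$ and $\mathbf{S}$ in the 1-skeleton $\mathcal{C}^1$. The number $\eta$ is the number of faces in the hemisphere with fewer faces; the convention is that this is the Western hemisphere $\mathbf{W}$, which is no loss of generality by the trivial equivalence $\kappa$ that reverses all edge orientations and interchanges $\mathbf{N}\leftrightarrow\mathbf{S}$, $\mathbf{WE}\leftrightarrow\mathbf{EW}$,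 $\mathbf{W}\leftrightarrow\mathbf{E}$. The meridian circle is the union of the two meridian paths $\mathbf{WE}$ and $\mathbf{EW}$. Background: by earlier work of the same authors, 3-cell templates are exactly the Thom-Smale complexes (decompositions into unstable manifolds of equilibria, with signed hemisphere decomposition) of Sturm 3-ball global attractors of dissipative PDEs $u_t=u_{xx}+f(x,u,u_x)$ on $0<x<1$ with Neumann boundary conditions and hyperbolic equilibria. *)

(* Defs.v *)
From HB Require Import structures.
From mathcomp Require Import all_boot all_order all_algebra.
From mathcomp Require Import all_classical all_reals all_analysis.

Set Implicit Arguments.
Unset Strict Implicit.
Unset Printing Implicit Defensive.

Import Order.TTheory GRing.Theory Num.Theory.
Import numFieldNormedType.Exports.

Local Open Scope classical_set_scope.
Local Open Scope ring_scope.

(* The library norm on row vectors is the sup norm, so the Euclidean balls are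
   written out.  For n = 0 both of them are the one-point space. *)
Definition open_unit_ball (R : realType) (n : nat) : set 'rV[R]_n :=
  [set x | \sum_i x ord0 i ^+ 2 < 1].

Definition closed_unit_ball (R : realType) (n : nat) : set 'rV[R]_n :=
  [set x | \sum_i x ord0 i ^+ 2 <= 1].

Definition homeomorphism_on (T U : topologicalType) (A : set T) (B : set U)
    (f : T -> U) : Prop :=
  exists g : U -> T,
    [/\ f @` A = B, {in A, cancel f g},
        {within A, continuous f} & {within B, continuous g}].

(* A finite regular CW complex, realized inside an ambient Hausdorff space X.
   The complex itself is the union of its cells; it is compact, so closures of
   cells in X and in the complex coincide. *)
Record regular_cw (R : realType) (X : topologicalType) := RegularCW {
  cell :> finType;
  dim : cell -> nat;
  open_cell : cell -> set X;
  cw_hausdorff : hausdorff_space X;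
  cw_disjoint : trivIset [set: cell] open_cell;
  cw_char : forall v : cell, exists phi : 'rV[R]_(dim v) -> X,
    homeomorphism_on (@closed_unit_ball R (dim v)) (closure (open_cell v)) phi
    /\ phi @` @open_unit_ball R (dim v) = open_cell v;
  cw_boundary : forall v : cell, exists A : {set cell},
    (forall w, w \in A -> (dim w < dim v)%N) /\
    closure (open_cell v) `\` open_cell v = \bigcup_(w in [set` A]) open_cell w
}.

Section Complex.
Context (R : realType) (X : topologicalType) (C : regular_cw R X).

Definition carrier : set X := \bigcup_(v in [set: C]) open_cell v.

Definition is_vertex (v : C) : bool := dim v == 0%N.
Definition is_edge (v : C) : bool := dim v == 1%N.
Definition is_face (v : C) : bool := dim v == 2%N.

Definition incident (v w : C) : bool :=
  `[< open_cell v `<=` closure (open_cell w) >].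

Definition joins (e u v : C) : bool :=
  [&& is_edge e, is_vertex u, is_vertex v, u != v, incident u e & incident v e].

Definition adjacent_via (A : pred C) (u v : C) : bool :=
  [exists e, A e && joins e u v].

(* Least length of a path from u to v using only edges in A; the junk value
   #|C| is taken when there is no path. *)
Definition edge_dist (A : pred C) (u v : C) : nat :=
  find (fun n => [exists p : n.-tuple C,
                   path (adjacent_via A) u p && (last u p == v)])
       (iota 0 #|C|).

Definition cells_in (k : nat) (H : set X) : {set C} :=
  [set v : C | (dim v == k) && `[< open_cell v `<=` H >]]%SET.

Definition oriented (src tgt : C -> C) : Prop :=
  forall e, is_edge e ->
    [/\ is_vertex (src e), is_vertex (tgt e), src e != tgt e &
        closure (open_cell e) `\` open_cell e
        = open_cell (src e) `|` open_cell (tgt e)].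

(* Paths are given by their sequences of edges. *)
Fixpoint directed_path (src tgt : C -> C) (u : C) (p : seq C) (v : C) : bool :=
  if p is e :: q then
    [&& is_edge e, src e == u & directed_path src tgt (tgt e) q v]
  else u == v.

Definition bipolar (src tgt : C -> C) (N S : C) : Prop :=
  [/\ oriented src tgt,
      forall u p, is_vertex u -> directed_path src tgt u p u -> p = [::],
      forall v, is_vertex v /\ (forall e, is_edge e -> tgt e != v) <-> v = N &
      forall v, is_vertex v /\ (forall e, is_edge e -> src e != v) <-> v = S].

Definition support (p : seq C) : set X :=
  \bigcup_(e in [set` p]) closure (open_cell e).

Definition first_edge (p : seq C) (e : C) : Prop := ohead p = Some e.
Definition last_edge (p : seq C) (e : C) : Prop := ohead (rev p) = Some e.

Definition the_face_at (H : set X) (e f : C) : Prop :=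
  unique (fun g => [/\ is_face g, open_cell g `<=` H & incident e g]) f.

Definition pole_faces_overlap (W E : set X) (p : seq C) : Prop :=
  exists e0 e1 f g : C,
    [/\ first_edge p e0 /\ the_face_at W e0 f,
        last_edge p e1 /\ the_face_at E e1 g &
        exists e, [/\ e \in p, incident e f & incident e g]].

Record template := Template {
  ball : C;
  src : C -> C;
  tgt : C -> C;
  north : C;
  south : C;
  WE : seq C;
  EW : seq C;
  west : set X;
  east : set X;
  (* That the boundary of the 3-cell is a 2-sphere is part of cw_char. *)
  ball_dim : dim ball = 3%N;
  ball_closure : closure (open_cell ball) = carrier;
  poles_bipolar : bipolar src tgt north south;
  WE_path : directed_path src tgt north WE south;
  EW_path : directed_path src tgt north EW south;
  meridians_disjoint :
    support WE `&` support EW = open_cell north `|` open_cell south;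
  hemispheres_neq : west <> east;
  hemispheres :
    let U := (carrier `\` open_cell ball) `\` (support WE `|` support EW) in
    [set connected_component U x | x in U] = [set west; east];
  west_towards : forall e v, is_edge e -> open_cell e `<=` west ->
    is_vertex v -> v != north -> v != south ->
    open_cell v `<=` support WE `|` support EW ->
    incident v e -> tgt e = v;
  east_away : forall e v, is_edge e -> open_cell e `<=` east ->
    is_vertex v -> v != north -> v != south ->
    open_cell v `<=` support WE `|` support EW ->
    incident v e -> src e = v;
  WE_overlap : pole_faces_overlap west east WE;
  EW_overlap : pole_faces_overlap west east EW
}.

Section Template.
Variable T : template.

Definition pole_dist : nat := edge_dist predT (north T) (south T).

(* The Western hemisphere, under the convention that it does not have more
   faces than the Eastern one. *)
Definition small_hemisphere : set X :=
  if (#|cells_in 2 (west T)| <= #|cells_in 2 (east T)|)%N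
  then west T else east T.

Definition face_count : nat := #|cells_in 2 small_hemisphere|.

Definition meridian_circle : {set C} := [set e in WE T ++ EW T]%SET.

Definition meridian_pole_dist : nat :=
  edge_dist (mem meridian_circle) (north T) (south T).

Definition poles_via_shared_edge : Prop :=
  exists f g e : C,
    [/\ f != g,
        cells_in 2 small_hemisphere = [set f; g]%SET,
        unique (fun a => [/\ is_edge a, incident a f & incident a g]) e &
        exists a m : C,
          joins e (north T) m && joins a m (south T)
          || joins a (north T) m && joins e m (south T)].

End Template.

End Complex.

(* The boundary complex of the dodecahedron, each closed cell being named by its
   set of vertices.  Vertices are numbered in four layers of five: top pentagon
   0-4, then i + 5 below i, then 10 + i between 5 + i and 5 + (i + 1 mod 5),
   and bottom pentagon 15-19 with 15 + i below 10 + i. *)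
Definition pentagons : seq (seq nat) :=
  [:: [:: 0; 1; 2; 3; 4];
      [:: 0; 1; 6; 10; 5];
      [:: 1; 2; 7; 11; 6];
      [:: 2; 3; 8; 12; 7];
      [:: 3; 4; 9; 13; 8];
      [:: 4; 0; 5; 14; 9];
      [:: 10; 6; 11; 16; 15];
      [:: 11; 7; 12; 17; 16];
      [:: 12; 8; 13; 18; 17];
      [:: 13; 9; 14; 19; 18];
      [:: 14; 5; 10; 15; 19];
      [:: 15; 16; 17; 18; 19]]%N.

Definition dodecahedron_cells (k : nat) : seq (seq nat) :=
  match k with
  | 0 => [seq [:: x] | x <- iota 0 20]
  | 1 => [seq [:: x; next p x] | p <- pentagons, x <- p]
  | 2 => pentagons
  | 3 => [:: iota 0 20]
  | _ => [::]
  end.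

Definition vertex_set (s : seq nat) : {set 'I_20} :=
  [set i : 'I_20 | nat_of_ord i \in s]%SET.

(* Regular complexes are determined up to cellular homeomorphism by the
   inclusions among their closed cells; h is an isomorphism of those. *)
Definition is_solid_dodecahedron (R : realType) (X : topologicalType)
    (C : regular_cw R X) : Prop :=
  exists h : C -> {set 'I_20},
    [/\ injective h,
        forall k (A : {set 'I_20}),
          A \in map vertex_set (dodecahedron_cells k)
          <-> exists2 v, dim v = k & h v = A &
        forall v w, incident v w = (h v \subset h w)].

(* Main.v *)
(* The meridian circle is a union of cells, so the hemispheres are unions of open
   cells too, and a template on the dodecahedron amounts to finite data: a simple
   cycle through the poles, a side for each remaining cell and an orientation of
   the edges.  Besides the overlap condition (iv), three things are forced.  By
   (iii), no edge off the cycle joins two of its vertices other than the poles.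
   The vertices inside E, if there are any, have an edge to S: by (iii) they would
   otherwise be closed under successors, which an acyclic orientation excludes.
   Dually, the vertices inside W, if there are any, have an edge from N.  A
   rotation moves the first edge of WE to 0 -> 1; a search over all simple cycles
   through that edge shows that only the configurations of the theorem satisfy
   these conditions.

   Conversely, a pyritohedron is a dodecahedron with rational coordinates, and
   radial projection with respect to the gauge of a face maps a round ball onto
   it.  Numbering the vertices so that every vertex but the first and the last has
   an earlier and a later neighbour, and directing edges forward, gives bipolar
   orientations; suitable numberings realize the three cases. *)

Require Import Defs.
From HB Require Import structures.
From mathcomp Require Import all_boot all_order all_algebra.
From mathcomp Require Import all_classical all_reals all_analysis.
From mathcomp Require Import ring lra zify.

Set Implicit Arguments.
Unset Strict Implicit.
Unset Printing Implicit Defensive.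

Import Order.TTheory GRing.Theory Num.Theory.
Import numFieldNormedType.Exports.

Local Open Scope classical_set_scope.
Local Open Scope ring_scope.
Local Notation dim := Defs.dim.
Local Notation support := Defs.support.

(** * Topology of regular complexes *)

(** Topology and computation meet in one fact: two incident open cells have a connected union. Hence
    a component of the complement of the meridians is a union of cells, and its faces determine it,
    since every cell below dimension 3 lies in a face. No Jordan curve theorem is invoked. For each
    cycle the search floods the faces from the two sides of its first edge and checks that both
    floods together reach all twelve faces; as each hemisphere contains a face, the floods are W and
    E in some order, and both orders are tested. Orientations are not enumerated either: only
    necessary conditions free of them enter the search.

    For existence the obstacle is that the face structure of the explicit polytope has to be proved.
    Facets that do not meet are never tight at the same point, by an integer certificate for each
    such pair. Every set of pairwise adjacent facets consists of the facets through one cell, so the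
    tight facets at a point always name a cell. *)

Lemma open_unit_ball_connected (R : realType) n :
  connected (@open_unit_ball R n).
Proof.
(* The ball is a union of segments that all start at the origin. *)
have -> : @open_unit_ball R n =
  \bigcup_(x in @open_unit_ball R n) ((fun t : R => t *: x) @` `[0, 1]).
  apply/seteqP; split=> [x xB|_ [x xB [t /= + <-]]].
    by exists x => //; exists 1; rewrite ?scale1r //= in_itv /= lexx ler01.
  rewrite in_itv /= => /andP[t0 t1]; rewrite /open_unit_ball /=.
  rewrite (eq_bigr (fun i => t ^+ 2 * x ord0 i ^+ 2)); last first.
    by move=> i _; rewrite mxE exprMn.
  rewrite -mulr_sumr; apply: le_lt_trans xB.
  by rewrite ler_piMl ?sumr_ge0 // => [i _|]; rewrite ?sqr_ge0 // exprn_ile1.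
apply: bigcup_connected => [|x _].
  by exists 0 => x _; exists 0; rewrite ?scale0r //= in_itv /= lexx ler01.
apply: connected_continuous_connected; first exact: segment_connected.
apply: continuous_subspaceT => t; exact: scalel_continuous.
Qed.

Section Cells.
Context (R : realType) (X : topologicalType) (C : regular_cw R X).
Implicit Types c d e : C.

Lemma open_cell_neq0 c : open_cell c !=set0.
Proof.
have [phi [_ <-]] := cw_char c.
by exists (phi 0), 0 => //; rewrite /open_unit_ball /= big1 // => i _; rewrite mxE expr0n.
Qed.

Lemma open_cell_connected c : connected (open_cell c).
Proof.
have [phi [[g [_ _ cphi _]] <-]] := cw_char c.
apply: connected_continuous_connected; first exact: open_unit_ball_connected.
apply: continuous_subspaceW cphi => x; exact: ltW.
Qed.

Lemma open_cell_inj c d x : open_cell c x -> open_cell d x -> c = d.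
Proof. by move=> cx dx; apply: (@cw_disjoint _ _ C c d) => //; exists x. Qed.

Lemma incident_refl c : incident c c.
Proof. by apply/asboolP; exact: subset_closure. Qed.

(** The axiom [cw_boundary] writes the boundary as a union of whole open cells. Closed cells are
    therefore unions of open cells, and all later set computations reduce to the relation
    [incident]. *)
Lemma closure_cellP c x :
  closure (open_cell c) x <-> exists2 d, incident d c & open_cell d x.
Proof.
split=> [cx|[d /asboolP]]; last exact.
have [A [_ dA]] := cw_boundary c.
have [ox|nx] := pselect (open_cell c x); first by exists c => //; exact: incident_refl.
have : (closure (open_cell c) `\` open_cell c) x by [].
rewrite dA => -[d /= dinA dx]; exists d => //; apply/asboolP => y dy.
have : (closure (open_cell c) `\` open_cell c) y by rewrite dA; exists d.
by case.
Qed.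

Lemma incidentP c d x : open_cell d x -> closure (open_cell c) x -> incident d c.
Proof. by move=> dx /closure_cellP[e ec ex]; rewrite (open_cell_inj dx ex). Qed.

(** A connected set stays connected when one point of its closure is added. The sets obtained from
    [c] by adding single points of [d] all share a point of [c], so their union is connected too. *)
Lemma connected_incident c d : incident d c ->
  connected (open_cell c `|` open_cell d).
Proof.
move=> /asboolP dc.
have : connected (\bigcup_(x in open_cell d) (open_cell c `|` [set x])).
  apply: bigcup_connected => [|x dx].
    have [y cy] := open_cell_neq0 c; by exists y => x _; left.
  apply/connectedP => E [E0 EU sE].
  have [y cy] := open_cell_neq0 c.
  wlog Ey : E E0 EU sE / E false y.
    move=> G; have : (open_cell c `|` [set x]) y by left.
    rewrite EU => -[|Ety]; first exact: G.
    by apply: (G (E \o negb)) => //; [case => /=|rewrite EU setUC|rewrite separatedC].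
  have : open_cell c `<=` E false `|` E true by rewrite -EU; exact: subsetUl.
  move=> /(connected_subset sE)/(_ (@open_cell_connected c))[cE|/(_ y cy) Ety].
    have [z Etz] := E0 true.
    have : (open_cell c `|` [set x]) z by rewrite EU; right.
    case=> [/cE Ez|zx]; first by have := separated_disjoint sE; apply/eqP/set0P; exists z.
    have clx : closure (E false) x by apply: closureS cE _ _; exact: dc.
    by case: sE => + _; apply/eqP/set0P; exists x; split=> //; rewrite -zx.
  by have := separated_disjoint sE; apply/eqP/set0P; exists y.
congr connected; apply/seteqP; split=> [z [x dx [cz|->]]|z [cz|dz]].
- by left.
- by right.
- by have [x dx] := open_cell_neq0 d; exists x => //; left.
- by exists z => //; right.
Qed.

Lemma cells_in_subset (c : C) (A : set C) x :
  open_cell c x -> (\bigcup_(d in A) open_cell d) x -> A c.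
Proof. by move=> cx [d Ad dx]; rewrite (open_cell_inj cx dx). Qed.

Lemma subset_cellsP (c : C) (A : set C) :
  (open_cell c `<=` \bigcup_(d in A) open_cell d) <-> A c.
Proof.
split=> [cA|Ac x cx]; last by exists c.
by have [x cx] := open_cell_neq0 c; exact: cells_in_subset cx (cA _ cx).
Qed.

Lemma support_cellsE (p : seq C) :
  support p = \bigcup_(c in [set c | has (incident c) p]) open_cell c.
Proof.
apply/seteqP; split=> [x [e /= ep /closure_cellP[c ce cx]]|x [c /= /hasP[e ep ce] cx]].
  by exists c => //=; apply/hasP; exists e.
by exists e => //; apply/closure_cellP; exists c.
Qed.

Lemma setD_cells (A B : set C) :
  (\bigcup_(c in A) open_cell c) `\` (\bigcup_(c in B) open_cell c) =
  \bigcup_(c in A `\` B) open_cell c.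
Proof.
apply/seteqP; split=> [x [[c Ac cx] nB]|x [c [Ac nBc] cx]].
  by exists c => //; split=> // Bc; apply: nB; exists c.
by split; [exists c|move=> /(cells_in_subset cx)].
Qed.

Lemma setI_cells (A B : set C) :
  (\bigcup_(c in A) open_cell c) `&` (\bigcup_(c in B) open_cell c) =
  \bigcup_(c in A `&` B) open_cell c.
Proof.
apply/seteqP; split=> [x [[c Ac cx] xB]|x [c [Ac Bc] cx]].
  by exists c => //; split=> //; apply: cells_in_subset cx xB.
by split; exists c.
Qed.

(** Supports are unions of closed cells, hence of open ones. Since open cells are disjoint, set
    operations on such unions become operations on the index sets. *)
Lemma complement_meridianE (b : C) (p q : seq C) :
  (carrier C `\` open_cell b) `\` (support p `|` support q) =
  \bigcup_(c in [set c | c != b /\ ~~ has (incident c) (p ++ q)]) open_cell c.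
Proof.
rewrite !support_cellsE -bigcup_setU -[open_cell b](bigcup_set1 (@open_cell _ _ C)).
rewrite /carrier !setD_cells; congr bigcup; apply/seteqP; split=> c /=.
  move=> [[_ /eqP cb] n]; split=> //; rewrite has_cat; apply/negP => /orP h.
  exact: n.
move=> [/eqP cb]; rewrite has_cat => /negP n; split; first by split.
by move=> h; apply: n; apply/orP.
Qed.

End Cells.

(** * Numbering the cells *)

Local Open Scope nat_scope.

(** [dodecahedron_cells] lists an edge once for each of its two pentagons, with its ends in either
    order. Sorting the ends and removing duplicates gives every edge a single position. *)
Definition edge_list : seq (seq nat) := Eval vm_compute in
  undup [seq [:: minn x (next p x); maxn x (next p x)] | p <- pentagons, x <- p].

Definition cell_list (k : nat) : seq (seq nat) :=
  if k is 1 then edge_list else dodecahedron_cells k.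

Definition cell_verts (k i : nat) : seq nat := nth [::] (cell_list k) i.

(* A cell is denoted by its dimension k and its position i in [cell_list k]. *)
Definition inc (k i l j : nat) : bool :=
  all (fun x => x \in cell_verts l j) (cell_verts k i).

Definition count_cells (k : nat) : nat := size (cell_list k).

Definition all_cells (P : nat -> nat -> bool) : bool :=
  all (fun k => all (P k) (iota 0 (count_cells k))) (iota 0 4).

Lemma all_cellsP P k i : all_cells P -> i < count_cells k -> P k i.
Proof.
move=> /allP h ik.
have k4 : k < 4 by case: k ik => [|[|[|[|]]]].
by move: (h k); rewrite mem_iota k4 => /(_ isT) /allP; apply; rewrite mem_iota.
Qed.

Definition set_eq (s t : seq nat) := all (mem t) s && all (mem s) t.

Definition cell_list_complete : bool :=
  all_cells (fun k i => (cell_verts k i != [::]) && all (fun x => x < 20) (cell_verts k i) &&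
    all_cells (fun l j => set_eq (cell_verts k i) (cell_verts l j) ==> ((k == l) && (i == j)))
    && has (fun s => set_eq s (cell_verts k i)) (dodecahedron_cells k)) &&
  all (fun k => all (fun s => has (set_eq s) (cell_list k)) (dodecahedron_cells k)) (iota 0 4).

Lemma cell_list_completeP : cell_list_complete.
Proof. by vm_compute. Qed.

Lemma vertex_set_eq s t : set_eq s t -> vertex_set s = vertex_set t.
Proof.
move=> /andP[/allP st /allP ts]; apply/setP => i; rewrite !inE.
by apply/idP/idP => [/st|/ts].
Qed.

Lemma vertex_set_sub s t : all (fun x => x < 20) s ->
  (vertex_set s \subset vertex_set t) = all (mem t) s.
Proof.
move=> /allP s20; apply/fintype.subsetP/allP => [h x xs|h x]; last by rewrite !inE; apply: h.
by have := h (Ordinal (s20 x xs)); rewrite !inE; exact.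
Qed.

Section Numbering.
Context (R : realType) (X : topologicalType) (C : regular_cw R X).

(** The interface between an abstract complex and the tables: combinatorial statements are
    transported along [num] and then decided on natural numbers. *)
Record numbering (num : C -> nat) : Prop := Numbering {
  numbering_inj : forall v w : C, dim v = dim w -> num v = num w -> v = w;
  numbering_lt : forall v : C, num v < count_cells (dim v);
  numbering_onto : forall k i, i < count_cells k -> exists2 v : C, dim v = k & num v = i;
  numbering_inc : forall v w : C, incident v w = inc (dim v) (num v) (dim w) (num w)
}.

Lemma solid_numbering : is_solid_dodecahedron C <-> exists num, numbering num.
Proof.
have /andP[cl1 /allP cl2] := cell_list_completeP.
have cl1P k i := all_cellsP cl1 (k := k) (i := i).
split=> [[h [hinj him hinc]]|[num nu]].
  have hv (v : C) : exists2 i, i < count_cells (dim v) & h v = vertex_set (cell_verts (dim v) i).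
    have : exists2 w, dim w = dim v & h w = h v by exists v.
    move=> /him /mapP[s sk ->].
    have dk : dim v < 4 by case: (dim v) sk => [|[|[|[|]]]].
    have := cl2 (dim v); rewrite mem_iota dk => /(_ isT) /allP /(_ _ sk).
    move=> /(has_nthP [::])[i ik st]; exists i => //; exact: vertex_set_eq.
  pose num (v : C) := find (fun s => h v == vertex_set s) (cell_list (dim v)).
  have numP (v : C) : num v < count_cells (dim v) /\ h v = vertex_set (cell_verts (dim v) (num v)).
    have hh : has (fun s => h v == vertex_set s) (cell_list (dim v)).
      by apply/(has_nthP [::]); have [i ? ->] := hv v; exists i.
    by split; [rewrite /num /count_cells -has_find|apply/eqP; exact: (nth_find [::] hh)].
  exists num; split.
  - move=> v w vw nvw; apply: hinj.
    by rewrite (proj2 (numP v)) (proj2 (numP w)) vw nvw.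
  - by move=> v; case: (numP v).
  - move=> k i ik.
    have /andP[/andP[/andP[_ c20] un] /hasP[s sk st]] := cl1P _ _ ik.
    have : vertex_set s \in map vertex_set (dodecahedron_cells k) by apply: map_f.
    move=> /him[v vk hv']; exists v => //.
    have [nv hv2] := numP v.
    have /andP[/andP[/andP[_ c20'] un'] _] := cl1P _ _ nv.
    have := all_cellsP un nv.
    have E1 : vertex_set (cell_verts k i) = vertex_set (cell_verts (dim v) (num v)).
      by rewrite -hv2 hv' (vertex_set_eq st).
    rewrite /set_eq -(vertex_set_sub _ c20) -(vertex_set_sub _ c20') E1 subxx /=.
    by move=> /andP[_ /eqP].
  - move=> v w; rewrite hinc (proj2 (numP v)) (proj2 (numP w)) vertex_set_sub //.
    have [nv _] := numP v.
    by have /andP[/andP[/andP[_]]] := cl1P _ _ nv.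
pose h (v : C) := vertex_set (cell_verts (dim v) (num v)).
have c20 (v : C) : all (fun x => x < 20) (cell_verts (dim v) (num v)).
  by have /andP[/andP[/andP[_]]] := cl1P _ _ (numbering_lt nu v).
exists h; split.
- move=> v w hvw.
  have /andP[/andP[_ un] _] := cl1P _ _ (numbering_lt nu v).
  have := all_cellsP un (numbering_lt nu w).
  rewrite /set_eq -(vertex_set_sub _ (c20 v)) -(vertex_set_sub _ (c20 w)).
  rewrite -/(h v) -/(h w) hvw subxx /= => /andP[/eqP ? /eqP ?].
  exact: (numbering_inj nu).
- move=> k A; split=> [/mapP[s sk ->]|[v <- <-]].
    have k4 : k < 4 by case: k sk => [|[|[|[|]]]].
    have := cl2 k; rewrite mem_iota k4 => /(_ isT) /allP /(_ _ sk).
    move=> /(has_nthP [::])[i ik st].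
    have [v vk vi] := numbering_onto nu ik; exists v => //.
    by rewrite (vertex_set_eq st) /h vk vi.
  have /andP[_ /hasP[s sk st]] := cl1P _ _ (numbering_lt nu v).
  by rewrite /h -(vertex_set_eq st); exact: map_f.
- by move=> v w; rewrite (numbering_inc nu) /h vertex_set_sub.
Qed.

End Numbering.

(** * Search over the meridian circles *)

Definition star_table : seq (seq (nat * nat)) := Eval vm_compute in
  [seq [seq (e, v) | e <- iota 0 30,
          v <- [seq v <- iota 0 20 | [&& inc 0 u 1 e, inc 0 v 1 e & u != v]]]
    | u <- iota 0 20].
Definition star u := nth [::] star_table u.

Definition edge_faces_table : seq (seq nat) := Eval vm_compute in
  [seq [seq f <- iota 0 12 | inc 1 e 2 f] | e <- iota 0 30].
Definition edge_faces e := nth [::] edge_faces_table e.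

Definition vertex_faces_table : seq (seq nat) := Eval vm_compute in
  [seq [seq f <- iota 0 12 | inc 0 v 2 f] | v <- iota 0 20].
Definition vertex_faces v := nth [::] vertex_faces_table v.

Definition face_edges_table : seq (seq nat) := Eval vm_compute in
  [seq [seq e <- iota 0 30 | inc 1 e 2 f] | f <- iota 0 12].
Definition face_edges f := nth [::] face_edges_table f.

(* Conjunctions in the search are written with if, since the arguments of &&
   are evaluated eagerly. *)
Fixpoint flood (fuel : nat) (M todo seen : seq nat) : seq nat :=
  if fuel is k.+1 then
    if todo is f :: t then
      if f \in seen then flood k M t seen
      else flood k M ([seq g | e <- [seq e <- face_edges f | e \notin M],
                               g <- edge_faces e] ++ t) (f :: seen)
    else seen
  else seen.

(** The fuel 100 needs no separate justification: stopping too early could only make the coverage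
    check in [test_cycle] fail. *)
Definition side_faces (M : seq nat) (i : nat) : seq nat :=
  [seq f <- iota 0 12 | f \in flood 100 M [:: i] [::]].

Definition star_adj u v := has (fun s => s.2 == v) (star u).

Definition overlap (W E es : seq nat) : bool :=
  has (fun e => has (fun f => (f \in W) && (f \in edge_faces (head 0 es))) (edge_faces e)
             && has (fun g => (g \in E) && (g \in edge_faces (last 0 es))) (edge_faces e)) es.

Definition no_chord (M vs : seq nat) (n s : nat) : bool :=
  all (fun v => [|| v == n, v == s | all (fun t =>
    [|| t.1 \in M, t.2 == n, t.2 == s | t.2 \notin vs]) (star v)]) vs.

(** [Q] consists of the vertices strictly inside the hemisphere: a vertex off the cycle is on the
    same side as each of its faces. *)
Definition no_trap (vs W : seq nat) (s : nat) : bool :=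
  let Q := [seq v <- iota 0 20 | (v \notin vs) && has (mem W) (vertex_faces v)] in
  nilp Q || has (fun v => star_adj v s) Q.

Definition smaller (W E : seq nat) : seq nat := if size W <= size E then W else E.

(** The value 3 stands for every distance above 2; [conclusion] rejects it. *)
Definition distance (n s : nat) : nat :=
  if star_adj n s then 1
  else if has (fun t => star_adj t.2 s) (star n) then 2 else 3.

(** This is invoked at pole distance 2. The meridian distance is then three as soon as one meridian
    has three edges and, by the third clause, no path of two edges on the circle joins the poles. *)
Definition two_face_case (M W : seq nat) (n s a b : nat) : bool :=
  [&& size M == 8, (a == 3) || (b == 3),
    all (fun t => all (fun t' => [|| t.1 \notin M, t'.1 \notin M | t'.2 != s]) (star t.2)) (star n) &
    has (fun f => has (fun g => has (fun e =>
     [&& f != g, perm_eq W [:: f; g],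
      [seq a <- face_edges f | a \in face_edges g] == [:: e] &
      has (fun t => has (fun t' => (t'.2 == s) && ((t.1 == e) || (t'.1 == e)))
         (star t.2)) (star n)]) (iota 0 30)) (iota 0 12)) (iota 0 12)].

Definition conclusion (M W E : seq nat) (n s a b : nat) : bool :=
  let S := smaller W E in
  [&& 1 <= size S, size S <= distance n s, distance n s <= 2 &
   ((size S == 2) && (distance n s == 2)) ==> two_face_case M S n s a b].

(* A closed walk n -> s -> n is cut into the path p from n to s and the
   reverse q of the other path. *)
Definition test (M vs W E : seq nat) (n s : nat) (p q : seq nat) : bool :=
  if overlap W E p then
    if overlap W E (rev q) then
      if no_chord M vs n s then
        if no_trap vs E s then
          if no_trap vs W n then
            conclusion M W E n s (size p) (size q)
          else true
        else true
      else true
    else true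
  else true.

(** Edge 0 joins vertices 0 and 1, and faces 0 and 1 are the two pentagons at it, so the floods
    start on either side of the first edge of the walk. A walk that comes back along its first edge
    is no circle and is skipped. Every visited vertex except the final [n] is tried as South
    pole. *)
Definition test_cycle (n : nat) (w : seq (nat * nat)) : bool :=
  let M := unzip1 w in
  let vs := unzip2 w in
  if head 0 M == last 0 M then true else
  let A := side_faces M 0 in
  let B := side_faces M 1 in
  if all (fun f => if f \in A then true else f \in B) (iota 0 12) then
    all (fun k => let s := nth 0 vs k in
       if test M vs A B n s (take k.+1 M) (drop k.+1 M) then
         test M vs B A n s (take k.+1 M) (drop k.+1 M) else false) (iota 0 (size w).-1)
  else false.

Fixpoint forall_walks (k : nat) (P : seq (nat * nat) -> bool) (n : nat)
    (acc : seq (nat * nat)) (u : nat) : bool :=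
  if k is k'.+1 then
    all (fun t => if t.2 == n then P (rev (t :: acc))
                  else if t.2 \in unzip2 acc then true
                  else forall_walks k' P n (t :: acc) t.2) (star u)
  else true.

(** After the step from 0 to 1 a simple cycle on twenty vertices has at most 19 steps left, within
    the fuel 20. *)
Definition all_cycles_ok : bool := forall_walks 20 (test_cycle 0) 0 [:: (0, 1)] 1.

Lemma all_cycles_okP : all_cycles_ok.
Proof. by vm_compute. Qed.

(** * Templates *)

Section Digraph.
Context (R : realType) (X : topologicalType) (C : regular_cw R X).
Variables (s t : C -> C).
Hypothesis st : oriented s t.
Hypothesis acyc : forall u p, is_vertex u -> directed_path s t u p u -> p = [::].

Lemma incident_edge (e v : C) : is_edge e -> is_vertex v ->
  incident v e = (v == s e) || (v == t e).
Proof.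
move=> ee vv; have [sv tv ste bd] := st ee.
apply/idP/idP => [/asboolP ve|].
  have [x vx] := open_cell_neq0 v.
  have ne : v != e by apply: contraL ee => /eqP <-; rewrite /is_edge (eqP vv).
  have : (closure (open_cell e) `\` open_cell e) x.
    by split=> [|ex]; [exact: ve|move/eqP: ne; apply; exact: open_cell_inj vx ex].
  rewrite bd => -[sx|tx]; apply/orP; [left|right]; apply/eqP;
  [exact: open_cell_inj vx sx|exact: open_cell_inj vx tx].
move=> vst; apply/asboolP => x vx.
suff : (closure (open_cell e) `\` open_cell e) x by case.
by rewrite bd; case/orP: vst vx => /eqP ->; [left|right].
Qed.

Lemma directed_path_cat u p q v :
  directed_path s t u (p ++ q) v =
  directed_path s t u p (last u (map t p)) && directed_path s t (last u (map t p)) q v.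
Proof.
elim: p u => [|e p IH] u /=; first by rewrite eqxx.
by rewrite IH !andbA.
Qed.

Lemma directed_path_last u p v : directed_path s t u p v -> last u (map t p) = v.
Proof. by elim: p u => [|e p IH] u /=; [move/eqP|move=> /and3P[_ _ /IH]]. Qed.

Lemma directed_path_edges u p v : directed_path s t u p v -> all (@is_edge _ _ C) p.
Proof. by elim: p u => //= e p IH u /and3P[-> _ /IH]. Qed.

Lemma directed_path_srcs u p v : directed_path s t u p v ->
  rcons (map s p) v = u :: map t p.
Proof.
by elim: p u => [|e p IH] u /=; [move/eqP ->|move=> /and3P[_ /eqP <- /IH ->]].
Qed.

(** A repeated vertex would cut out a nonempty closed directed path. *)
Lemma directed_path_uniq u p v : is_vertex u -> directed_path s t u p v ->
  uniq (u :: map t p).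
Proof.
elim: p u => // e p IH u uu dp; rewrite cons_uniq; apply/andP; split; last first.
  have /and3P[ee _ dp'] := dp; apply: IH dp'.
  by case: (st ee).
apply/negP => /mapP[f /path.splitPr-fp def_u].
case: fp dp => p1 p2; rewrite -cat_rcons directed_path_cat map_rcons last_rcons -def_u.
by move=> /andP[/(acyc uu)]; case: p1.
Qed.

(** From a vertex of [Q] there would be directed paths of every length. One with [#|C|] edges visits
    [#|C|.+1] vertices, which are distinct by acyclicity. *)
Lemma no_sink (Q : pred C) :
  (forall v, Q v -> is_vertex v) ->
  (forall v, Q v -> exists e, [/\ is_edge e, s e = v & Q (t e)]) ->
  forall v, ~ Q v.
Proof.
move=> Qv Qs v Qvv.
have P k : forall v, Q v -> exists2 p, size p = k & exists w, directed_path s t v p w.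
  elim: k => [|k IH] {Qvv}v Qvv; first by exists [::] => //; exists v => /=.
  have [e [ee se /IH[p <- [w dp]]]] := Qs v Qvv.
  by exists (e :: p) => //; exists w; rewrite /= ee se eqxx.
have [p sp [w dp]] := P #|C| v Qvv.
have /card_uniqP := directed_path_uniq (Qv v Qvv) dp.
rewrite /= size_map sp => E; have := max_card (mem (v :: map t p)).
by rewrite E ltnn.
Qed.

Lemma no_source (Q : pred C) :
  (forall v, Q v -> is_vertex v) ->
  (forall v, Q v -> exists e, [/\ is_edge e, t e = v & Q (s e)]) ->
  forall v, ~ Q v.
Proof.
move=> Qv Qs v Qvv.
have P k : forall v, Q v -> exists2 p, size p = k & exists2 w, Q w & directed_path s t w p v.
  elim: k => [|k IH] {Qvv}v Qvv; first by exists [::] => //; exists v => //=.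
  have [e [ee te /IH[p <- [w Qw dp]]]] := Qs v Qvv.
  exists (rcons p e); first by rewrite size_rcons.
  exists w => //; rewrite -cats1 directed_path_cat /= ee te eqxx (directed_path_last dp).
  by rewrite dp eqxx.
have [p sp [w Qw dp]] := P #|C| v Qvv.
have /card_uniqP := directed_path_uniq (Qv w Qw) dp.
rewrite /= size_map sp => E; have := max_card (mem (w :: map t p)).
by rewrite E ltnn.
Qed.

End Digraph.

Section Template.
Context (R : realType) (X : topologicalType) (C : regular_cw R X).
Variable T : template C.
Local Notation N := (north T).
Local Notation S := (south T).
Local Notation s := (src T).
Local Notation t := (tgt T).
Local Notation we := (WE T).
Local Notation ew := (EW T).

Lemma template_oriented : oriented s t.
Proof. by case: (poles_bipolar T). Qed.

Lemma template_acyclic u p : is_vertex u -> directed_path s t u p u -> p = [::].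
Proof. by case: (poles_bipolar T) => _ + _ _; exact. Qed.

Lemma north_vertex : is_vertex N.
Proof. by case: (poles_bipolar T) => _ _ /(_ N)[_ /(_ erefl)[]]. Qed.

Lemma south_vertex : is_vertex S.
Proof. by case: (poles_bipolar T) => _ _ _ /(_ S)[_ /(_ erefl)[]]. Qed.

Lemma north_source e : is_edge e -> t e != N.
Proof.
by move=> ee; have [_ _ /(_ N)[_ /(_ erefl)[_ h]] _] := poles_bipolar T; apply/eqP/eqP/h.
Qed.

Lemma south_sink e : is_edge e -> s e != S.
Proof.
by move=> ee; have [_ _ _ /(_ S)[_ /(_ erefl)[_ h]]] := poles_bipolar T; apply/eqP/eqP/h.
Qed.

Lemma exists_in_edge v : is_vertex v -> v != N -> exists2 e, is_edge e & t e = v.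
Proof.
move=> vv vN; case: (poles_bipolar T) => _ _ /(_ v)[h _] _.
apply: contrapT => ne; move/eqP: vN; apply; apply: h; split=> // e ee.
by apply/eqP => te; apply: ne; exists e.
Qed.

Lemma exists_out_edge v : is_vertex v -> v != S -> exists2 e, is_edge e & s e = v.
Proof.
move=> vv vS; case: (poles_bipolar T) => _ _ _ /(_ v)[h _].
apply: contrapT => ne; move/eqP: vS; apply; apply: h; split=> // e ee.
by apply/eqP => te; apply: ne; exists e.
Qed.

(** With equal poles acyclicity makes [WE] empty, whereas the overlap condition provides a first
    edge of it. *)
Lemma poles_neq : N != S.
Proof.
apply/eqP => NS; have [e0 [e1 [f [g [[fe _] _ _]]]]] := WE_overlap T.
have := WE_path T; rewrite -NS => /(template_acyclic north_vertex) w0.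
by move: fe; rewrite /first_edge w0.
Qed.

Definition on_meridian (c : C) : bool := has (incident c) (we ++ ew).
Definition off_meridian (c : C) : bool := (c != Defs.ball T) && ~~ on_meridian c.

Lemma sub_meridians (c : C) :
  open_cell c `<=` support we `|` support ew <-> on_meridian c.
Proof.
rewrite !support_cellsE -bigcup_setU subset_cellsP /= /on_meridian has_cat.
by split=> [/orP|/orP].
Qed.

Local Notation U := (\bigcup_(c in [set c | off_meridian c]) open_cell c).

Lemma hemisphereE :
  [set connected_component U x | x in U] = [set west T; east T].
Proof.
have := hemispheres T; rewrite /= complement_meridianE.
suff -> : [set c : C | c != Defs.ball T /\ ~~ has (incident c) (we ++ ew)] =
  [set c | off_meridian c] by [].
by apply/seteqP; split=> c /=; rewrite /off_meridian /on_meridian => /andP.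
Qed.

Lemma hemisphere_component (H : set X) : H = west T \/ H = east T ->
  exists2 x, U x & H = connected_component U x.
Proof.
move=> HH; have : [set west T; east T] H by [].
by rewrite -hemisphereE => -[x Ux <-]; exists x.
Qed.

(** Both are components of the same set, and components that share a point coincide. *)
Lemma hemispheres_disjoint x : west T x -> ~ east T x.
Proof.
have [y Uy wE] := hemisphere_component (or_introl erefl).
have [z Uz eE] := hemisphere_component (or_intror erefl).
rewrite wE eE => yx zx; apply: (@hemispheres_neq _ _ _ T); rewrite wE eE.
rewrite (same_connected_component yx).
by rewrite (same_connected_component zx).
Qed.

Lemma connected_hemisphere (A : set X) (H : set X) : H = west T \/ H = east T ->
  connected A -> A `<=` U -> (A `&` H) !=set0 -> A `<=` H.
Proof.
move=> /hemisphere_component[y Uy ->] cA AU [x [Ax yx]].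
rewrite (same_connected_component yx).
exact: connected_component_max.
Qed.

Lemma off_meridian_sub (c : C) : off_meridian c -> open_cell c `<=` U.
Proof. by move=> oc; apply/subset_cellsP. Qed.

Lemma off_meridian_side (c : C) : off_meridian c ->
  open_cell c `<=` west T \/ open_cell c `<=` east T.
Proof.
move=> oc; have [x cx] := open_cell_neq0 c.
have Ux := off_meridian_sub oc cx.
have : [set connected_component U x | x in U] (connected_component U x) by exists x.
rewrite hemisphereE => -[] HE; [left|right]; rewrite -HE;
  by apply: connected_component_max => //;
  [exact: off_meridian_sub|exact: open_cell_connected].
Qed.

(** The union of the two cells is connected and avoids the meridians, so it stays in one component.
    Through this lemma sides propagate from cell to cell. *)
Lemma incident_hemisphere (H : set X) (c d : C) : H = west T \/ H = east T ->
  off_meridian c -> off_meridian d -> incident d c ->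
  (open_cell c `<=` H) <-> (open_cell d `<=` H).
Proof.
move=> HH oc od dc; have cn := connected_incident dc.
have sub : open_cell c `|` open_cell d `<=` U.
  by move=> x [|]; apply: off_meridian_sub.
have [x cx] := open_cell_neq0 c; have [y dy] := open_cell_neq0 d.
split=> h z hz; apply: (connected_hemisphere HH cn sub) => //;
  [exists x|right|exists y|left] => //; split=> //;
  by [left|right|exact: h].
Qed.

Lemma hemisphere_cell (H : set X) : H = west T \/ H = east T ->
  exists2 c, off_meridian c & open_cell c `<=` H.
Proof.
move=> HH; have [x [c /= oc cx] HE] := hemisphere_component HH.
exists c => //; apply: (connected_hemisphere HH) => //.
- exact: open_cell_connected.
- exact: off_meridian_sub.
- exists x; split=> //; rewrite HE; apply: connected_component_refl.
  by exists c.
Qed.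

End Template.

(** * Certification of the incidence tables and their transport to a numbered complex *)

Definition tables_ok : bool :=
  [&& all (fun u => all (fun t => [&& t.1 < 30, t.2 < 20, inc 0 u 1 t.1, inc 0 t.2 1 t.1 & u != t.2])
        (star u)) (iota 0 20),
      all (fun e => all (fun u => all (fun v =>
        [&& inc 0 u 1 e, inc 0 v 1 e & u != v] ==> ((e, v) \in star u))
        (iota 0 20)) (iota 0 20)) (iota 0 30),
      all (fun f => all (fun e => ((f \in edge_faces e) == inc 1 e 2 f)
           && ((e \in face_edges f) == inc 1 e 2 f)) (iota 0 30)) (iota 0 12),
      all (fun f => all (fun v => (f \in vertex_faces v) == inc 0 v 2 f) (iota 0 20)) (iota 0 12) &
      all (fun e => all (fun f => f < 12) (edge_faces e)) (iota 0 30)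
      && all (fun f => all (fun e => e < 30) (face_edges f)) (iota 0 12)
      && all (fun v => has (fun f => f < 12) (vertex_faces v)) (iota 0 20)].

Lemma tables_okP : tables_ok.
Proof. by vm_compute. Qed.

Lemma all_iota (P : pred nat) n i : all P (iota 0 n) -> i < n -> P i.
Proof. by move=> /allP h ilt; apply: h; rewrite mem_iota. Qed.

Lemma mem_star u e v : u < 20 -> (e, v) \in star u ->
  [&& e < 30, v < 20, inc 0 u 1 e, inc 0 v 1 e & u != v].
Proof.
by have /and5P[h _ _ _ _] := tables_okP => u20; move/allP: (all_iota h u20); exact.
Qed.

Lemma star_mem u e v : u < 20 -> v < 20 -> e < 30 ->
  inc 0 u 1 e -> inc 0 v 1 e -> u != v -> (e, v) \in star u.
Proof.
have /and5P[_ h _ _ _] := tables_okP => u20 v20 e30 ue ve uv.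
by move: (all_iota (all_iota (all_iota h e30) u20) v20); rewrite ue ve uv.
Qed.

Lemma mem_edge_faces e f : e < 30 -> f < 12 -> (f \in edge_faces e) = inc 1 e 2 f.
Proof.
have /and5P[_ _ h _ _] := tables_okP => e30 f12.
by move: (all_iota (all_iota h f12) e30) => /andP[/eqP].
Qed.

Lemma mem_face_edges e f : e < 30 -> f < 12 -> (e \in face_edges f) = inc 1 e 2 f.
Proof.
have /and5P[_ _ h _ _] := tables_okP => e30 f12.
by move: (all_iota (all_iota h f12) e30) => /andP[_ /eqP].
Qed.

Lemma mem_vertex_faces v f : v < 20 -> f < 12 -> (f \in vertex_faces v) = inc 0 v 2 f.
Proof.
have /and5P[_ _ _ h _] := tables_okP => v20 f12.
by move: (all_iota (all_iota h f12) v20) => /eqP.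
Qed.

Lemma edge_faces_lt e f : e < 30 -> f \in edge_faces e -> f < 12.
Proof.
have /and5P[_ _ _ _ /andP[/andP[h _] _]] := tables_okP => e30.
by move: (all_iota h e30) => /allP; exact.
Qed.

Lemma face_edges_lt e f : f < 12 -> e \in face_edges f -> e < 30.
Proof.
have /and5P[_ _ _ _ /andP[/andP[_ h] _]] := tables_okP => e30.
by move: (all_iota h e30) => /allP; exact.
Qed.

Lemma cell_has_face_table :
  all_cells (fun k i => (k < 3) ==> has (fun f => inc k i 2 f) (iota 0 12)) &&
  all_cells (fun k i => all_cells (fun l j => inc k i l j ==> ((k < l) || ((k == l) && (i == j))))).
Proof. by vm_compute. Qed.

Lemma inc_dim k i l j : i < count_cells k -> j < count_cells l -> inc k i l j ->
  (k < l) || ((k == l) && (i == j)).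
Proof.
have /andP[_ h] := cell_has_face_table => ik jl kl.
by move: (all_cellsP (all_cellsP h ik) jl); rewrite kl.
Qed.

Lemma cell_has_face k i : k < 3 -> i < count_cells k ->
  exists2 f, f < 12 & inc k i 2 f.
Proof.
have /andP[h _] := cell_has_face_table => k3 ik.
move: (all_cellsP h ik); rewrite k3 => /hasP[f]; rewrite mem_iota => ? ?.
by exists f.
Qed.

Section NumberedCells.
Context (R : realType) (X : topologicalType) (C : regular_cw R X).
Variables (num : C -> nat).
Hypothesis nu : numbering num.

Lemma num_vertex (v : C) : is_vertex v -> num v < 20.
Proof. by move=> /eqP vv; have := numbering_lt nu v; rewrite vv. Qed.

Lemma num_edge (e : C) : is_edge e -> num e < 30.
Proof. by move=> /eqP ee; have := numbering_lt nu e; rewrite ee. Qed.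

Lemma num_face (f : C) : is_face f -> num f < 12.
Proof. by move=> /eqP ff; have := numbering_lt nu f; rewrite ff. Qed.

Lemma vertex_num i : i < 20 -> exists2 v : C, is_vertex v & num v = i.
Proof. by move=> h; have [v /eqP ? ?] := numbering_onto nu (k := 0) h; exists v. Qed.

Lemma edge_num i : i < 30 -> exists2 v : C, is_edge v & num v = i.
Proof. by move=> h; have [v /eqP ? ?] := numbering_onto nu (k := 1) h; exists v. Qed.

Lemma face_num i : i < 12 -> exists2 v : C, is_face v & num v = i.
Proof. by move=> h; have [v /eqP ? ?] := numbering_onto nu (k := 2) h; exists v. Qed.

Lemma numbering_eq (c d : C) : dim c = dim d -> (num c == num d) = (c == d).
Proof. by move=> cd; apply/eqP/eqP => [/(numbering_inj nu cd)|->]. Qed.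

Lemma num_inc_dims k l (c d : C) : dim c == k -> dim d == l ->
  incident c d = inc k (num c) l (num d).
Proof. by move=> /eqP <- /eqP <-; exact: numbering_inc. Qed.

Lemma incident_dim (c d : C) : incident c d -> c = d \/ dim c < dim d.
Proof.
rewrite (numbering_inc nu) => /(inc_dim (numbering_lt nu c) (numbering_lt nu d)).
by case/orP => [?|/andP[/eqP cd /eqP nn]]; [right|left; exact: (numbering_inj nu)].
Qed.

Lemma star_joins (e u v : C) : joins e u v -> (num e, num v) \in star (num u).
Proof.
move=> /and5P[ee uu vv uv /andP[ue ve]].
apply: star_mem; rewrite ?num_vertex ?num_edge ?numbering_eq ?(eqP uu) ?(eqP vv) //.
  by rewrite -(num_inc_dims uu ee).
by rewrite -(num_inc_dims vv ee).
Qed.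

Lemma joins_star (u : C) i j : is_vertex u -> (i, j) \in star (num u) ->
  exists e v, [/\ joins e u v, num e = i & num v = j].
Proof.
move=> uu /(mem_star (num_vertex uu)) /and5P[/edge_num[e ee <-] /vertex_num[v vv <-] ue ve uv].
exists e, v; split=> //; apply/and5P; split=> //.
  by move: uv; rewrite numbering_eq // (eqP uu) (eqP vv).
by rewrite (num_inc_dims uu ee) (num_inc_dims vv ee) ue ve.
Qed.

Lemma adjacent_num (u v : C) : is_vertex u ->
  adjacent_via predT u v = is_vertex v && star_adj (num u) (num v).
Proof.
move=> uu; apply/existsP/andP => [[e /= j]|[vv /hasP[[i j] ij /= /eqP jv]]].
  have /and5P[_ _ vv _ _] := j; split=> //.
  by apply/hasP; exists (num e, num v) => //; exact: star_joins.
have [e [w [j1 _ wj]]] := joins_star uu ij.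
have /and5P[_ _ ww _ _] := j1.
by exists e; rewrite /= -(numbering_inj nu _ (etrans wj jv)) // (eqP vv) (eqP ww).
Qed.

Lemma cells_in_size k (H : set X) (W : seq nat) :
  uniq W -> (forall i, i \in W -> i < count_cells k) ->
  (forall c : C, dim c == k -> (num c \in W) <-> open_cell c `<=` H) ->
  #|cells_in C k H| = size W.
Proof.
move=> uW ltW WH; rewrite cardE -(size_map num); apply/perm_size/uniq_perm => //.
  rewrite map_inj_in_uniq ?enum_uniq // => c d.
  rewrite !mem_enum !inE => /andP[/eqP ck _] /andP[/eqP dk _].
  by apply: (numbering_inj nu); rewrite ck dk.
move=> i; apply/mapP/idP => [[c]|iW].
  by rewrite mem_enum inE => /andP[ck /asboolP cH] ->; apply/WH.
have [c ck ci] := numbering_onto nu (ltW i iW); exists c => //.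
rewrite mem_enum inE ck eqxx; apply/asboolP/WH; first exact/eqP.
by rewrite ci.
Qed.

End NumberedCells.

(** * Necessary conditions *)

(** [edge_dist] only tries lengths below [#|C|], whence the last hypothesis. *)
Lemma edge_dist_eq (R : realType) (X : topologicalType) (C : regular_cw R X)
    (A : pred C) (u v : C) (p : seq C) :
  path (adjacent_via A) u p -> last u p = v ->
  (forall q, size q < size p -> path (adjacent_via A) u q -> last u q != v) ->
  size p < #|C| -> edge_dist A u v = size p.
Proof.
move=> up lp hq ltC; rewrite /edge_dist.
have -> : iota 0 #|C| = iota 0 (size p) ++ size p :: iota (size p).+1 (#|C| - (size p).+1).
  by rewrite -[in LHS](subnKC ltC) addSnnS iotaD /= add0n.
rewrite find_cat size_iota /=; case: ifP => [/hasP[k]|_].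
  rewrite mem_iota add0n => /andP[_ klt] /existsP[q /andP[uq /eqP lq]].
  by have := hq q; rewrite size_tuple lq eqxx => /(_ klt uq).
case: ifP => [_|/negbT/existsPn/(_ (in_tuple p))]; first by rewrite addn0.
by rewrite /= up lp eqxx.
Qed.

Fixpoint is_walk (u : nat) (w : seq (nat * nat)) : bool :=
  if w is t :: w' then (t \in star u) && is_walk t.2 w' else true.

Lemma is_walk_cat u w1 w2 :
  is_walk u (w1 ++ w2) = is_walk u w1 && is_walk (last u (unzip2 w1)) w2.
Proof. by elim: w1 u => //= t w1 IH u; rewrite IH andbA. Qed.

(** Since the visited vertices are distinct and [n] is the last of them, the walk meets neither
    cut-off of the search before its end: it returns to [n] only once and never revisits a vertex of
    [acc]. *)
Lemma forall_walksP k P n acc u w : forall_walks k P n acc u ->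
  is_walk u w -> w != [::] -> last u (unzip2 w) = n ->
  uniq (unzip2 acc ++ unzip2 w) -> size w <= k -> P (rev acc ++ w).
Proof.
elim: k acc u w => [|k IH] acc u [|t w] //= /allP h /andP[tu tw] _ lw uaw szw.
have := h t tu; case: (eqVneq t.2 n) => [tn|tn].
  suff -> : w = [::] by rewrite rev_cons -cats1.
  case: w {szw tw h} lw uaw => //= t' w lw; rewrite cat_uniq => /and3P[_ _ /=].
  by rewrite tn -lw mem_last.
case: ifP => [tacc|_ /IH].
  by move: uaw; rewrite cat_uniq => /and3P[_ /=]; rewrite tacc.
move=> /(_ _ tw) h'; rewrite -cat_rcons -rev_cons; apply: h' => //.
  by apply: contraNneq tn => w0; rewrite -lw w0.
by move: uaw; rewrite -(cat1s t.2) uniq_catCA.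
Qed.

(** This is soundness only, for any fuel: what is preserved by crossing edges outside [M] holds for
    every face reached. That enough faces are reached is checked by computation. *)
Lemma floodP (P : nat -> Prop) k M todo seen :
  (forall f, P f -> f < 12) ->
  (forall f e g, P f -> e \in face_edges f -> e \notin M -> g \in edge_faces e -> P g) ->
  (forall f, f \in todo -> P f) -> (forall f, f \in seen -> P f) ->
  forall f, f \in flood k M todo seen -> P f.
Proof.
move=> P12 Pcl; elim: k todo seen => [|k IH] [|f0 todo] seen //= Pt Ps.
case: ifP => _; first by apply: IH => // f ft; apply: Pt; rewrite inE ft orbT.
have P0 : P f0 by apply: Pt; rewrite mem_head.
apply: IH => f.
  rewrite mem_cat => /orP[/allpairsPdep[e [g [+ ge ->]]]|ft]; last first.
    by apply: Pt; rewrite inE ft orbT.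
  by rewrite mem_filter => /andP[eM ef]; apply: Pcl P0 ef eM ge.
by rewrite inE => /orP[/eqP ->|/Ps].
Qed.

Section Necessity.
Context (R : realType) (X : topologicalType) (C : regular_cw R X).
Variables (T : template C) (num : C -> nat).
Hypothesis nu : numbering num.
Local Notation N := (north T).
Local Notation S := (south T).
Local Notation s := (src T).
Local Notation t := (tgt T).
Local Notation we := (WE T).
Local Notation ew := (EW T).

Lemma meridian_edges : all (@is_edge _ _ C) (we ++ ew).
Proof.
by rewrite all_cat (directed_path_edges (WE_path T)) (directed_path_edges (EW_path T)).
Qed.

Lemma ball_neq (c : C) : dim c < 3 -> c != Defs.ball T.
Proof. by apply: contraTneq => ->; rewrite ball_dim. Qed.

Lemma face_off (f : C) : is_face f -> off_meridian T f.
Proof.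
move=> /eqP f2; rewrite /off_meridian ball_neq ?f2 //=; apply/hasPn => e /(allP meridian_edges) /eqP e1.
by apply/negP => /(incident_dim nu)[fe|]; [move: f2; rewrite fe e1|rewrite f2 e1].
Qed.

Lemma edge_on (e : C) : is_edge e -> on_meridian T e = (e \in we ++ ew).
Proof.
move=> /eqP e1; apply/hasP/idP => [[d /[dup] dm /(allP meridian_edges) /eqP d1]|em]; last first.
  by exists e => //; exact: incident_refl.
by move=> /(incident_dim nu)[->//|]; rewrite e1 d1.
Qed.

Lemma edge_off (e : C) : is_edge e -> off_meridian T e = (e \notin we ++ ew).
Proof. by move=> ee; rewrite /off_meridian ball_neq ?(eqP ee) //= edge_on. Qed.

Lemma vertex_off (v : C) : is_vertex v -> off_meridian T v = ~~ on_meridian T v.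
Proof. by move=> vv; rewrite /off_meridian ball_neq ?(eqP vv). Qed.

Definition hemi_list (H : set X) (A : seq nat) : Prop :=
  [/\ uniq A, forall i, i \in A -> i < 12 &
      forall f : C, is_face f -> (num f \in A) <-> open_cell f `<=` H].

(** A cell off the meridians shares its side with every face that contains it, and below dimension 3
    there is such a face. So a list of faces describes the whole hemisphere. *)
Lemma has_faces_hemi (H : set X) A (c : C) fs : H = west T \/ H = east T ->
  hemi_list H A -> off_meridian T c -> dim c < 3 ->
  (forall f : C, is_face f -> (num f \in fs) = incident c f) ->
  has (mem A) fs <-> open_cell c `<=` H.
Proof.
move=> HH [uA ltA AH] oc c2 fsP; split=> [/hasP[i ifs /= iA]|cH].
  have [f ff fi] := face_num nu (ltA i iA).
  have fc : incident c f by rewrite -fsP // fi.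
  by apply/(incident_hemisphere HH (face_off ff) oc fc)/AH => //; rewrite fi.
have [i i12 ci] := cell_has_face c2 (numbering_lt nu c).
have [f ff fi] := face_num nu i12.
have fc : incident c f by rewrite (numbering_inc nu) (eqP ff) fi.
apply/hasP; exists i; first by rewrite -fi fsP.
by rewrite /= -fi; apply/AH => //; apply/(incident_hemisphere HH (face_off ff) oc fc).
Qed.

Lemma vertex_hemi (H : set X) A (v : C) : H = west T \/ H = east T ->
  hemi_list H A -> is_vertex v -> ~~ on_meridian T v ->
  has (mem A) (vertex_faces (num v)) <-> open_cell v `<=` H.
Proof.
move=> HH AH vv ov; apply: has_faces_hemi => //; rewrite ?vertex_off ?(eqP vv) //.
move=> f ff; rewrite (num_inc_dims nu vv ff) mem_vertex_faces //;
  [exact: num_vertex nu _ _|exact: num_face nu _ _].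
Qed.

Lemma overlap_necessary W E A B p : hemi_list W A -> hemi_list E B ->
  all (@is_edge _ _ C) p -> pole_faces_overlap W E p -> overlap A B (map num p).
Proof.
move=> [_ _ AW] [_ _ BE] /allP pe [e0 [e1 [f [g [[]]]]]].
rewrite /first_edge /last_edge => h0 [[ff fW e0f] _] [h1 [[gg gE e1g] _]] [e [ep ef eg]].
have -> : overlap A B (map num p) =
  has (fun e => has (fun f => (f \in A) && (f \in edge_faces (num e0))) (edge_faces e)
             && has (fun g => (g \in B) && (g \in edge_faces (num e1))) (edge_faces e)) (map num p).
  rewrite /overlap; have -> : head 0 (map num p) = num e0 by case: p h0 {pe ep h1} => //= a p [->].
  suff -> : last 0 (map num p) = num e1 by [].
  by case/lastP: p h1 {pe ep h0} => //= p a; rewrite rev_rcons map_rcons last_rcons => -[->].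
have e0p : e0 \in p by case: p h0 {pe ep h1} => //= a p [->]; rewrite mem_head.
have e1p : e1 \in p by case/lastP: p h1 {pe ep h0 e0p} => //= p a; rewrite rev_rcons mem_rcons => -[->]; rewrite mem_head.
have inc_faces d h : is_edge d -> is_face h -> incident d h -> num h \in edge_faces (num d).
  move=> dd hh dh; rewrite mem_edge_faces -?(num_inc_dims nu dd hh) //;
  [exact: num_edge nu _ _|exact: num_face nu _ _].
apply/hasP; exists (num e); first exact: map_f.
apply/andP; split; apply/hasP.
  exists (num f); first by apply: inc_faces => //; exact: pe.
  by rewrite inc_faces ?andbT //; [apply/AW|exact: pe].
exists (num g); first by apply: inc_faces => //; exact: pe.
by rewrite inc_faces ?andbT //; [apply/BE|exact: pe].
Qed.

Definition meridian_list (M : seq nat) :=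
  forall e : C, is_edge e -> (num e \in M) = (e \in we ++ ew).

Definition meridian_vertices (vs : seq nat) :=
  (forall i, i \in vs -> i < 20) /\
  (forall v : C, is_vertex v -> (num v \in vs) = on_meridian T v).

(** A chord in W would have both of its ends as target, a chord in E both as source, although its
    ends differ. *)
Lemma no_chord_necessary M vs : meridian_list M -> meridian_vertices vs ->
  no_chord M vs (num N) (num S).
Proof.
move=> MP [vs20 vsP]; apply/allP => i ivs; have [v vv vi] := vertex_num nu (vs20 i ivs).
have vN : (i == num N) = (v == N).
  by rewrite -vi (numbering_eq nu) // (eqP vv) (eqP (north_vertex T)).
have vS : (i == num S) = (v == S).
  by rewrite -vi (numbering_eq nu) // (eqP vv) (eqP (south_vertex T)).
rewrite vN vS; case: eqVneq => // nvN; case: eqVneq => //= nvS.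
rewrite -vi in ivs *; apply/allP => -[j k] jk /=.
have [e [w [jn ej wk]]] := joins_star nu vv jk.
have /and5P[ee _ ww vw /andP[ve we']] := jn.
rewrite -ej -wk MP // !(numbering_eq nu) ?(eqP ww) ?(eqP (north_vertex T)) ?(eqP (south_vertex T)) //.
rewrite vsP // in ivs.
case: (boolP (e \in we ++ ew)) => //= em; case: eqVneq => // nwN; case: eqVneq => //= nwS.
rewrite vsP //; apply/negP => won.
have := off_meridian_side (T := T) (c := e); rewrite edge_off // => /(_ em)[eW|eE].
  have te := west_towards ee eW vv nvN nvS (proj2 (sub_meridians T v) ivs) ve.
  have te' := west_towards ee eW ww nwN nwS (proj2 (sub_meridians T w) won) we'.
  by move: vw; rewrite -te -te' eqxx.
have te := east_away ee eE vv nvN nvS (proj2 (sub_meridians T v) ivs) ve.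
have te' := east_away ee eE ww nwN nwS (proj2 (sub_meridians T w) won) we'.
by move: vw; rewrite -te -te' eqxx.
Qed.

Lemma pole_on : on_meridian T N /\ on_meridian T S.
Proof.
have := meridians_disjoint T; rewrite !support_cellsE setI_cells.
move=> /esym h; split; rewrite /on_meridian has_cat.
  have [x Nx] := open_cell_neq0 N.
  have : (open_cell N `|` open_cell S) x by left.
  by rewrite h => /(cells_in_subset Nx)[/= -> _].
have [x Sx] := open_cell_neq0 S.
have : (open_cell N `|` open_cell S) x by right.
by rewrite h => /(cells_in_subset Sx)[/= -> _].
Qed.

Lemma off_edge_of_off_vertex (e v : C) : is_edge e -> is_vertex v -> incident v e ->
  ~~ on_meridian T v -> e \notin we ++ ew.
Proof.
move=> ee vv ve; apply: contra => em.
by apply/hasP; exists e.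
Qed.

(* An interior vertex set of a hemisphere with no edge to the pole S (resp. from
   the pole N) would be closed under successors (resp. predecessors). *)
Lemma no_trap_south B vs : hemi_list (east T) B -> meridian_vertices vs ->
  no_trap vs B (num S).
Proof.
move=> BE [vs20 vsP]; rewrite /no_trap.
set Q := [seq v <- _ | _]; apply/orP; case: (boolP (nilp Q)) => [|nQ]; [by left|right].
apply/negPn/negP => /hasPn noS.
have QP (v : C) : is_vertex v -> (num v \in Q) <-> (~~ on_meridian T v) /\ open_cell v `<=` east T.
  move=> vv; rewrite mem_filter mem_iota leq0n /= (num_vertex nu vv) andbT vsP //.
  split=> [/andP[ov]|[ov]]; first by move=> /(vertex_hemi (or_intror erefl) BE vv ov).
  by rewrite ov /= => /(vertex_hemi (or_intror erefl) BE vv ov).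
have [i iQ] : exists i, i \in Q by case: (Q) nQ => // i q _; exists i; rewrite mem_head.
have i20 : i < 20 by move: iQ; rewrite mem_filter mem_iota => /andP[_].
have [v0 vv0 v0i] := vertex_num nu i20.
have trap := no_sink (template_oriented T) (@template_acyclic _ _ _ T)
  (Q := fun v => is_vertex v && (num v \in Q)).
apply: (trap _ _ v0) => [v /andP[]//|v /andP[vv vQ]|]; last by rewrite vv0 v0i.
have /(QP v vv)[ov vE] := vQ.
have vS : v != S by apply: contraNneq ov => ->; case: pole_on.
have [e ee se] := exists_out_edge vv vS; exists e; split=> //.
have [_ tv ste _] := template_oriented T ee.
have ve : incident v e by rewrite (incident_edge (template_oriented T)) // se eqxx.
have te : incident (t e) e by rewrite (incident_edge (template_oriented T)) // eqxx orbT.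
rewrite tv; apply/QP => //.
have oe := off_edge_of_off_vertex ee vv ve ov.
have eE : open_cell e `<=` east T.
  apply/(incident_hemisphere (or_intror erefl) _ _ ve) => //; first by rewrite edge_off.
  by rewrite vertex_off.
have tS : t e != S.
  apply: contraNneq (noS _ vQ) => tS; apply/hasP; exists (num e, num S) => //.
  by apply: star_joins => //; rewrite /joins ee vv south_vertex vS ve -tS.
(* On the meridians the target of [e] would be neither [N], which no edge enters, nor [S]; then
   [east_away] would make it the source of [e] as well. *)
have ot : ~~ on_meridian T (t e).
  apply/negP => ot; have := east_away ee eE tv (north_source T ee) tS (proj2 (sub_meridians T _) ot) te.
  by move/eqP: ste.
split=> //; apply/(incident_hemisphere (or_intror erefl) _ _ te) => //; first by rewrite edge_off.
by rewrite vertex_off.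
Qed.

Lemma no_trap_north A vs : hemi_list (west T) A -> meridian_vertices vs ->
  no_trap vs A (num N).
Proof.
move=> BE [vs20 vsP]; rewrite /no_trap.
set Q := [seq v <- _ | _]; apply/orP; case: (boolP (nilp Q)) => [|nQ]; [by left|right].
apply/negPn/negP => /hasPn noN.
have QP (v : C) : is_vertex v -> (num v \in Q) <-> (~~ on_meridian T v) /\ open_cell v `<=` west T.
  move=> vv; rewrite mem_filter mem_iota leq0n /= (num_vertex nu vv) andbT vsP //.
  split=> [/andP[ov]|[ov]]; first by move=> /(vertex_hemi (or_introl erefl) BE vv ov).
  by rewrite ov /= => /(vertex_hemi (or_introl erefl) BE vv ov).
have [i iQ] : exists i, i \in Q by case: (Q) nQ => // i q _; exists i; rewrite mem_head.
have i20 : i < 20 by move: iQ; rewrite mem_filter mem_iota => /andP[_].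
have [v0 vv0 v0i] := vertex_num nu i20.
have trap := no_source (template_oriented T) (@template_acyclic _ _ _ T)
  (Q := fun v => is_vertex v && (num v \in Q)).
apply: (trap _ _ v0) => [v /andP[]//|v /andP[vv vQ]|]; last by rewrite vv0 v0i.
have /(QP v vv)[ov vW] := vQ.
have vN : v != N by apply: contraNneq ov => ->; case: pole_on.
have [e ee te] := exists_in_edge vv vN; exists e; split=> //.
have [sv _ ste _] := template_oriented T ee.
have ve : incident v e by rewrite (incident_edge (template_oriented T)) // te eqxx orbT.
have se : incident (s e) e by rewrite (incident_edge (template_oriented T)) // eqxx.
rewrite sv; apply/QP => //.
have oe := off_edge_of_off_vertex ee vv ve ov.
have eW : open_cell e `<=` west T.
  apply/(incident_hemisphere (or_introl erefl) _ _ ve) => //; first by rewrite edge_off.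
  by rewrite vertex_off.
have sN : s e != N.
  apply: contraNneq (noN _ vQ) => sN; apply/hasP; exists (num e, num N) => //.
  by apply: star_joins => //; rewrite /joins ee vv north_vertex vN ve -sN.
have os : ~~ on_meridian T (s e).
  apply/negP => os; have := west_towards ee eW sv sN (south_sink T ee) (proj2 (sub_meridians T _) os) se.
  by move/eqP: ste => ste te'; apply: ste.
split=> //; apply/(incident_hemisphere (or_introl erefl) _ _ se) => //; first by rewrite edge_off.
by rewrite vertex_off.
Qed.

(** [test] is an implication from necessary conditions to [conclusion]; a template meets all of the
    conditions. *)
Lemma test_necessary M vs A B p q : meridian_list M -> meridian_vertices vs ->
  hemi_list (west T) A -> hemi_list (east T) B ->
  p = map num we -> q = rev (map num ew) ->
  test M vs A B (num N) (num S) p q ->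
  conclusion M A B (num N) (num S) (size we) (size ew).
Proof.
move=> MP vsP AW BE -> ->; rewrite /test.
have := meridian_edges; rewrite all_cat => /andP[wee ewe].
rewrite (overlap_necessary AW BE wee (WE_overlap T)) revK.
rewrite (overlap_necessary AW BE ewe (EW_overlap T)).
rewrite no_chord_necessary // no_trap_south // no_trap_north //.
by rewrite size_rev !size_map.
Qed.

End Necessity.

(** * From a template to a closed walk of the search *)

Section Necessity.
Context (R : realType) (X : topologicalType) (C : regular_cw R X).
Variables (T : template C) (num : C -> nat).
Hypothesis nu : numbering num.
Local Notation N := (north T).
Local Notation S := (south T).
Local Notation s := (src T).
Local Notation t := (tgt T).
Local Notation we := (WE T).
Local Notation ew := (EW T).

(** [WE] forwards, then [EW] backwards. Each edge is paired with the vertex it leads to, which is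
    its source on the way back. *)
Definition closed_walk : seq (nat * nat) :=
  [seq (num e, num (t e)) | e <- we] ++ rev [seq (num e, num (s e)) | e <- ew].

Lemma closed_walk_edges : unzip1 closed_walk = map num we ++ rev (map num ew).
Proof. by rewrite /unzip1 map_cat map_rev -!map_comp. Qed.

Lemma closed_walk_vertices :
  unzip2 closed_walk = map num (map t we) ++ rev (map num (map s ew)).
Proof. by rewrite /unzip2 map_cat map_rev -!map_comp. Qed.

Lemma joins_src_tgt (e : C) : is_edge e -> joins e (s e) (t e) /\ joins e (t e) (s e).
Proof.
move=> ee; have [sv tv ste _] := template_oriented T ee.
by rewrite /joins ee sv tv ste eq_sym ste !(incident_edge (template_oriented T)) // !eqxx orbT.
Qed.

Lemma walk_forward u p v : directed_path s t u p v ->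
  is_walk (num u) [seq (num e, num (t e)) | e <- p].
Proof.
elim: p u => //= e p IH u /and3P[ee /eqP <- /IH ->]; rewrite andbT.
by apply: star_joins => //; case: (joins_src_tgt ee).
Qed.

Lemma walk_backward u p v : directed_path s t u p v ->
  is_walk (num v) (rev [seq (num e, num (s e)) | e <- p]) /\
  last (num v) (rev (map num (map s p))) = num u.
Proof.
elim: p u => [|e p IH] u /=; first by move=> /eqP ->.
move=> /and3P[ee /eqP <- /IH[h1 h2]]; rewrite !rev_cons last_rcons; split=> //.
rewrite -cats1 is_walk_cat h1 /= andbT /unzip2 map_rev -map_comp.
rewrite -map_comp in h2; rewrite h2.
by apply: star_joins => //; case: (joins_src_tgt ee).
Qed.

Lemma closed_walk_walk : is_walk (num N) closed_walk.
Proof.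
rewrite is_walk_cat (walk_forward (WE_path T)) /unzip2 -map_comp.
rewrite -[last _ _]/(last _ [seq num (t e) | e <- we]) map_comp last_map.
rewrite (directed_path_last (WE_path T)).
by case: (walk_backward (EW_path T)).
Qed.

Lemma WE_neq0 : we != [::].
Proof.
by have := WE_path T; case: we => //= /eqP NS; have := poles_neq T; rewrite NS eqxx.
Qed.

Lemma EW_neq0 : ew != [::].
Proof.
by have := EW_path T; case: ew => //= /eqP NS; have := poles_neq T; rewrite NS eqxx.
Qed.

Lemma closed_walk_last : last (num N) (unzip2 closed_walk) = num N.
Proof.
rewrite closed_walk_vertices last_cat last_map (directed_path_last (WE_path T)).
by case: (walk_backward (EW_path T)).
Qed.

Lemma in_both_meridians (c : C) : has (incident c) we -> has (incident c) ew ->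
  c = N \/ c = S.
Proof.
move=> cw ce; have := meridians_disjoint T; rewrite !support_cellsE setI_cells => h.
have [x cx] := open_cell_neq0 c.
have : (open_cell N `|` open_cell S) x by rewrite -h; exists c.
by case=> [Nx|Sx]; [left|right]; exact: open_cell_inj cx _.
Qed.

Lemma mem_map_vertex (v : C) q : is_vertex v -> all (@is_vertex _ _ C) q ->
  (num v \in map num q) = (v \in q).
Proof.
move=> /eqP vv /allP qv; apply/mapP/idP => [[w wq vw]|]; last by exists v.
by have -> : v = w by apply: (numbering_inj nu); rewrite ?vv ?(eqP (qv w wq)).
Qed.

Lemma all_tgt p : all (@is_edge _ _ C) p -> all (@is_vertex _ _ C) (map t p).
Proof. by move=> /allP pe; apply/allP => _ /mapP[e /pe ee ->]; case: (template_oriented T ee). Qed.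

Lemma all_src p : all (@is_edge _ _ C) p -> all (@is_vertex _ _ C) (map s p).
Proof. by move=> /allP pe; apply/allP => _ /mapP[e /pe ee ->]; case: (template_oriented T ee). Qed.

Lemma we_edges : all (@is_edge _ _ C) we.
Proof. exact: directed_path_edges (WE_path T). Qed.

Lemma ew_edges : all (@is_edge _ _ C) ew.
Proof. exact: directed_path_edges (EW_path T). Qed.

Lemma uniq_num q : all (@is_vertex _ _ C) q -> uniq q -> uniq (map num q).
Proof.
move=> /allP qv uq; rewrite map_inj_in_uniq // => v w /qv /eqP vv /qv /eqP ww.
by apply: (numbering_inj nu); rewrite vv ww.
Qed.

(** Within one meridian this is acyclicity. A vertex reached on both would be a pole, but the way
    out only reaches targets, never [N], and the way back only sources, never [S]. *)
Lemma closed_walk_uniq : uniq (unzip2 closed_walk).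
Proof.
rewrite closed_walk_vertices cat_uniq rev_uniq.
have tw := all_tgt we_edges; have se := all_src ew_edges.
have := directed_path_uniq (template_oriented T) (@template_acyclic _ _ _ T)
  (north_vertex T) (WE_path T).
rewrite cons_uniq => /andP[_ /(uniq_num tw) ->] /=.
have := directed_path_uniq (template_oriented T) (@template_acyclic _ _ _ T)
  (north_vertex T) (EW_path T).
rewrite -(directed_path_srcs (EW_path T)) rcons_uniq => /andP[_ /(uniq_num se) ->].
rewrite andbT; apply/hasPn => i; rewrite mem_rev => /mapP[v vs ->] /=.
have vv := allP se _ vs.
rewrite mem_map_vertex //; apply/negP => /mapP[e ee ve].
case/mapP: vs => f ff vf.
have eE := allP we_edges _ ee; have fE := allP ew_edges _ ff.
have [] := @in_both_meridians v.
- apply/hasP; exists e => //; by rewrite (incident_edge (template_oriented T)) // ve eqxx orbT.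
- apply/hasP; exists f => //; by rewrite (incident_edge (template_oriented T)) // vf eqxx.
- by move=> vN; have := north_source T eE; rewrite -ve vN eqxx.
- by move=> vS; have := south_sink T fE; rewrite -vf vS eqxx.
Qed.

Lemma closed_walk_meridian_list : meridian_list T num (unzip1 closed_walk).
Proof.
move=> e ee; rewrite closed_walk_edges !mem_cat mem_rev.
have P q : all (@is_edge _ _ C) q -> (num e \in map num q) = (e \in q).
  move=> /allP qe; apply/mapP/idP => [[f fq ef]|]; last by exists e.
  by have -> : e = f by apply: (numbering_inj nu) => //; rewrite (eqP ee) (eqP (qe f fq)).
by rewrite !P ?we_edges ?ew_edges.
Qed.

Lemma closed_walk_meridian_vertices : meridian_vertices T num (unzip2 closed_walk).
Proof.
have tw := all_tgt we_edges; have se := all_src ew_edges.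
rewrite closed_walk_vertices; split=> [i|v vv].
  rewrite mem_cat mem_rev => /orP[] /mapP[v vq ->]; apply: (num_vertex nu);
  by [apply: (allP tw)|apply: (allP se)].
rewrite mem_cat mem_rev !mem_map_vertex //.
(* Neither pole is lost: [N] is the source of the first edge of [EW], and [S] the target of the last
   edge of [WE]. *)
have Nse : N \in map s ew.
  have := EW_path T; have := EW_neq0; case: ew => //= e p _ /and3P[_ /eqP -> _].
  exact: mem_head.
have Stw : S \in map t we.
  have := directed_path_last (WE_path T); have := WE_neq0.
  by case: we => //= e p _ <-; exact: mem_last.
apply/orP/hasP => [[] /mapP[e ee ->]|[e]].
- exists e; first by rewrite mem_cat ee.
  by have eE := allP we_edges _ ee; rewrite (incident_edge (template_oriented T)) ?eqxx ?orbT //;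
    case: (template_oriented T eE).
- exists e; first by rewrite mem_cat ee orbT.
  by have eE := allP ew_edges _ ee; rewrite (incident_edge (template_oriented T)) ?eqxx //;
    case: (template_oriented T eE).
rewrite mem_cat => em; have eE : is_edge e by apply: (allP (meridian_edges T)); rewrite mem_cat.
rewrite (incident_edge (template_oriented T)) // => vst.
case/orP: em => em.
  have := map_f s em; have := map_f t em; case/orP: vst => /eqP <-; first last.
    by left.
  move=> _ vs; have := mem_rcons (map s we) S v; rewrite (directed_path_srcs (WE_path T)).
  by rewrite !inE vs orbT => /orP[/eqP ->|]; [right|left].
have := map_f s em; have := map_f t em; case/orP: vst => /eqP <-; first by right.
move=> vt _; have := mem_rcons (map s ew) S v; rewrite (directed_path_srcs (EW_path T)).
by rewrite !inE vt orbT => /esym/orP[/eqP ->|]; [left|right].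
Qed.

(** Faces that share an edge off the meridians are on the same side, so a flood never leaves the
    hemisphere of its seed. *)
Lemma flood_hemi (H : set X) i : H = west T \/ H = east T ->
  (exists2 f : C, is_face f /\ num f = i & open_cell f `<=` H) ->
  forall f : C, is_face f -> num f \in flood 100 (unzip1 closed_walk) [:: i] [::] ->
  open_cell f `<=` H.
Proof.
move=> HH iH f ff fin.
pose P i := exists2 f : C, is_face f /\ num f = i & open_cell f `<=` H.
have [] := @floodP P _ _ _ _ _ _ _ _ _ fin.
- by move=> j [g [gg <-] _]; exact: num_face nu _ gg.
- move=> j e k [g [gg <-] gH] eg eM ke.
  have e30 := face_edges_lt (num_face nu gg) eg.
  have k12 := edge_faces_lt e30 ke.
  have [e' ee ei] := edge_num nu e30; have [k' kk ki] := face_num nu k12.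
  exists k' => //; rewrite -ei in eg eM ke; rewrite -ki in ke.
  have eg' : incident e' g by rewrite (num_inc_dims nu ee gg) -(mem_face_edges (num_edge nu ee) (num_face nu gg)).
  have ek' : incident e' k' by rewrite (num_inc_dims nu ee kk) -(mem_edge_faces (num_edge nu ee) (num_face nu kk)).
  have oe : off_meridian T e' by rewrite (edge_off T nu ee) -closed_walk_meridian_list.
  apply/(incident_hemisphere HH (face_off T nu kk) oe ek').
  by apply/(incident_hemisphere HH (face_off T nu gg) oe eg').
- by move=> j; rewrite inE => /eqP ->.
- by [].
move=> g [gg gf] gH; suff -> : f = g by [].
by apply: (numbering_inj nu) => //; rewrite (eqP ff) (eqP gg).
Qed.

(** If both seeds lay in one hemisphere, the floods, which cover all faces, would leave no face for
    the other one. So the seeds are on different sides, and by coverage each flood is exactly the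
    set of faces on its side. *)
Lemma flood_hemi_lists (A B : seq nat) (M := unzip1 closed_walk) :
  A = side_faces M 0 -> B = side_faces M 1 ->
  (forall f, f < 12 -> (f \in A) || (f \in B)) ->
  hemi_list num (west T) A /\ hemi_list num (east T) B \/
  hemi_list num (west T) B /\ hemi_list num (east T) A.
Proof.
move=> AE BE AB.
have [f0 f0f f00] := face_num nu (isT : 0 < 12).
have [f1 f1f f11] := face_num nu (isT : 1 < 12).
have sub H i f A' : H = west T \/ H = east T -> A' = side_faces M i ->
    is_face f -> num f = i -> open_cell f `<=` H ->
    forall g : C, is_face g -> num g \in A' -> open_cell g `<=` H.
  move=> HH -> ff fi fH g gg; rewrite mem_filter => /andP[gin _].
  by apply: flood_hemi gg gin => //; exists f.
have some_face H : H = west T \/ H = east T -> exists2 f : C, is_face f & open_cell f `<=` H.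
  move=> HH; have [c oc cH] := hemisphere_cell HH.
  (* The only cell of dimension 3 is the ball, which [off_meridian] excludes. *)
  have c3 : dim c < 3.
    have := numbering_lt nu c; move: oc => /andP[cb _] ; have : dim c < 4.
      by have := numbering_lt nu c; case: (dim c) => [|[|[|[|]]]].
    rewrite ltnS leq_eqVlt => /orP[/eqP c3 n1|//]; move/eqP: cb => cb; case: cb.
    apply: (numbering_inj nu); first by rewrite c3 ball_dim.
    have := numbering_lt nu (Defs.ball T); rewrite ball_dim; move: n1; rewrite c3.
    by case: (num c) => //; case: (num (Defs.ball T)).
  have [i i12 ci] := cell_has_face c3 (numbering_lt nu c).
  have [f ff fi] := face_num nu i12; exists f => //.
  apply/(incident_hemisphere HH (face_off T nu ff) oc) => //.
  by rewrite (numbering_inc nu) (eqP ff) fi.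
have excl (f : C) : open_cell f `<=` west T -> open_cell f `<=` east T -> False.
  by have [x fx] := open_cell_neq0 f => fW fE; exact: (@hemispheres_disjoint _ _ _ T x (fW _ fx) (fE _ fx)).
have uA : uniq A by rewrite AE /side_faces filter_uniq ?iota_uniq.
have uB : uniq B by rewrite BE /side_faces filter_uniq ?iota_uniq.
have ltA i : i \in A -> i < 12 by rewrite AE mem_filter mem_iota => /andP[_ /andP[]].
have ltB i : i \in B -> i < 12 by rewrite BE mem_filter mem_iota => /andP[_ /andP[]].
have W := or_introl erefl : west T = west T \/ west T = east T.
have E := or_intror erefl : east T = west T \/ east T = east T.
have [h0|h0] := off_meridian_side (face_off T nu f0f);
have [h1|h1] := off_meridian_side (face_off T nu f1f).
- have [g gg gE] := some_face _ E.
  by have /orP[gA|gB] := AB _ (num_face nu gg); exfalso; apply: (excl g) => //;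
  [exact: sub W AE f0f f00 h0 g gg gA|exact: sub W BE f1f f11 h1 g gg gB].
- left; split; split=> // f ff; split=> [fin|fH].
  + exact: sub W AE f0f f00 h0 f ff fin.
  + have /orP[//|fB] := AB _ (num_face nu ff).
    by exfalso; apply: (excl f) => //; exact: sub E BE f1f f11 h1 f ff fB.
  + exact: sub E BE f1f f11 h1 f ff fin.
  + have /orP[fA|//] := AB _ (num_face nu ff).
    by exfalso; apply: (excl f) => //; exact: sub W AE f0f f00 h0 f ff fA.
- right; split; split=> // f ff; split=> [fin|fH].
  + exact: sub W BE f1f f11 h1 f ff fin.
  + have /orP[fA|//] := AB _ (num_face nu ff).
    by exfalso; apply: (excl f) => //; exact: sub E AE f0f f00 h0 f ff fA.
  + exact: sub E AE f0f f00 h0 f ff fin.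
  + have /orP[//|fB] := AB _ (num_face nu ff).
    by exfalso; apply: (excl f) => //; exact: sub W BE f1f f11 h1 f ff fB.
- have [g gg gE] := some_face _ W.
  by have /orP[gA|gB] := AB _ (num_face nu gg); exfalso; apply: (excl g) => //;
  [exact: sub E AE f0f f00 h0 g gg gA|exact: sub E BE f1f f11 h1 g gg gB].
Qed.

Lemma conclusion_of_test : test_cycle (num N) closed_walk ->
  exists A B, [/\ hemi_list num (west T) A, hemi_list num (east T) B &
    conclusion (unzip1 closed_walk) A B (num N) (num S) (size we) (size ew)].
Proof.
rewrite /test_cycle; case: ifP => [/eqP he|_].
  (* The walk ends with the first edge of [EW]. An edge common to both meridians would have to be a
     pole, which is a vertex. *)
  exfalso; move: he; rewrite closed_walk_edges.
  have := EW_path T; have := WE_path T; have := WE_neq0; have := EW_neq0.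
  have := we_edges; have := ew_edges; have := @in_both_meridians.
  case: we => // e p; case: ew => // f q disj /= /andP[ff _] /andP[ee _] _ _ /and3P[_ /eqP se _] /and3P[_ /eqP sf _].
  rewrite last_cat rev_cons last_rcons => /(numbering_inj nu _) ef.
  have {ef} ef : e = f by apply: ef; rewrite (eqP ee) (eqP ff).
  have ei := incident_refl e.
  have [||eN|eS] := disj e; rewrite /= -?ef ?ei //.
    by have := north_vertex T; rewrite -eN /is_vertex (eqP ee).
  by have := south_vertex T; rewrite -eS /is_vertex (eqP ee).
move AE: (side_faces _ 0) => A; move BE: (side_faces _ 1) => B.
case: ifP => // AB /allP h.
have szw : size closed_walk = size we + size ew by rewrite size_cat size_rev !size_map.
have we0 : 0 < size we by have := WE_neq0; case: we.
have ew0 : 0 < size ew by have := EW_neq0; case: ew.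
(* The walk reaches [S] with the last edge of [WE], at index [(size we).-1]. *)
have := h (size we).-1; rewrite mem_iota leq0n add0n szw.
have -> : (size we).-1 < (size we + size ew).-1 by lia.
move=> /(_ isT) /=.
have -> : nth 0 (unzip2 closed_walk) (size we).-1 = num S.
  rewrite closed_walk_vertices nth_cat !size_map prednK // leqnn.
  rewrite -[X in X.-1](size_map t) -(size_map num) nth_last.
  rewrite -(directed_path_last (WE_path T)).
  by move: WE_neq0; case: we => //= e p _; rewrite last_map.
rewrite prednK //.
have tk : take (size we) (unzip1 closed_walk) = map num we.
  by rewrite closed_walk_edges take_size_cat ?size_map.
have dr : drop (size we) (unzip1 closed_walk) = rev (map num ew).
  by rewrite closed_walk_edges drop_size_cat ?size_map.
case: ifP => // t1 t2.
have ABP f : f < 12 -> (f \in A) || (f \in B).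
  by move=> f12; have := all_iota AB f12; case: ifP.
have [[h1 h2]|[h1 h2]] := flood_hemi_lists (esym AE) (esym BE) ABP.
  exists A, B; split=> //.
  exact: (test_necessary nu closed_walk_meridian_list closed_walk_meridian_vertices h1 h2 tk dr t1).
exists B, A; split=> //.
exact: (test_necessary nu closed_walk_meridian_list closed_walk_meridian_vertices h1 h2 tk dr t2).
Qed.

End Necessity.

(** * Renumbering by symmetries of the dodecahedron *)

Definition vertex_act (g : seq nat) (v : nat) : nat := nth 0 g v.

Definition cell_act (g : seq nat) (k i : nat) : nat :=
  find (set_eq (map (vertex_act g) (cell_verts k i))) (cell_list k).

Definition automorphism (g : seq nat) : bool :=
  all_cells (fun k i => [&& cell_act g k i < count_cells k,
    (k == 0) ==> (cell_act g k i == vertex_act g i),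
    has (fun j => cell_act g k j == i) (iota 0 (count_cells k)) &
    all_cells (fun l j => inc k i l j == inc k (cell_act g k i) l (cell_act g l j))]).

(* Vertex tables of two rotations that generate the rotation group. *)
Definition generator (b : bool) : seq nat :=
  if b then [:: 1; 2; 3; 4; 0; 6; 7; 8; 9; 5; 11; 12; 13; 14; 10; 16; 17; 18; 19; 15]
  else [:: 1; 2; 7; 11; 6; 0; 3; 12; 16; 10; 4; 8; 17; 15; 5; 9; 13; 18; 19; 14].

Lemma generator_automorphism b : automorphism (generator b).
Proof. by case: b; vm_compute. Qed.

Fixpoint words (n : nat) : seq (seq bool) :=
  if n is m.+1 then [::] :: flatten [seq [:: true :: w; false :: w] | w <- words m] else [:: [::]].

(** Words of length at most 6 carry every directed edge to the one from 0 to 1. Orientation of the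
    sphere need not be preserved, because a numbering records incidences only and the search tries
    both assignments of the sides. *)
Definition dart_transitive : bool :=
  all (fun u => all (fun t => has (fun w =>
    if foldr (vertex_act \o generator) u w == 0
    then foldr (vertex_act \o generator) t.2 w == 1 else false) (words 6)) (star u)) (iota 0 20).

Lemma dart_transitiveP : dart_transitive.
Proof. by vm_compute. Qed.

Section Relabel.
Context (R : realType) (X : topologicalType) (C : regular_cw R X).

Lemma numbering_act (num : C -> nat) g : numbering num -> automorphism g ->
  numbering (fun c => cell_act g (dim c) (num c)).
Proof.
move=> nu ag.
have P (c : C) := all_cellsP ag (numbering_lt nu c).
split=> [v w vw|v|k i ik|v w].
- have /and4P[_ _ _ h] := P v.
  have := all_cellsP h (numbering_lt nu w); rewrite vw => /eqP + vw'; rewrite vw'.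
  have -> : inc (dim w) (cell_act g (dim w) (num w)) (dim w) (cell_act g (dim w) (num w)).
    by apply/allP.
  rewrite -vw => i; have wl := numbering_lt nu w; rewrite -vw in wl.
  have := inc_dim (numbering_lt nu v) wl i; rewrite ltnn eqxx /= => /eqP.
  exact: (numbering_inj nu).
- by have /and4P[] := P v.
- have /and4P[_ _ /hasP[j]] := all_cellsP ag ik; rewrite mem_iota => jk /eqP ji _.
  have [v vk vj] := numbering_onto nu jk; exists v => //.
  by rewrite vk vj.
- have /and4P[_ _ _ h] := P v.
  by rewrite (numbering_inc nu); apply/eqP; exact: (all_cellsP h (numbering_lt nu w)).
Qed.

Lemma numbering_word (num : C -> nat) w : numbering num ->
  exists2 num', numbering num' &
    forall v : C, is_vertex v -> num' v = foldr (vertex_act \o generator) (num v) w.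
Proof.
move=> nu; elim: w => [|b w [num' nu' h]]; first by exists num.
exists (fun c => cell_act (generator b) (dim c) (num' c)).
  by apply: numbering_act nu' _; exact: generator_automorphism.
move=> v vv; rewrite /= -h //.
have /and4P[_ + _ _] := all_cellsP (generator_automorphism b) (numbering_lt nu' v).
by rewrite (eqP vv) => /eqP.
Qed.

Lemma numbering_dart (num : C -> nat) (e u v : C) : numbering num -> joins e u v ->
  exists2 num', numbering num' & num' u = 0 /\ num' v = 1.
Proof.
move=> nu j; have /and5P[_ uu vv _ _] := j.
have := all_iota dart_transitiveP (num_vertex nu uu).
move=> /allP /(_ _ (star_joins nu j)) /hasP[w _]; case: ifP => // /eqP wu /eqP wv.
have [num' nu' h] := numbering_word w nu.
by exists num' => //; rewrite !h.
Qed.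

End Relabel.

(** * Translating the outcome of the search back to the template *)

Section Conclusion.
Context (R : realType) (X : topologicalType) (C : regular_cw R X).
Variables (T : template C) (num : C -> nat).
Hypothesis nu : numbering num.
Local Notation N := (north T).
Local Notation S := (south T).
Local Notation s := (src T).
Local Notation t := (tgt T).
Local Notation we := (WE T).
Local Notation ew := (EW T).
Variables A B : seq nat.
Hypothesis AW : hemi_list num (west T) A.
Hypothesis BE : hemi_list num (east T) B.

Lemma hemi_list_size (H : set X) L : hemi_list num H L -> #|cells_in C 2 H| = size L.
Proof. by move=> [uL ltL LH]; apply: (cells_in_size nu). Qed.

Lemma small_hemi_list : hemi_list num (small_hemisphere T) (smaller A B).
Proof.
rewrite /small_hemisphere /smaller (hemi_list_size AW) (hemi_list_size BE).
by case: ifP.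
Qed.

Lemma face_countE : face_count T = size (smaller A B).
Proof. exact: hemi_list_size small_hemi_list. Qed.

(** This keeps distances up to 3 below the default value of [edge_dist]; the twelve faces already
    suffice. *)
Lemma card_cells_gt3 : 3 < #|C|.
Proof.
have h : hemi_list num setT (iota 0 12).
  split=> [|i|f ff]; [exact: iota_uniq|by rewrite mem_iota|].
  by rewrite mem_iota (num_face nu ff).
by apply: leq_trans (max_card (mem (cells_in C 2 setT))); rewrite (hemi_list_size h) size_iota.
Qed.

Lemma pole_distE : distance (num N) (num S) <= 2 -> pole_dist T = distance (num N) (num S).
Proof.
have Nv := north_vertex T; have Sv := south_vertex T; have NS := poles_neq T.
rewrite /distance; case: ifP => [NS1 _|NS1].
  apply: (@edge_dist_eq _ _ _ _ _ _ [:: S]) => //=.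
  - by rewrite (adjacent_num nu) // Sv NS1.
  - by case.
  - exact: leq_trans card_cells_gt3.
case: ifP => [/hasP[[i j] ij /= jS] _|_ //].
have [e [m [jn _ mj]]] := joins_star nu Nv ij.
have /and5P[_ _ mv _ _] := jn.
apply: (@edge_dist_eq _ _ _ _ _ _ [:: m; S]) => //=.
- rewrite !(adjacent_num nu) // mv Sv mj jS andbT /=.
  by rewrite andbT; apply/hasP; exists (i, j) => /=.
- case=> [|x [|y q]] //= _; rewrite andbT (adjacent_num nu) // => /andP[_ Nx].
  by apply: contraFneq NS1 => <-.
- exact: leq_trans card_cells_gt3.
Qed.

Lemma meridian_uniq : uniq (we ++ ew).
Proof.
have u1 := directed_path_uniq (template_oriented T) (@template_acyclic _ _ _ T)
  (north_vertex T) (WE_path T).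
have u2 := directed_path_uniq (template_oriented T) (@template_acyclic _ _ _ T)
  (north_vertex T) (EW_path T).
rewrite cat_uniq; move: u1 u2; rewrite !cons_uniq => /andP[_ /map_uniq ->] /andP[_ /map_uniq ->].
rewrite andbT; apply/hasPn => e ee /=; apply/negP => ew'.
have eE := allP (ew_edges T) _ ee.
have [||eN|eS] := @in_both_meridians _ _ _ T e.
- by apply/hasP; exists e => //; exact: incident_refl.
- by apply/hasP; exists e => //; exact: incident_refl.
- by have := north_vertex T; rewrite -eN /is_vertex (eqP eE).
- by have := south_vertex T; rewrite -eS /is_vertex (eqP eE).
Qed.

Lemma card_meridian_circle : #|meridian_circle T| = size (we ++ ew).
Proof. by rewrite cardsE; apply/card_uniqP; exact: meridian_uniq. Qed.

Lemma meridian_path p u v : {subset p <= we ++ ew} -> directed_path s t u p v ->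
  path (adjacent_via (mem (meridian_circle T))) u (map t p).
Proof.
elim: p u => //= e p IH u sub /and3P[ee /eqP <- dp]; rewrite (IH (t e)) // ?andbT; last first.
  by move=> x xp; apply: sub; rewrite inE xp orbT.
apply/existsP; exists e; rewrite !inE sub ?mem_head //=.
by case: (joins_src_tgt T ee).
Qed.

Lemma conclusionP :
  conclusion (unzip1 (closed_walk T num)) A B (num N) (num S) (size we) (size ew) ->
  [/\ (1 <= face_count T)%N,
         (face_count T <= pole_dist T)%N,
         (pole_dist T <= 2)%N &
         face_count T = 2%N -> pole_dist T = 2%N ->
         [/\ poles_via_shared_edge T,
             #|meridian_circle T| = 8%N &
             meridian_pole_dist T = 3%N]].
Proof.
move=> /and4P[c1 c2 c3 c4]; rewrite face_countE pole_distE //; split=> // A2 D2.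
move: c4; rewrite A2 D2 /= => /and4P[/eqP sz s3 /allP nomid sh].
have Nv := north_vertex T; have Sv := south_vertex T; have NS := poles_neq T.
have szm : size (we ++ ew) = 8.
  by rewrite -sz closed_walk_edges !size_cat size_rev !size_map.
split.
- have [uL ltL LH] := small_hemi_list.
  have /hasP[f + /hasP[g + /hasP[e + /and4P[fg WL /eqP fe hh]]]] := sh.
  rewrite !mem_iota => /(face_num nu)[f' ff fE] /(face_num nu)[g' gg gE] /(edge_num nu)[e' ee eE].
  have fg' : f' != g' by apply: contraNneq fg => h; rewrite -fE -gE h.
  have sharedP (a : C) : is_edge a -> (incident a f' && incident a g') = (a == e').
    move=> aa; have := mem_filter (fun a => a \in face_edges g) (num a) (face_edges f).
    rewrite fe inE -eE (numbering_eq nu) ?(eqP aa) ?(eqP ee) // => ->.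
    rewrite -fE -gE !mem_face_edges ?(num_edge nu aa) ?(num_face nu) //.
    by rewrite (num_inc_dims nu aa ff) (num_inc_dims nu aa gg) andbC.
  exists f', g', e'; split=> //.
  + apply/setP => x; rewrite !inE; apply/andP/orP.
      move=> [/[dup] xx /eqP x2 /asboolP /(LH x xx)]; rewrite (perm_mem WL) !inE -fE -gE.
      by rewrite !(numbering_eq nu) // ?(eqP ff) ?(eqP gg) // => /orP.
    move=> xfg; have [xx] : is_face x /\ (num x \in smaller A B).
      rewrite (perm_mem WL) !inE -fE -gE.
      by case: xfg => /eqP ->; rewrite eqxx ?orbT.
    by move=> /(LH x xx) xs; split=> //; apply/asboolP.
  + split; last by move=> a [aa af ag]; apply/esym/eqP; rewrite -sharedP // af ag.
    by have := sharedP _ ee; rewrite eqxx => /andP[].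
  + have /hasP[[i m] im /hasP[[j k] jk /= /andP[/eqP kS ije]]] := hh.
    have [a [m' [ja ai mm]]] := joins_star nu Nv im.
    have /and5P[aa _ mv _ _] := ja.
    rewrite -mm in jk; have [b [S' [jb bj SS]]] := joins_star nu mv jk.
    have /and5P[bb _ S'v _ _] := jb.
    have {SS} SS : S' = S.
      by apply: (numbering_inj nu); rewrite ?SS // (eqP S'v) (eqP Sv).
    rewrite SS in jb; case/orP: ije => /eqP h.
      have ae : a = e' by apply: (numbering_inj nu); rewrite ?(eqP aa) ?(eqP ee) // ai eE.
      by exists b, m'; rewrite -ae ja jb.
    have be : b = e' by apply: (numbering_inj nu); rewrite ?(eqP bb) ?(eqP ee) // bj eE.
    by exists a, m'; rewrite -be ja jb orbT.
- by rewrite card_meridian_circle.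
- have short q : size q < 3 -> path (adjacent_via (mem (meridian_circle T))) N q -> last N q != S.
    have adjT u v : adjacent_via (mem (meridian_circle T)) u v -> adjacent_via predT u v.
      by move=> /existsP[x /andP[_ j]]; apply/existsP; exists x.
    move: D2; rewrite /distance; case: ifP => // noadj _.
    case: q => [|x [|y [|z q]]] //= _.
      rewrite andbT => /adjT; rewrite (adjacent_num nu) // => /andP[_ Nx].
      by apply: contraFneq noadj => <-.
    rewrite andbT => /andP[/existsP[a /andP[+ ja]] /existsP[b /andP[+ jb]]].
    rewrite !inE => am bm; apply/eqP => yS; rewrite yS in jb.
    have /and5P[aa _ _ _ _] := ja; have /and5P[bb _ _ _ _] := jb.
    have := nomid _ (star_joins nu ja) => /= /allP /(_ _ (star_joins nu jb)) /=.
    rewrite !(closed_walk_meridian_list T nu) // ?eqxx.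
    by rewrite am bm.
  have cd := card_cells_gt3.
  (* The search does not tell which meridian has three edges; either one is a shortest path on the
     circle. *)
  case/orP: s3 => /eqP s3.
    have sub : {subset we <= we ++ ew} by move=> x; rewrite mem_cat => ->.
    rewrite /meridian_pole_dist.
    have sm : size (map t we) = 3 by rewrite size_map.
    rewrite -[RHS]sm; apply: edge_dist_eq; rewrite ?sm //.
      exact: meridian_path sub (WE_path T).
    exact: directed_path_last (WE_path T).
  have sub : {subset ew <= we ++ ew} by move=> x; rewrite mem_cat orbC => ->.
  rewrite /meridian_pole_dist.
  have sm : size (map t ew) = 3 by rewrite size_map.
  rewrite -[RHS]sm; apply: edge_dist_eq; rewrite ?sm //.
    exact: meridian_path sub (EW_path T).
  exact: directed_path_last (EW_path T).
Qed.

End Conclusion.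

Lemma template_bounds (R : realType) (X : topologicalType) (C : regular_cw R X) (T : template C) :
  is_solid_dodecahedron C ->
     [/\ (1 <= face_count T)%N,
         (face_count T <= pole_dist T)%N,
         (pole_dist T <= 2)%N &
         face_count T = 2%N -> pole_dist T = 2%N ->
         [/\ poles_via_shared_edge T,
             #|meridian_circle T| = 8%N &
             meridian_pole_dist T = 3%N]].
Proof.
move=> /solid_numbering[num0 nu0].
have we0 := WE_neq0 T; have wd := WE_path T.
case weE : (WE T) we0 wd => [//|e0 p] _ /= /and3P[ee /eqP se dp].
have [j0 _] := joins_src_tgt T ee.
(* The first edge of [WE], read from [N], becomes the step from 0 to 1 with which all searched walks
   begin. *)
have [num nu [nN nt]] := numbering_dart nu0 j0; rewrite se in nN.
have wk := closed_walk_walk T nu; have wu := closed_walk_uniq T nu.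
have wl := closed_walk_last T nu.
have [_ wv] := closed_walk_meridian_vertices T nu.
have : test_cycle (num (north T)) (closed_walk T num).
  have szc : size (unzip2 (closed_walk T num)) <= 20.
    rewrite -(size_iota 0 20); apply: uniq_leq_size => // i iw; rewrite mem_iota.
    by have [h _] := closed_walk_meridian_vertices T nu; exact: h.
  have ew0 := EW_neq0 T.
  case cwE : (closed_walk T num) wk wl wu szc => [|[i v] w].
    by move: cwE; rewrite /closed_walk weE.
  have : (i, v) = (num e0, num (tgt T e0)) by move: cwE; rewrite /closed_walk weE => -[-> -> _].
  case=> ie ve; rewrite nN => /= /andP[st wk] wl wu szc.
  have i0 : i = 0 by move: st; rewrite ve nt !inE => /or3P[] /eqP[].
  have w0 : w != [::].
    move: cwE; rewrite /closed_walk weE => -[_ _ <-]; case: (EW T) ew0 => // f q _.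
    by rewrite /= rev_cons; case: (map _ p) => //; case: (rev _).
  have v1 : v = 1 by rewrite ve.
  have := forall_walksP (k := 20) (P := test_cycle 0) (acc := [:: (0, 1)]) (n := 0) all_cycles_okP.
  rewrite i0 v1 in wk wl wu *; move=> /(_ w wk w0); apply=> //.
  by rewrite size_map in szc; exact: ltnW.
move=> /(conclusion_of_test nu)[A [B [AW BE]]].
exact: conclusionP.
Qed.

(** * Realizing templates *)

Section Components.
Context (R : realType) (X : topologicalType) (C : regular_cw R X).

Lemma closure_cells (A : set C) :
  closure (\bigcup_(c in A) open_cell c) `<=` \bigcup_(c in A) closure (open_cell c).
Proof.
have cl : closed (\bigcup_(c in A) closure (open_cell c)).
  by apply: closed_bigcup => [|c _]; [exact: finite_finset|exact: closed_closure].
rewrite (iffLR (closure_id _) cl); apply: closureS => x [c Ac cx].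
by exists c => //; exact: subset_closure.
Qed.

(** The families are finite, so a limit point of one of them lies in one of its closed cells; if it
    also lay in a cell of the other family, two cells would be incident. *)
Lemma separated_cells (A B : set C) :
  (forall c d, A c -> B d -> ~~ incident c d /\ ~~ incident d c) ->
  separated (\bigcup_(c in A) open_cell c) (\bigcup_(c in B) open_cell c).
Proof.
move=> AB; split; rewrite -subset0 => x.
  move=> [/closure_cells[c Ac cx] [d Bd dx]].
  by have [_ /negP[]] := AB c d Ac Bd; exact: incidentP dx cx.
move=> [[c Ac cx] /closure_cells[d Bd dx]].
by have [/negP[]] := AB c d Ac Bd; exact: incidentP cx dx.
Qed.

Lemma component_cells (A B : set C) x :
  (forall c d, A c -> B d -> ~~ incident c d /\ ~~ incident d c) ->
  connected (\bigcup_(c in A) open_cell c) ->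
  (\bigcup_(c in A) open_cell c) x ->
  connected_component (\bigcup_(c in A `|` B) open_cell c) x =
  \bigcup_(c in A) open_cell c.
Proof.
move=> AB cA Ax; have sAB := separated_cells AB.
rewrite bigcup_setU in sAB *; apply/seteqP; split; last first.
  by apply: connected_component_max => //; exact: subsetUl.
have Ux : (\bigcup_(c in A) open_cell c `|` \bigcup_(c in B) open_cell c) x by left.
have [//|h] := connected_subset sAB (@connected_component_sub _ _ _) (@component_connected _ _ x).
have := h _ (connected_component_refl Ux).
by move=> Bx; exfalso; have := separated_disjoint sAB; apply/eqP/set0P; exists x.
Qed.

(** Each cell but the last is incident with a later one, so the union is built up from the end of
    the list and stays connected. This makes connectedness a matter of one pass through a list. *)
Fixpoint linked (l : seq C) : bool :=
  if l is c :: l' then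
    (nilp l' || has (fun d => incident c d || incident d c) l') && linked l'
  else true.

Lemma linked_connected (l : seq C) : linked l ->
  connected (\bigcup_(c in [set` l]) open_cell c).
Proof.
elim: l => [_|c l IH /= /andP[h /IH cl]].
  by rewrite (_ : [set` _] = set0) ?bigcup_set0; [exact: connected0|apply/seteqP; split].
have -> : [set` c :: l] = [set c] `|` [set` l].
  apply/seteqP; split=> d /=; rewrite inE.
    by case/orP => [/eqP|]; [left|right].
  by case=> [->|->]; rewrite ?eqxx ?orbT.
rewrite bigcup_setU bigcup_set1; case/orP: h => [/nilP ->|/hasP[d dl dc]].
  rewrite (_ : [set` [::]] = set0); last by apply/seteqP; split.
  by rewrite bigcup_set0 setU0; exact: open_cell_connected.
have -> : open_cell c `|` \bigcup_(c in [set` l]) open_cell c =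
  (open_cell c `|` open_cell d) `|` \bigcup_(c in [set` l]) open_cell c.
  by rewrite -setUA; congr setU; apply/esym/setUidPr => x dx; exists d.
have [x dx] := open_cell_neq0 d.
apply: connectedU cl; first by exists x; split; [right|exists d].
by case/orP: dc => /connected_incident //; rewrite setUC.
Qed.

End Components.

(* Numerical data of a template: the edges point forward in the given ordering
   of the vertices, the meridians are given by their vertices, and the
   hemispheres by their faces, each of which shares an interior edge with a later
   one. *)
Record plan := Plan {
  plan_order : seq nat;
  plan_WE : seq nat;
  plan_EW : seq nat;
  plan_west : seq nat;
  plan_east : seq nat
}.

Section PlanData.
Variable p : plan.

Definition plan_rank (v : nat) : nat := index v (plan_order p).

Definition plan_src (e : nat) : nat :=
  let x := nth 0 (cell_verts 1 e) 0 in let y := nth 0 (cell_verts 1 e) 1 in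
  if plan_rank x < plan_rank y then x else y.

Definition plan_tgt (e : nat) : nat :=
  let x := nth 0 (cell_verts 1 e) 0 in let y := nth 0 (cell_verts 1 e) 1 in
  if plan_rank x < plan_rank y then y else x.

Definition plan_north : nat := head 0 (plan_WE p).
Definition plan_south : nat := last 0 (plan_WE p).

Definition edge_between (u v : nat) : nat :=
  (head (0, 0) [seq t <- star u | t.2 == v]).1.

Definition path_edges (vs : seq nat) : seq nat :=
  pairmap edge_between (head 0 vs) (behead vs).

Definition plan_we : seq nat := path_edges (plan_WE p).
Definition plan_ew : seq nat := path_edges (plan_EW p).

Definition plan_on (k i : nat) : bool := has (inc k i 1) (plan_we ++ plan_ew).

(** [region] lists the interior edges before; those shared with later faces are repeated here on
    purpose. The repetition provides the face with a later incident edge and that edge with a later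
    face, as the linking condition demands. *)
Fixpoint face_chain (fs : seq nat) : seq (nat * nat) :=
  if fs is f :: fs' then
    (2, f) :: [seq (1, e) | e <- face_edges f &
      (e \notin plan_we ++ plan_ew) && has (fun g => e \in face_edges g) fs'] ++ face_chain fs'
  else [::].

Definition region (fs : seq nat) : seq (nat * nat) :=
  [seq (0, v) | v <- iota 0 20 & ~~ plan_on 0 v && has (mem fs) (vertex_faces v)] ++
  [seq (1, e) | e <- iota 0 30 & ~~ plan_on 1 e && has (mem fs) (edge_faces e)] ++
  face_chain fs.

Definition inc2 (a b : nat * nat) : bool := inc a.1 a.2 b.1 b.2.

Fixpoint num_linked (l : seq (nat * nat)) : bool :=
  if l is c :: l' then
    (nilp l' || has (fun d => inc2 c d || inc2 d c) l') && num_linked l'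
  else true.

Fixpoint num_directed (u : nat) (q : seq nat) (v : nat) : bool :=
  if q is e :: q' then (plan_src e == u) && num_directed (plan_tgt e) q' v else u == v.

Definition plan_oriented : bool :=
  all (fun e => [&& plan_src e < 20, plan_tgt e < 20, plan_rank (plan_src e) < plan_rank (plan_tgt e),
      inc 0 (plan_src e) 1 e, inc 0 (plan_tgt e) 1 e &
      all_cells (fun k i => inc k i 1 e ==> ((k, i) \in [:: (1, e); (0, plan_src e); (0, plan_tgt e)]))])
    (iota 0 30).

Definition plan_poles : bool :=
  all (fun v => ((v == plan_north) == all (fun e => plan_tgt e != v) (iota 0 30)) &&
                ((v == plan_south) == all (fun e => plan_src e != v) (iota 0 30))) (iota 0 20).

Definition plan_meridians : bool :=
  [&& all (fun e => e < 30) (plan_we ++ plan_ew),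
      num_directed plan_north plan_we plan_south,
      num_directed plan_north plan_ew plan_south &
      all_cells (fun k i => (has (inc k i 1) plan_we && has (inc k i 1) plan_ew) ==
        ((k == 0) && ((i == plan_north) || (i == plan_south))))].

Definition plan_side (fs : seq nat) (toward : nat -> nat) : bool :=
  [&& num_linked (region fs), ~~ nilp (region fs),
      all (fun a => a.2 < count_cells a.1) (region fs), uniq fs,
      all (fun f => f < 12) fs,
      all (fun f => (f \in fs) == ((2, f) \in region fs)) (iota 0 12) &
      all (fun e => ((1, e) \in region fs) ==> all (fun v =>
        [&& v != plan_north, v != plan_south, plan_on 0 v & inc 0 v 1 e] ==> (toward e == v))
        (iota 0 20)) (iota 0 30)].

Definition plan_hemispheres : bool :=
  all_cells (fun k i => ((k != 3) && ~~ plan_on k i) ==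
     (((k, i) \in region (plan_west p)) || ((k, i) \in region (plan_east p)))) &&
  all (fun a => all (fun b => ~~ inc2 a b && ~~ inc2 b a) (region (plan_east p)))
    (region (plan_west p)).

(** Comparing a filtered list with a singleton gives existence and uniqueness in [the_face_at] at
    once. *)
Definition plan_overlap (q : seq nat) : bool :=
  let W := region (plan_west p) in let E := region (plan_east p) in
  ~~ nilp q && has (fun f => has (fun g =>
    [&& [seq f' <- iota 0 12 | ((2, f') \in W) && inc 1 (head 0 q) 2 f'] == [:: f],
        [seq g' <- iota 0 12 | ((2, g') \in E) && inc 1 (last 0 q) 2 g'] == [:: g] &
        has (fun e => inc 1 e 2 f && inc 1 e 2 g) q]) (iota 0 12)) (iota 0 12).

Definition plan_ok : bool :=
  [&& plan_oriented, plan_poles, plan_meridians, plan_side (plan_west p) plan_tgt,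
      plan_side (plan_east p) plan_src, plan_hemispheres, plan_overlap plan_we & plan_overlap plan_ew].

End PlanData.

(* Found by a computer search. *)
Definition plan11 : plan := Plan
  [:: 0; 4; 3; 5; 14; 10; 2; 19; 9; 15; 13; 18; 8; 16; 17; 12; 7; 11; 6; 1]
  [:: 0; 1] [:: 0; 4; 3; 2; 1] [:: 0] [:: 11; 10; 9; 8; 7; 6; 5; 4; 3; 2; 1].

(** The poles 0 and 2 cut the boundary of the single Western pentagon into two and three edges. *)
Definition plan12 : plan := Plan
  [:: 0; 4; 9; 1; 14; 13; 3; 19; 5; 10; 6; 15; 18; 17; 16; 8; 11; 12; 7; 2]
  [:: 0; 1; 2] [:: 0; 4; 3; 2] [:: 0] [:: 11; 10; 9; 8; 7; 6; 5; 4; 3; 2; 1].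

(** The Western pentagons 5 and 0 share the edge between 0 and 4. The poles 0 and 3 cut the boundary
    of their union into three and five edges, and the short path between them runs through 4. *)
Definition plan22 : plan := Plan
  [:: 0; 5; 1; 2; 10; 14; 19; 15; 7; 18; 6; 11; 16; 9; 17; 13; 12; 4; 8; 3]
  [:: 0; 1; 2; 3] [:: 0; 5; 14; 9; 4; 3] [:: 5; 0] [:: 11; 10; 9; 8; 7; 6; 4; 3; 2; 1].

Lemma plans_ok : [&& plan_ok plan11, plan_ok plan12 & plan_ok plan22].
Proof. by vm_compute. Qed.

(** * From a verified plan to a template *)

Section PlanTemplate.
Context (R : realType) (X : topologicalType) (C : regular_cw R X).
Variables (num : C -> nat) (p : plan).
Hypothesis nu : numbering num.
Hypothesis okp : plan_ok p.

Lemma cell_at_ex : exists cl : nat -> nat -> C, forall k i, i < count_cells k ->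
  dim (cl k i) = k /\ num (cl k i) = i.
Proof.
(* An arbitrary value for positions beyond the tables. *)
have [b _ _] := numbering_onto nu (k := 3) (i := 0) isT.
have h (ki : nat * nat) : exists c : C, ki.2 < count_cells ki.1 -> dim c = ki.1 /\ num c = ki.2.
  have [lt|] := boolP (ki.2 < count_cells ki.1); last by exists b.
  by have [c] := numbering_onto nu lt; exists c.
have [f fP] := choice h.
by exists (fun k i => f (k, i)) => k i; exact: (fP (k, i)).
Qed.

Variable cl : nat -> nat -> C.
Hypothesis clP : forall k i, i < count_cells k -> dim (cl k i) = k /\ num (cl k i) = i.

Lemma cl_num (c : C) : cl (dim c) (num c) = c.
Proof.
by have [d n] := clP (numbering_lt nu c); exact: (numbering_inj nu).
Qed.

Lemma incident_cl k i l j : i < count_cells k -> j < count_cells l ->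
  incident (cl k i) (cl l j) = inc k i l j.
Proof.
move=> /clP[dk ni] /clP[dl nj]; rewrite (numbering_inc nu).
by rewrite dk ni dl nj.
Qed.

Lemma incident_clr (c : C) l j : j < count_cells l ->
  incident c (cl l j) = inc (dim c) (num c) l j.
Proof. by move=> jl; rewrite -{1}(cl_num c) incident_cl // numbering_lt. Qed.

Definition realize_src (c : C) : C := if is_edge c then cl 0 (plan_src p (num c)) else c.
Definition realize_tgt (c : C) : C := if is_edge c then cl 0 (plan_tgt p (num c)) else c.
Definition realize_path (q : seq nat) : seq C := map (cl 1) q.
Definition realize_region (fs : seq nat) : set X :=
  \bigcup_(c in [set c | (dim c, num c) \in region p fs]) open_cell c.

Local Notation N := (cl 0 (plan_north p)).
Local Notation S := (cl 0 (plan_south p)).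

Lemma plan_orientedP (e : C) : is_edge e ->
  [&& plan_src p (num e) < 20, plan_tgt p (num e) < 20,
      plan_rank p (plan_src p (num e)) < plan_rank p (plan_tgt p (num e)),
      inc 0 (plan_src p (num e)) 1 (num e), inc 0 (plan_tgt p (num e)) 1 (num e) &
      all_cells (fun k i => inc k i 1 (num e) ==>
        ((k, i) \in [:: (1, num e); (0, plan_src p (num e)); (0, plan_tgt p (num e))]))].
Proof. by case/and5P: okp => h _ _ _ _ ee; exact: (all_iota h (num_edge nu ee)). Qed.

Lemma realize_srcE (e : C) : is_edge e ->
  is_vertex (realize_src e) /\ num (realize_src e) = plan_src p (num e).
Proof.
move=> ee; have /andP[h _] := plan_orientedP ee.
by rewrite /realize_src ee /is_vertex; have [-> ->] := clP (k := 0) h.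
Qed.

Lemma realize_tgtE (e : C) : is_edge e ->
  is_vertex (realize_tgt e) /\ num (realize_tgt e) = plan_tgt p (num e).
Proof.
move=> ee; have /and3P[_ h _] := plan_orientedP ee.
by rewrite /realize_tgt ee /is_vertex; have [-> ->] := clP (k := 0) h.
Qed.

Lemma realize_oriented : oriented realize_src realize_tgt.
Proof.
move=> e ee; have [sv sn] := realize_srcE ee; have [tv tn] := realize_tgtE ee.
have /and5P[_ _ rk si /andP[ti al]] := plan_orientedP ee.
have ste : realize_src e != realize_tgt e.
  by apply: contraTneq rk => h; rewrite -sn -tn h ltnn.
split=> //; apply/seteqP; split=> [x [/closure_cellP[d de dx] nx]|x].
  have := all_cellsP al (numbering_lt nu d); move: de.
  rewrite (numbering_inc nu) (eqP ee) => -> /=; rewrite !inE -sn -tn => /or3P[] /eqP[dd dn].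
  - by case: nx; rewrite -(numbering_inj nu _ dn) // dd (eqP ee).
  - by left; rewrite -(numbering_inj nu _ dn) // dd (eqP sv).
  - by right; rewrite -(numbering_inj nu _ dn) // dd (eqP tv).
have vne (v : C) : is_vertex v -> v != e by apply: contraTneq => ->; rewrite /is_vertex (eqP ee).
case=> vx; split.
- apply/closure_cellP; exists (realize_src e) => //.
  by rewrite (numbering_inc nu) (eqP sv) (eqP ee) sn.
- by move=> ex; move/eqP: (vne _ sv); apply; exact: open_cell_inj vx ex.
- apply/closure_cellP; exists (realize_tgt e) => //.
  by rewrite (numbering_inc nu) (eqP tv) (eqP ee) tn.
- by move=> ex; move/eqP: (vne _ tv); apply; exact: open_cell_inj vx ex.
Qed.

(** Edges increase the rank; acyclicity follows by taking [u = v]. *)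
Lemma realize_rank u q v : directed_path realize_src realize_tgt u q v ->
  (q == [::]) || (plan_rank p (num u) < plan_rank p (num v)).
Proof.
elim: q u => //= e q IH u /and3P[ee /eqP <- /[dup] dp /IH].
have [_ sn] := realize_srcE ee; have [_ tn] := realize_tgtE ee.
have /and5P[_ _ rk _ _] := plan_orientedP ee; rewrite -sn -tn in rk.
case/orP => [/eqP q0|]; last exact: ltn_trans rk.
by move: dp; rewrite q0 => /eqP <-.
Qed.

Lemma pole_lt : plan_north p < 20 /\ plan_south p < 20.
Proof.
have /and5P[_ _ /and4P[_ _ _ m] _ _] := okp.
have e30 : all (fun e => e < 30) (plan_we p ++ plan_ew p).
  by have /and5P[_ _ /and4P[]] := okp.
have /and5P[_ _ _ _ /and4P[_ _ ov _]] := okp.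
have /and5P[ori _ /and4P[_ dp _ _] _ _] := okp.
have : forall u q v, q != [::] -> all (fun e => e < 30) q -> num_directed p u q v -> u < 20 /\ v < 20.
  move=> u q v; elim: q u => //= e q IH u _ /andP[el ql] /andP[/eqP <- dq].
  have /and3P[se te _] := all_iota ori el; split=> //.
  case: (eqVneq q [::]) dq => [->/= /eqP <- //|q0 dq].
  by have [] := IH _ q0 ql dq.
apply; last exact: dp.
  by case/andP: ov; case: (plan_we p).
by move: e30; rewrite all_cat => /andP[].
Qed.

Lemma pole_vertex : [/\ is_vertex N, is_vertex S, num N = plan_north p & num S = plan_south p].
Proof.
have [nl sl] := pole_lt; rewrite /is_vertex.
by have [-> ->] := clP (k := 0) nl; have [-> ->] := clP (k := 0) sl.
Qed.

Lemma vertex_eqN (v : C) i : is_vertex v -> i < 20 -> (v == cl 0 i) = (num v == i).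
Proof.
move=> vv il; have [cd cn] := clP (k := 0) il.
by rewrite -[in RHS]cn (numbering_eq nu) // cd (eqP vv).
Qed.

Lemma realize_bipolar : bipolar realize_src realize_tgt N S.
Proof.
have [nl sl] := pole_lt; have [Nv Sv Nn Sn] := pole_vertex.
have /and5P[_ po _ _ _] := okp.
split; first exact: realize_oriented.
- move=> u q uu dp; have := realize_rank dp.
  by rewrite ltnn orbF => /eqP.
- move=> v; split=> [[vv h]|->].
    apply/eqP; rewrite vertex_eqN //.
    have /andP[/eqP -> _] := all_iota po (num_vertex nu vv).
    apply/allP => i; rewrite mem_iota => /andP[_ il].
    have [e ee ei] := edge_num nu il; have [tv tn] := realize_tgtE ee.
    rewrite -ei -tn (numbering_eq nu) ?(eqP tv) ?(eqP vv) //.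
    exact: h.
  split=> // e ee; have /andP[/eqP + _] := all_iota po nl.
  rewrite eqxx => /esym h; have := all_iota h (num_edge nu ee).
  have [tv tn] := realize_tgtE ee.
  by rewrite vertex_eqN // tn.
- move=> v; split=> [[vv h]|->].
    apply/eqP; rewrite vertex_eqN //.
    have /andP[_ /eqP ->] := all_iota po (num_vertex nu vv).
    apply/allP => i; rewrite mem_iota => /andP[_ il].
    have [e ee ei] := edge_num nu il; have [sv sn] := realize_srcE ee.
    rewrite -ei -sn (numbering_eq nu) ?(eqP sv) ?(eqP vv) //.
    exact: h.
  split=> // e ee; have /andP[_ /eqP] := all_iota po sl.
  rewrite eqxx => /esym h; have := all_iota h (num_edge nu ee).
  have [sv sn] := realize_srcE ee.
  by rewrite vertex_eqN // sn.
Qed.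

Lemma realize_directed (u : nat) q (v : nat) : u < 20 -> all (fun e => e < 30) q ->
  num_directed p u q v ->
  directed_path realize_src realize_tgt (cl 0 u) (realize_path q) (cl 0 v).
Proof.
elim: q u => [|e q IH] u ul /=; first by move=> _ /eqP ->.
move=> /andP[el ql] /andP[/eqP su dq].
have [ed en] := clP (k := 1) el.
have ee : is_edge (cl 1 e) by rewrite /is_edge ed.
have /and3P[_ tl _] := plan_orientedP ee; rewrite en in tl.
have -> : realize_src (cl 1 e) = cl 0 u by rewrite /realize_src ee en su.
have -> : realize_tgt (cl 1 e) = cl 0 (plan_tgt p e) by rewrite /realize_tgt ee en.
rewrite ee eqxx /=.
exact: IH.
Qed.

Lemma has_realize (c : C) q : all (fun e => e < 30) q ->
  has (incident c) (realize_path q) = has (inc (dim c) (num c) 1) q.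
Proof.
elim: q => //= e q IH /andP[el ql].
by rewrite IH // incident_clr.
Qed.

Lemma edges_lt : all (fun e => e < 30) (plan_we p) && all (fun e => e < 30) (plan_ew p).
Proof. by have /and5P[_ _ /and4P[+ _ _ _] _ _] := okp; rewrite all_cat. Qed.

Local Notation we := (realize_path (plan_we p)).
Local Notation ew := (realize_path (plan_ew p)).

Lemma realize_on (c : C) : has (incident c) (we ++ ew) = plan_on p (dim c) (num c).
Proof.
by have /andP[h1 h2] := edges_lt; rewrite has_cat !has_realize // /plan_on has_cat.
Qed.

Lemma realize_meridians : support we `&` support ew = open_cell N `|` open_cell S.
Proof.
have /andP[h1 h2] := edges_lt; have [Nv Sv Nn Sn] := pole_vertex.
have [nl sl] := pole_lt.
have /and5P[_ _ /and4P[_ _ _ m] _ _] := okp.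
rewrite !support_cellsE setI_cells -(bigcup_set1 (@open_cell _ _ C) N)
  -(bigcup_set1 (@open_cell _ _ C) S) -bigcup_setU.
congr bigcup; apply/seteqP; split=> c /=; rewrite !has_realize //.
  move=> [cw ce]; have := all_cellsP m (numbering_lt nu c).
  rewrite cw ce => /eqP/esym/andP[c0 ns].
  by case/orP: ns => ns; [left|right]; apply/eqP; rewrite vertex_eqN.
move=> cNS; have := all_cellsP m (numbering_lt nu c).
suff -> : (dim c == 0) && ((num c == plan_north p) || (num c == plan_south p)).
  by move=> /eqP/andP.
by case: cNS => ->; rewrite ?Nn ?Sn eqxx ?orbT andbT; [exact: Nv|exact: Sv].
Qed.

Lemma region_sub fs (c : C) : open_cell c `<=` realize_region fs <->
  (dim c, num c) \in region p fs.
Proof. by rewrite subset_cellsP. Qed.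

Lemma realize_region_connected fs toward : plan_side p fs toward ->
  connected (realize_region fs) /\ realize_region fs !=set0.
Proof.
rewrite /plan_side => /and5P[lk nn al _ _]; pose l := [seq cl a.1 a.2 | a <- region p fs].
have lE : [set c : C | (dim c, num c) \in region p fs] = [set` l].
  apply/seteqP; split=> c /=.
    by move=> cr; apply/mapP; exists (dim c, num c) => //=; rewrite cl_num.
  by move=> /mapP[a ar ->]; have [-> ->] := clP (allP al _ ar); case: a ar.
rewrite /realize_region lE; split.
  apply: linked_connected; rewrite /l; elim: (region p fs) lk al => //= a r IH.
  move=> /andP[h lk] /andP[al rl]; rewrite IH // andbT.
  case/orP: h => [/nilP ->//|/hasP[b br ab]]; apply/orP; right.
  apply/hasP; exists (cl b.1 b.2); first exact: (map_f (fun a => cl a.1 a.2)).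
  by rewrite !incident_cl //; exact: (allP rl).
move: nn @l {lE lk al}; case: (region p fs) => // a r _.
have [x ax] := open_cell_neq0 (cl a.1 a.2).
by exists x, (cl a.1 a.2) => //=; exact: mem_head.
Qed.

Lemma ball_lt : 0 < count_cells 3. Proof. by []. Qed.

Lemma off_region (c : C) : (c != cl 3 0) && ~~ has (incident c) (we ++ ew) =
  ((dim c, num c) \in region p (plan_west p)) || ((dim c, num c) \in region p (plan_east p)).
Proof.
have /and5P[_ _ _ _ /and4P[_ /andP[h _] _ _]] := okp.
rewrite -(eqP (all_cellsP h (numbering_lt nu c))) realize_on; congr (~~ _ && _).
have [bd bn] := clP ball_lt.
apply/eqP/eqP => [->//|c3]; apply: (numbering_inj nu); first by rewrite c3 bd.
have := numbering_lt nu c; rewrite c3 bn; by case: (num c).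
Qed.

Lemma regions_apart (c d : C) : (dim c, num c) \in region p (plan_west p) ->
  (dim d, num d) \in region p (plan_east p) -> ~~ incident c d /\ ~~ incident d c.
Proof.
have /and5P[_ _ _ _ /and4P[_ /andP[_ h] _ _]] := okp => cw de.
have := allP (allP h _ cw) _ de; rewrite /inc2 /= -!(numbering_inc nu).
by move=> /andP.
Qed.

(** The complement of the meridians is the union of two connected regions without incidences between
    them, and these are then its components. *)
Lemma realize_hemispheres :
  let U := (carrier C `\` open_cell (cl 3 0)) `\` (support we `|` support ew) in
  [set connected_component U x | x in U] =
  [set realize_region (plan_west p); realize_region (plan_east p)].
Proof.
rewrite /= complement_meridianE.
have -> : [set c : C | c != cl 3 0 /\ ~~ has (incident c) (we ++ ew)] =
  [set c | (dim c, num c) \in region p (plan_west p)] `|`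
  [set c | (dim c, num c) \in region p (plan_east p)].
  apply/seteqP; split=> c /=; first by move=> /andP; rewrite off_region => /orP.
  by move=> /orP; rewrite -off_region => /andP.
set A := [set c | _ \in region p (plan_west p)]; set B := [set c | _ \in region p (plan_east p)].
have /and5P[_ _ _ sw /andP[se _]] := okp.
have [cW [w ww]] := realize_region_connected sw.
have [cE [e ee]] := realize_region_connected se.
have AB c d : A c -> B d -> ~~ incident c d /\ ~~ incident d c by exact: regions_apart.
have BA c d : B c -> A d -> ~~ incident c d /\ ~~ incident d c.
  by move=> Bc Ad; have [] := AB d c Ad Bc.
have compW x : realize_region (plan_west p) x ->
  connected_component (\bigcup_(c in A `|` B) open_cell c) x = realize_region (plan_west p).
  by move=> Wx; apply: component_cells.
have compE x : realize_region (plan_east p) x ->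
  connected_component (\bigcup_(c in A `|` B) open_cell c) x = realize_region (plan_east p).
  by move=> Ex; rewrite setUC; apply: component_cells.
have UE : \bigcup_(c in A `|` B) open_cell c =
  realize_region (plan_west p) `|` realize_region (plan_east p) by rewrite bigcup_setU.
apply/seteqP; split=> [_ [x + <-]|H].
  by rewrite {1}UE => -[/compW|/compE] ->; [left|right].
case=> ->.
  by exists w; [rewrite UE; left|exact: compW].
by exists e; [rewrite UE; right|exact: compE].
Qed.

Lemma realize_hemispheres_neq :
  realize_region (plan_west p) <> realize_region (plan_east p).
Proof.
move=> WE; have /and5P[_ _ _ sw _] := okp.
have [_ [x [c cw cx]]] := realize_region_connected sw.
have ce : (dim c, num c) \in region p (plan_east p).
  by apply/region_sub; rewrite -WE; apply/region_sub.
by have [] := regions_apart cw ce; rewrite incident_refl.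
Qed.

Lemma realize_closure_ball : closure (open_cell (cl 3 0)) = carrier C.
Proof.
apply/seteqP; split=> x; first by move=> /closure_cellP[d _ dx]; exists d.
move=> [d _ dx]; apply/closure_cellP; exists d => //; rewrite incident_clr //.
have : all_cells (fun k i => inc k i 3 0) by vm_compute.
by move=> h; exact: (all_cellsP h (numbering_lt nu d)).
Qed.

Lemma realize_side fs toward (e v : C) : plan_side p fs toward ->
  is_edge e -> open_cell e `<=` realize_region fs -> is_vertex v -> v != N -> v != S ->
  open_cell v `<=` support we `|` support ew -> incident v e -> toward (num e) = num v.
Proof.
have [nl sl] := pole_lt.
rewrite /plan_side => /and5P[_ _ _ _ /and3P[_ _ h]] ee /region_sub er vv vN vS von ve.
have := all_iota h (num_edge nu ee); move: er; rewrite (eqP ee) => -> /implyP/(_ isT) h'.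
have := all_iota h' (num_vertex nu vv).
rewrite -!vertex_eqN // vN vS -(num_inc_dims nu vv ee) ve /= andbT.
move: von; rewrite !support_cellsE -bigcup_setU subset_cellsP /= => von.
have : has (incident v) (we ++ ew) by rewrite has_cat; apply/orP.
by rewrite realize_on (eqP vv) => -> /eqP.
Qed.

Lemma realize_overlap q : all (fun e => e < 30) q -> plan_overlap p q ->
  pole_faces_overlap (realize_region (plan_west p)) (realize_region (plan_east p)) (realize_path q).
Proof.
move=> ql /andP[q0 /hasP[f + /hasP[g + /and3P[/eqP fE /eqP gE /hasP[e eq /andP[ef eg]]]]]].
rewrite !mem_iota => /andP[_ f12] /andP[_ g12].
have h0 : head 0 q \in q by case: (q) q0 => //= a q' _; exact: mem_head.
have h1 : last 0 q \in q by case: (q) q0 => //= a q' _; exact: mem_last.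
have theface fs d h : d \in q -> h < 12 ->
    [seq f' <- iota 0 12 | ((2, f') \in region p fs) && inc 1 d 2 f'] = [:: h] ->
    the_face_at (realize_region fs) (cl 1 d) (cl 2 h).
  move=> dq h12 hE; have [hd hn] := clP (k := 2) h12.
  have [dd dn] := clP (k := 1) (allP ql _ dq).
  have hin (c : C) : is_face c ->
     (open_cell c `<=` realize_region fs /\ incident (cl 1 d) c) <-> c = cl 2 h.
    move=> cc; have -> : (c = cl 2 h) <-> num c \in [:: h].
      rewrite inE -{2}hn; split=> [->//|/eqP nc]; apply: (numbering_inj nu) => //.
      by rewrite hd (eqP cc).
    rewrite -hE mem_filter mem_iota (num_face nu cc) leq0n !andbT region_sub (eqP cc).
    rewrite (numbering_inc nu) dd dn (eqP cc).
    by split=> [[-> ->]//|/andP].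
  have hh : is_face (cl 2 h) by rewrite /is_face hd.
  split; first by have [_ /(_ erefl)[]] := hin _ hh.
  by move=> c [cc cr ci]; apply/esym/hin.
exists (cl 1 (head 0 q)), (cl 1 (last 0 q)), (cl 2 f), (cl 2 g); split.
- split; last exact: theface.
  by rewrite /first_edge; case: (q) q0.
- split; last exact: theface.
  rewrite /last_edge /realize_path -map_rev; case: (lastP q) q0 => // a q' _.
  by rewrite rev_rcons last_rcons.
- exists (cl 1 e); rewrite !incident_cl ?(allP ql _ eq) //; split=> //.
  exact: map_f.
Qed.

Lemma plan_template_ex : exists T : template C,
  [/\ #|cells_in C 2 (west T)| = size (plan_west p),
      #|cells_in C 2 (east T)| = size (plan_east p) &
      distance (plan_north p) (plan_south p) <= 2 ->
      pole_dist T = distance (plan_north p) (plan_south p)].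
Proof.
have [bd bn] := clP ball_lt; have /andP[wel ewl] := edges_lt; have [nl sl] := pole_lt.
have [Nv Sv Nn Sn] := pole_vertex.
have /and5P[_ _ /and4P[_ dw de _] sw /and4P[se _ ow oe]] := okp.
have toW (e v : C) : is_edge e -> open_cell e `<=` realize_region (plan_west p) ->
    is_vertex v -> v != N -> v != S -> open_cell v `<=` support we `|` support ew ->
    incident v e -> realize_tgt e = v.
  move=> ee eW vv vN vS von ve; have [tv tn] := realize_tgtE ee.
  by apply: (numbering_inj nu); rewrite ?(eqP tv) ?(eqP vv) // tn; apply: realize_side sw _ _ _ _ _ _ _.
have awE (e v : C) : is_edge e -> open_cell e `<=` realize_region (plan_east p) ->
    is_vertex v -> v != N -> v != S -> open_cell v `<=` support we `|` support ew ->
    incident v e -> realize_src e = v.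
  move=> ee eW vv vN vS von ve; have [tv tn] := realize_srcE ee.
  by apply: (numbering_inj nu); rewrite ?(eqP tv) ?(eqP vv) // tn; apply: realize_side se _ _ _ _ _ _ _.
pose T := Template bd realize_closure_ball realize_bipolar (realize_directed nl wel dw)
  (realize_directed nl ewl de) realize_meridians realize_hemispheres_neq realize_hemispheres
  toW awE (realize_overlap wel ow) (realize_overlap ewl oe).
have hl fs toward : plan_side p fs toward -> hemi_list num (realize_region fs) fs.
  rewrite /plan_side => /and5P[_ _ _ u /and3P[l12 fr _]]; split=> [//|i|f ff]; first exact: (allP l12).
  by rewrite region_sub (eqP ff) (eqP (all_iota fr (num_face nu ff))).
exists T; split.
- exact: (hemi_list_size nu (hl _ _ sw)).
- exact: (hemi_list_size nu (hl _ _ se)).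
- by move=> d2; rewrite (pole_distE nu) /= Nn Sn.
Qed.

End PlanTemplate.

Lemma plan_template (R : realType) (X : topologicalType) (C : regular_cw R X) (p : plan) :
  is_solid_dodecahedron C -> plan_ok p -> size (plan_west p) <= size (plan_east p) ->
  distance (plan_north p) (plan_south p) <= 2 ->
  exists T : template C,
    [/\ #|cells_in C 2 (west T)| <= #|cells_in C 2 (east T)|,
        face_count T = size (plan_west p) &
        pole_dist T = distance (plan_north p) (plan_south p)].
Proof.
move=> /solid_numbering[num nu] okp we d2; have [cl clP] := cell_at_ex nu.
have [T [w e d]] := plan_template_ex nu okp clP.
exists T; split; [by rewrite w e| |exact: d].
by rewrite /face_count /small_hemisphere w e we.
Qed.

(** * Radial homeomorphisms *)

Local Open Scope ring_scope.

Lemma cvg_mx (T : Type) (F : set_system T) (FF : Filter F) (K : topologicalType) m n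
    (f : T -> 'M[K]_(m, n)) (M : 'M[K]_(m, n)) :
  (forall i j, (fun x => f x i j) @ F --> M i j) -> f @ F --> M.
Proof.
move=> h A [P MP sub].
have : \forall x \near F, forall i j, P i j (f x i j).
  apply: (@filter_forall _ _ (fun i x => forall j, P i j (f x i j)) F FF) => i.
  apply: (@filter_forall _ _ (fun j x => P i j (f x i j)) F FF) => j.
  exact: h (MP i j).
by apply: filterS => x Px; exact: sub.
Qed.

Section EuclideanNorm.
Context (R : realType).

Definition norm2 n (y : 'rV[R]_n) : R := Num.sqrt (\sum_i y ord0 i ^+ 2).

Lemma sum_sqr_ge0 n (y : 'rV[R]_n) : 0 <= \sum_i y ord0 i ^+ 2.
Proof. by apply: sumr_ge0 => i _; exact: sqr_ge0. Qed.

Lemma norm2_ge0 n (y : 'rV[R]_n) : 0 <= norm2 y.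
Proof. exact: sqrtr_ge0. Qed.

Lemma norm2_le1 n (y : 'rV[R]_n) : (\sum_i y ord0 i ^+ 2 <= 1) = (norm2 y <= 1).
Proof. by rewrite /norm2 -{2}sqrtr1 ler_sqrt. Qed.

Lemma norm2_lt1 n (y : 'rV[R]_n) : (\sum_i y ord0 i ^+ 2 < 1) = (norm2 y < 1).
Proof. by rewrite /norm2 -{2}sqrtr1 ltr_sqrt. Qed.

Lemma norm2_eq0 n (y : 'rV[R]_n) : norm2 y <= 0 -> y = 0.
Proof.
move=> y0; have /eqP : norm2 y = 0 by apply/eqP; rewrite eq_le y0 norm2_ge0.
rewrite sqrtr_eq0 => s0; apply/rowP => i; rewrite mxE.
have : \sum_i y ord0 i ^+ 2 == 0 by rewrite eq_le s0 sum_sqr_ge0.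
rewrite psumr_eq0 => [/allP/(_ i)|j _]; last exact: sqr_ge0.
by rewrite mem_index_enum sqrf_eq0 => /(_ isT)/eqP.
Qed.

Lemma norm2Z n (a : R) (y : 'rV[R]_n) : 0 <= a -> norm2 (a *: y) = a * norm2 y.
Proof.
move=> a0; rewrite /norm2 (eq_bigr (fun i => a ^+ 2 * y ord0 i ^+ 2)); last first.
  by move=> i _; rewrite mxE exprMn.
by rewrite -mulr_sumr sqrtrM ?sqr_ge0 // sqrtr_sqr ger0_norm.
Qed.

Lemma norm2_0 n : norm2 (0 : 'rV[R]_n) = 0.
Proof. by rewrite /norm2 big1 ?sqrtr0 // => i _; rewrite mxE expr0n. Qed.

Lemma normr_le_norm2 n (y : 'rV[R]_n) : `|y| <= norm2 y.
Proof.
rewrite [leLHS]mx_normrE; apply/bigmax_leP; split=> [|[i j] _ /=]; first exact: norm2_ge0.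
rewrite (ord1 i) -sqrtr_sqr ler_sqrt ?sum_sqr_ge0 // (bigD1 j) //= lerDl.
by apply: sumr_ge0 => k _; exact: sqr_ge0.
Qed.

Lemma norm2_le n (y : 'rV[R]_n) (b : 'I_n -> R) : (forall j, `|y ord0 j| <= b j) ->
  norm2 y <= Num.sqrt (\sum_j b j ^+ 2).
Proof.
move=> yb; apply: ler_wsqrtr; apply: ler_sum => j _.
by rewrite -real_normK ?num_real // lerXn2r ?nnegrE // (le_trans _ (yb j)).
Qed.

Lemma norm2_continuous n : continuous (@norm2 n).
Proof.
have sq i : continuous (fun y : 'rV[R]_n => y ord0 i ^+ 2).
  move=> y; apply: (@continuous_comp _ _ _ (fun y : 'rV[R]_n => y ord0 i) (fun x => x ^+ 2)).
    exact: coord_continuous.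
  exact: exprn_continuous.
have sum_sq : continuous (fun y : 'rV[R]_n => \sum_i y ord0 i ^+ 2).
  by apply: continuous_big => //; exact: add_continuous.
move=> y; apply: (@continuous_comp _ _ _ (fun y : 'rV[R]_n => \sum_i y ord0 i ^+ 2) Num.sqrt).
  exact: sum_sq.
exact: sqrt_continuous.
Qed.

End EuclideanNorm.

Section Radial.
Context (R : realType) (n : nat) (gauge : 'rV[R]_n -> R) (M : R).
Hypothesis gauge_continuous : continuous gauge.
Hypothesis gaugeZ : forall a y, 0 <= a -> gauge (a *: y) = a * gauge y.
Hypothesis gauge_ge0 : forall y, 0 <= gauge y.
Hypothesis gauge_bounded : forall y, gauge y <= 1 -> norm2 y <= M.

Lemma gauge0 : gauge 0 = 0.
Proof. by rewrite -[0](scale0r 0) gaugeZ // mul0r. Qed.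

Lemma radius_ge0 : 0 <= M.
Proof. by apply: le_trans (gauge_bounded (y := 0) _); rewrite ?norm2_ge0 // gauge0. Qed.

(** Homogeneity reduces a positive gauge to gauge 1. If the gauge vanishes, all nonnegative
    multiples of [y] lie in the bounded body, which forces norm 0. *)
Lemma norm2_le_gauge y : norm2 y <= M * gauge y.
Proof.
have [g0|g0] := leP (gauge y) 0; last first.
  have := gauge_bounded (y := (gauge y)^-1 *: y).
  rewrite gaugeZ ?norm2Z ?invr_ge0 ?(ltW g0) // mulVf ?gt_eqF // lexx => /(_ isT).
  by rewrite mulrC ler_pdivrMr.
have ge : gauge y = 0 by apply/eqP; rewrite eq_le g0 gauge_ge0.
rewrite ge mulr0 leNgt; apply/negP => y0.
(* This multiple of [y] would have norm M + 1 and gauge 0. *)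
have a0 : 0 <= (M + 1) / norm2 y by rewrite divr_ge0 ?norm2_ge0 // addr_ge0 // radius_ge0.
have := gauge_bounded (y := ((M + 1) / norm2 y) *: y).
rewrite gaugeZ // ge mulr0 ler01 norm2Z // divfK ?gt_eqF // => /(_ isT).
by rewrite gerDl ler10.
Qed.

Lemma gauge_eq0 y : gauge y <= 0 -> y = 0.
Proof.
move=> g0; apply: norm2_eq0; apply: le_trans (norm2_le_gauge y) _.
by apply: mulr_ge0_le0 => //; exact: radius_ge0.
Qed.

(* Both radial maps send 0 to 0, by the convention x / 0 = 0. *)
Definition ball_to_body (y : 'rV[R]_n) : 'rV[R]_n := (norm2 y / gauge y) *: y.
Definition body_to_ball (y : 'rV[R]_n) : 'rV[R]_n := (gauge y / norm2 y) *: y.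

Lemma gauge_ball_to_body y : gauge (ball_to_body y) = norm2 y.
Proof.
rewrite gaugeZ ?divr_ge0 ?norm2_ge0 //.
have [/gauge_eq0 ->|g0] := leP (gauge y) 0; last by rewrite divfK ?gt_eqF.
by rewrite gauge0 mulr0 norm2_0.
Qed.

Lemma norm2_body_to_ball y : norm2 (body_to_ball y) = gauge y.
Proof.
rewrite norm2Z ?divr_ge0 ?norm2_ge0 //.
have [/norm2_eq0 ->|y0] := leP (norm2 y) 0; last by rewrite divfK ?gt_eqF.
by rewrite gauge0 !mul0r.
Qed.

Lemma ball_to_bodyK : cancel ball_to_body body_to_ball.
Proof.
move=> y; have [/norm2_eq0 ->|y0] := leP (norm2 y) 0.
  by rewrite /ball_to_body /body_to_ball !scaler0.
have g0 : 0 < gauge y by rewrite ltNge; apply/negP => /gauge_eq0 ye; move: y0; rewrite ye norm2_0 ltxx.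
rewrite /body_to_ball gauge_ball_to_body /ball_to_body norm2Z ?divr_ge0 ?norm2_ge0 //.
rewrite scalerA; rewrite [X in X *: _](_ : _ = 1) ?scale1r //.
by field; rewrite !gt_eqF.
Qed.

Lemma body_to_ballK : cancel body_to_ball ball_to_body.
Proof.
move=> y; have [/norm2_eq0 ->|y0] := leP (norm2 y) 0.
  by rewrite /ball_to_body /body_to_ball !scaler0.
have g0 : 0 < gauge y by rewrite ltNge; apply/negP => /gauge_eq0 ye; move: y0; rewrite ye norm2_0 ltxx.
rewrite /ball_to_body norm2_body_to_ball /body_to_ball gaugeZ ?divr_ge0 ?norm2_ge0 //.
rewrite scalerA; rewrite [X in X *: _](_ : _ = 1) ?scale1r //.
by field; rewrite !gt_eqF.
Qed.

(** At 0 the factor [s] need not be continuous; there the bound [b] squeezes the product to 0. *)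
Lemma scaling_continuous (s : 'rV[R]_n -> R) (b : 'rV[R]_n -> R) :
  (forall y, y != 0 -> {for y, continuous s}) ->
  (forall y, `|s y *: y| <= b y) -> {for 0, continuous b} -> b 0 = 0 ->
  continuous (fun y => s y *: y).
Proof.
move=> sc sb bc b0 y; have [->|yn0] := eqVneq y 0; last by apply: (cvgZ (sc y yn0)); exact: cvg_id.
have lim0 : `|s x *: x| @[x --> (0 : 'rV[R]_n)] --> (0 : R).
  apply: (@squeeze_cvgr _ (nbhs (0 : 'rV[R]_n)) _ R (cst 0) b).
  - by near=> x; rewrite /= normr_ge0 sb.
  - exact: cvg_cst.
  - by rewrite -b0; exact: bc.
have h := iffLR (norm_cvg0P (fun x => s x *: x)) lim0.
by rewrite /continuous_at scaler0; exact: h.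
Unshelve. all: by end_near. Qed.

Lemma ball_to_body_continuous : continuous ball_to_body.
Proof.
apply: (@scaling_continuous _ (fun y => M * norm2 y)).
- move=> y y0; apply: (cvgM (@norm2_continuous R n y)); apply: (cvgV _ (@gauge_continuous y)).
  by apply: contraNneq y0 => g0; apply/eqP/gauge_eq0; rewrite g0.
- move=> y; have [/gauge_eq0 ->|g0] := leP (gauge y) 0.
    by rewrite scaler0 normr0 mulr_ge0 ?norm2_ge0 // radius_ge0.
  rewrite normrZ ger0_norm ?divr_ge0 ?norm2_ge0 // mulrAC ler_pdivrMr // mulrAC.
  apply: ler_pM; rewrite ?norm2_ge0 ?normr_le_norm2 //.
  exact: norm2_le_gauge.
- exact: (cvgM (cvg_cst M) (@norm2_continuous R n 0)).
- by rewrite norm2_0 mulr0.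
Qed.

Lemma body_to_ball_continuous : continuous body_to_ball.
Proof.
apply: (@scaling_continuous _ gauge).
- move=> y y0; apply: (cvgM (@gauge_continuous y)); apply: (cvgV _ (@norm2_continuous R n y)).
  by apply: contraNneq y0 => g0; apply/eqP/norm2_eq0; rewrite g0.
- move=> y; apply: le_trans (normr_le_norm2 _) _.
  by rewrite -/(body_to_ball y) norm2_body_to_ball.
- exact: gauge_continuous.
- exact: gauge0.
Qed.

End Radial.

Lemma mulmx_continuous (R : realType) m n (B : 'M[R]_(m, n)) :
  continuous (fun y : 'rV[R]_m => y *m B).
Proof.
move=> y; apply: (@cvg_mx _ (nbhs y) (nbhs_filter y)) => i j.
have -> : (fun x : 'rV[R]_m => (x *m B) i j) = (fun x => \sum_k x i k * B k j).
  by apply/funext => x; rewrite mxE.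
have c : continuous (fun x : 'rV[R]_m => \sum_k x i k * B k j).
  apply: continuous_big; first exact: add_continuous.
  by move=> k _ z; apply: continuousM; [exact: coord_continuous|exact: cst_continuous].
by rewrite mxE; exact: c.
Qed.

(** * Faces of a polytope as balls *)

Section FaceBall.
Context (R : realType) (a : nat -> 'cV[R]_3).
Definition height (f : nat) (x : 'rV[R]_3) : R := (x *m a f) ord0 ord0.

Lemma heightD f x y : height f (x + y) = height f x + height f y.
Proof. by rewrite /height mulmxDl mxE. Qed.

Lemma heightB f x y : height f (x - y) = height f x - height f y.
Proof. by rewrite /height mulmxBl !mxE. Qed.

Lemma heightZ f c x : height f (c *: x) = c * height f x.
Proof. by rewrite /height -scalemxAl mxE. Qed.

Lemma height_sum f (I : Type) (r : seq I) (F : I -> 'rV[R]_3) :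
  height f (\sum_(i <- r) F i) = \sum_(i <- r) height f (F i).
Proof. by rewrite /height mulmx_suml summxE. Qed.

Lemma height_continuous f : continuous (height f).
Proof.
move=> x; apply: (@continuous_comp _ _ _ (fun y : 'rV[R]_3 => y *m a f) (fun M => M ord0 ord0)).
  exact: mulmx_continuous.
exact: coord_continuous.
Qed.

Variables (d : nat) (B : 'M[R]_(d, 3)) (Q : 'M[R]_(3, d)) (p : 'rV[R]_3) (G : seq nat) (b : R).
Hypothesis BQ : B *m Q = 1%:M.
Hypothesis Gp : forall g, g \in G -> height g p < 1.

(** As [Q] is a right inverse of [B], the first condition says that [x - p] lies in the row space of
    [B], the directions of the face. [G] will be the list of facets that do not contain the face. *)
Definition face_body : set 'rV[R]_3 :=
  [set x | (x - p) *m Q *m B = x - p /\ forall g, g \in G -> height g x <= 1].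
Definition face_interior : set 'rV[R]_3 :=
  [set x | (x - p) *m Q *m B = x - p /\ forall g, g \in G -> height g x < 1].

Hypothesis body_bounded : forall x, face_body x -> forall k, `|(x - p) ord0 k| <= b.

Definition slope (g : nat) (y : 'rV[R]_d) : R := height g (y *m B) / (1 - height g p).
(** The Minkowski functional about [p] of the face in the coordinates given by [B]: a slope is at
    most 1 exactly when [p + y *m B] respects the facet. The initial 0 makes it nonnegative. *)
Definition face_gauge (y : 'rV[R]_d) : R := foldr (fun g m => Num.max (slope g y) m) 0 G.

Lemma face_gauge_le1 y : face_gauge y <= 1 <-> forall g, g \in G -> height g (p + y *m B) <= 1.
Proof.
rewrite /face_gauge; elim: G Gp => [|g G' IH] Gp' /=.
  by split.
have gp : 0 < 1 - height g p by rewrite subr_gt0 Gp' ?mem_head.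
have sg : (slope g y <= 1) = (height g (p + y *m B) <= 1).
  by rewrite /slope ler_pdivrMr // mul1r heightD lerBrDl.
have {}IH : _ <-> _ := IH (fun f fG => Gp' f (@mem_behead _ (g :: G') f fG)).
rewrite ge_max sg; split=> [/andP[h /IH h'] f|h].
  by rewrite inE => /orP[/eqP ->|/h'].
rewrite h ?mem_head //=; apply/IH => f fG; apply: h.
by rewrite inE fG orbT.
Qed.

Lemma face_gauge_lt1 y : face_gauge y < 1 <-> forall g, g \in G -> height g (p + y *m B) < 1.
Proof.
rewrite /face_gauge; elim: G Gp => [|g G' IH] Gp' /=.
  by split.
have gp : 0 < 1 - height g p by rewrite subr_gt0 Gp' ?mem_head.
have sg : (slope g y < 1) = (height g (p + y *m B) < 1).
  by rewrite /slope ltr_pdivrMr // mul1r heightD ltrBrDl.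
have {}IH : _ <-> _ := IH (fun f fG => Gp' f (@mem_behead _ (g :: G') f fG)).
rewrite gt_max sg; split=> [/andP[h /IH h'] f|h].
  by rewrite inE => /orP[/eqP ->|/h'].
rewrite h ?mem_head //=; apply/IH => f fG; apply: h.
by rewrite inE fG orbT.
Qed.

Lemma face_gauge_ge0 y : 0 <= face_gauge y.
Proof. by rewrite /face_gauge; elim: G => //= g G' IH; rewrite le_max IH orbT. Qed.

Lemma face_gaugeZ c y : 0 <= c -> face_gauge (c *: y) = c * face_gauge y.
Proof.
move=> c0; rewrite /face_gauge; elim: G => [|g G' IH] /=; first by rewrite mulr0.
by rewrite IH maxr_pMr // /slope -scalemxAl heightZ mulrA.
Qed.

Lemma face_gauge_continuous : continuous face_gauge.
Proof.
rewrite /face_gauge; elim: G => [|g G' IH] /=; first by move=> y; exact: cst_continuous.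
move=> y; apply: (@continuous_max R _ (slope g)); last exact: IH.
apply: continuousM; last exact: cst_continuous.
apply: (@continuous_comp _ _ _ (fun y : 'rV[R]_d => y *m B) (height g)).
  exact: mulmx_continuous.
exact: height_continuous.
Qed.

Lemma face_point y : (p + y *m B - p) *m Q *m B = p + y *m B - p.
Proof. by rewrite addrC addKr -[y *m B *m Q]mulmxA BQ mulmx1. Qed.

(** From [y = y *m B *m Q], where the entries of [y *m B] are bounded by [b] on the body. *)
Definition face_radius : R := Num.sqrt (\sum_j (\sum_k b * `|Q k j|) ^+ 2).

Lemma face_gauge_bounded y : face_gauge y <= 1 -> norm2 y <= face_radius.
Proof.
move=> /face_gauge_le1 h; apply: norm2_le => j.
have xb := body_bounded (conj (face_point y) h).
rewrite -[y]mulmx1 -BQ mulmxA mxE.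
apply: le_trans (ler_norm_sum _ _ _) _; apply: ler_sum => k _.
rewrite normrM ler_wpM2r //.
by have := xb k; rewrite addrC addKr.
Qed.

Lemma face_ball : exists phi : 'rV[R]_d -> 'rV[R]_3,
  homeomorphism_on (@closed_unit_ball R d) face_body phi /\
  phi @` @open_unit_ball R d = face_interior.
Proof.
pose phi y := p + ball_to_body face_gauge y *m B.
pose psi x := body_to_ball face_gauge ((x - p) *m Q).
have gc := face_gauge_continuous; have gZ := face_gaugeZ.
have g0 := face_gauge_ge0; have gb := face_gauge_bounded.
have phiK : cancel phi psi.
  move=> y; rewrite /psi /phi addrC addKr -mulmxA BQ mulmx1.
  exact: (ball_to_bodyK gZ g0 gb).
have psiK x : (x - p) *m Q *m B = x - p -> phi (psi x) = x.
  move=> xp; rewrite /phi /psi (body_to_ballK gZ g0 gb) xp.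
  by rewrite addrC subrK.
have pc : continuous phi.
  move=> y; apply: (@cvgD R 'rV[R]_3 'rV[R]_d (nbhs y) (nbhs_filter y) (cst p)); first exact: cvg_cst.
  apply: (@continuous_comp _ _ _ (ball_to_body face_gauge) (fun y => y *m B)).
    exact: (ball_to_body_continuous gc gZ g0 gb).
  exact: mulmx_continuous.
have sc : continuous psi.
  move=> x; apply: (@continuous_comp 'rV[R]_3 'rV[R]_d 'rV[R]_d (fun x => (x - p) *m Q) (body_to_ball face_gauge)).
    apply: (@continuous_comp 'rV[R]_3 'rV[R]_3 'rV[R]_d (fun x => x - p) (fun x => x *m Q)).
      by apply: (@cvgB R 'rV[R]_3 'rV[R]_3 (nbhs x) (nbhs_filter x) id (cst p)); [exact: cvg_id|exact: cvg_cst].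
    exact: mulmx_continuous.
  exact: (body_to_ball_continuous gc gZ g0).
have le1 x : (x - p) *m Q *m B = x - p ->
    face_gauge ((x - p) *m Q) <= 1 <-> forall g, g \in G -> height g x <= 1.
  move=> xp; have -> : (forall g, g \in G -> height g x <= 1) <->
     forall g, g \in G -> height g (p + (x - p) *m Q *m B) <= 1.
    by rewrite xp addrC subrK.
  exact: face_gauge_le1.
have lt1 x : (x - p) *m Q *m B = x - p ->
    face_gauge ((x - p) *m Q) < 1 <-> forall g, g \in G -> height g x < 1.
  move=> xp; have -> : (forall g, g \in G -> height g x < 1) <->
     forall g, g \in G -> height g (p + (x - p) *m Q *m B) < 1.
    by rewrite xp addrC subrK.
  exact: face_gauge_lt1.
have n2 x : norm2 (psi x) = face_gauge ((x - p) *m Q).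
  exact: (norm2_body_to_ball gZ g0).
have n1 y : face_gauge ((phi y - p) *m Q) = norm2 y by rewrite -n2 phiK.
exists phi; split; first exists psi; first split.
- apply/seteqP; split=> [_ [y yb <-]|x [xp xG]].
    split; first exact: face_point.
    by apply/le1; [exact: face_point|rewrite n1 -norm2_le1].
  exists (psi x); last exact: psiK.
  by rewrite /closed_unit_ball /= norm2_le1 n2; apply/le1.
- by move=> y _; exact: phiK.
- exact: continuous_subspaceT.
- exact: continuous_subspaceT.
- apply/seteqP; split=> [_ [y yb <-]|x [xp xG]].
    split; first exact: face_point.
    by apply/lt1; [exact: face_point|rewrite n1 -norm2_lt1].
  exists (psi x); last exact: psiK.
  by rewrite /open_unit_ball /= norm2_lt1 n2; apply/lt1.
Qed.

End FaceBall.

(** * A dodecahedron in space *)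

(* Facet normals and 12 times the vertices of a pyritohedron, numbered as in
   [pentagons]: it has the combinatorics of the dodecahedron and rational
   coordinates. *)
Definition facet_normals : seq (seq int) :=
  [:: [:: 0; 1; 2]; [:: 1; 2; 0]; [:: 2; 0; 1]; [:: 0; -1; 2]; [:: -2; 0; 1];
      [:: -1; 2; 0]; [:: 2; 0; -1]; [:: 1; -2; 0]; [:: -1; -2; 0]; [:: -2; 0; -1];
      [:: 0; 1; -2]; [:: 0; -1; -2]]%Z.

Definition corners12 : seq (seq int) :=
  [:: [:: 0; 6; 3]; [:: 4; 4; 4]; [:: 3; 0; 6]; [:: -3; 0; 6]; [:: -4; 4; 4];
      [:: 0; 6; -3]; [:: 6; 3; 0]; [:: 4; -4; 4]; [:: -4; -4; 4]; [:: -6; 3; 0];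
      [:: 4; 4; -4]; [:: 6; -3; 0]; [:: 0; -6; 3]; [:: -6; -3; 0]; [:: -4; 4; -4];
      [:: 3; 0; -6]; [:: 4; -4; -4]; [:: 0; -6; -3]; [:: -4; -4; -4]; [:: -3; 0; -6]]%Z.

Definition facet_normal (f k : nat) : int := nth 0 (nth [::] facet_normals f) k.
Definition corner12 (v k : nat) : int := nth 0 (nth [::] corners12 v) k.

Definition dot3 (u v : nat -> int) : int := u 0%N * v 0%N + u 1%N * v 1%N + u 2%N * v 2%N.

Definition det3 (u v w : nat -> int) : int :=
  u 0%N * (v 1%N * w 2%N - v 2%N * w 1%N) - u 1%N * (v 0%N * w 2%N - v 2%N * w 0%N)
  + u 2%N * (v 0%N * w 1%N - v 1%N * w 0%N).

(** Normals are scaled so that each facet plane has height 1, which is 12 for the scaled corners. *)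
Definition corners_ok : bool :=
  all (fun f => all (fun v => if inc 0 v 2 f then dot3 (corner12 v) (facet_normal f) == 12%Z
     else dot3 (corner12 v) (facet_normal f) < 12%Z) (iota 0 20)) (iota 0 12).

Lemma corners_okP : corners_ok.
Proof. by vm_compute. Qed.

Definition facets_adjacent (f g : nat) : bool :=
  (f == g) || has (fun e => inc 1 e 2 f && inc 1 e 2 g) (iota 0 30).

(* For facets that do not meet, n_f + n_g is by Cramer's rule a combination of
   the normals at some vertex, with nonnegative coefficients of sum less than 2;
   everything is multiplied by the squared determinant. *)
Definition separated_facets (f g : nat) : bool :=
  has (fun v =>
    let u k := facet_normal f k + facet_normal g k in
    let h := vertex_faces v in
    let n0 := facet_normal (nth 0%N h 0) in
    let n1 := facet_normal (nth 0%N h 1) in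
    let n2 := facet_normal (nth 0%N h 2) in
    let D := det3 n0 n1 n2 in
    let c0 := D * det3 u n1 n2 in
    let c1 := D * det3 n0 u n2 in
    let c2 := D * det3 n0 n1 u in
    [&& 0 <= c0, 0 <= c1, 0 <= c2, c0 + c1 + c2 < 2%Z * (D * D),
        all (fun k => D * D * u k == c0 * n0 k + c1 * n1 k + c2 * n2 k) (iota 0 3) &
        all (fun f => (f < 12)%N) h && (size h == 3%N)]) (iota 0 20).

Lemma separated_facetsP :
  all (fun f => all (fun g => facets_adjacent f g || separated_facets f g) (iota 0 12)) (iota 0 12).
Proof. by vm_compute. Qed.

Definition active (k i : nat) : seq nat := [seq f <- iota 0 12 | inc k i 2 f].

Definition has_cell (P : nat -> nat -> bool) : bool :=
  has (fun k => has (P k) (iota 0 (count_cells k))) (iota 0 4).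

Fixpoint forall_cliques (P : seq nat -> bool) (fs acc : seq nat) : bool :=
  if fs is f :: fs' then
    if forall_cliques P fs' acc then
      if all (facets_adjacent f) acc then forall_cliques P fs' (rcons acc f) else true
    else false
  else P acc.

(** Three mutually adjacent pentagons always share a vertex and no four are mutually adjacent. This
    is why knowing which pairs of facets can be tight together determines all faces of the
    polytope. *)
Lemma cliques_active :
  forall_cliques (fun s => has_cell (fun k i => active k i == s)) (iota 0 12) [::].
Proof. by vm_compute. Qed.

Lemma forall_cliquesP P (a : pred nat) fs acc :
  (forall f g, a f -> a g -> f \in acc ++ fs -> g \in acc ++ fs -> facets_adjacent f g) ->
  all a acc -> forall_cliques P fs acc -> P (acc ++ [seq f <- fs | a f]).
Proof.
elim: fs acc => [|f fs IH] acc adj aacc /=; first by rewrite cats0.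
case: ifP => // h0; case: ifP => [h1 h2|h1 _]; case: ifP => af.
- rewrite -cat_rcons; apply: IH => //; last by rewrite all_rcons af.
  by move=> g h; rewrite cat_rcons; exact: adj.
- apply: IH => // g h ag ah gin hin; apply: adj => //.
    by move: gin; rewrite !mem_cat inE => /orP[] ->; rewrite ?orbT.
  by move: hin; rewrite !mem_cat inE => /orP[] ->; rewrite ?orbT.
- case/negP: (negbT h1); apply/allP => g gacc; apply: adj => //.
  + exact: (allP aacc).
  + by rewrite mem_cat mem_head orbT.
  + by rewrite mem_cat gacc.
- apply: IH => // g h ag ah gin hin; apply: adj => //.
    by move: gin; rewrite !mem_cat inE => /orP[] ->; rewrite ?orbT.
  by move: hin; rewrite !mem_cat inE => /orP[] ->; rewrite ?orbT.
Qed.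

(** The clauses serve the cell structure in turn: codimension equals the number of facets through a
    cell; omitting any one of these facets leaves those of some other cell, which yields independent
    normals; and incidence is reversed inclusion of facet sets. *)
Definition active_ok : bool :=
  all_cells (fun k i => [&& (size (active k i) + k == 3)%N,
    all (fun f => has_cell (fun l j => all (fun g => (g != f) == inc l j 2 g) (active k i)))
      (active k i) &
    all_cells (fun l j => [&& (active k i == active l j) ==> ((k == l) && (i == j)),
       inc k i l j == all (fun f => f \in active k i) (active l j) &
       ((k != l) || (i != j)) && all (fun f => f \in active k i) (active l j) ==> (k < l)%N])]).

Lemma active_okP : active_ok.
Proof. by vm_compute. Qed.

Lemma has_cellP P : has_cell P -> exists k i, [/\ (k < 4)%N, (i < count_cells k)%N & P k i].
Proof.
move=> /hasP[k]; rewrite mem_iota => /andP[_ k4] /hasP[i]; rewrite mem_iota => /andP[_ ik] Pki.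
by exists k, i.
Qed.

Lemma mem_active k i f : (f \in active k i) = (f < 12)%N && inc k i 2 f.
Proof. by rewrite mem_filter mem_iota andbC. Qed.

Section Pyritohedron.
Context (R : realType).

Definition normal (f : nat) : 'cV[R]_3 := \col_(k < 3) (facet_normal f k)%:~R.
Local Notation ht := (height normal).
Definition corner (v : nat) : 'rV[R]_3 := 12%:R^-1 *: \row_(k < 3) (corner12 v k)%:~R.

Lemma height_normalE f (x : 'rV[R]_3) : ht f x =
  (facet_normal f 0)%:~R * x ord0 (inord 0) + (facet_normal f 1)%:~R * x ord0 (inord 1)
  + (facet_normal f 2)%:~R * x ord0 (inord 2).
Proof.
rewrite /height mxE !big_ord_recl big_ord0 addr0 !mxE /= !(mulrC (x _ _)) addrA.
have E1 : lift ord0 ord0 = inord 1 :> 'I_3 by apply: val_inj; rewrite /= inordK.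
have E2 : lift ord0 (lift ord0 ord0) = inord 2 :> 'I_3 by apply: val_inj; rewrite /= inordK.
have E0 : ord0 = inord 0 :> 'I_3 by apply: val_inj; rewrite /= inordK.
by rewrite E1 E2 [in X in X + _ + _]E0.
Qed.

Lemma height_corner f v : (f < 12)%N -> (v < 20)%N ->
  if inc 0 v 2 f then ht f (corner v) = 1 else ht f (corner v) < 1.
Proof.
move=> f12 v20.
have -> : ht f (corner v) = (dot3 (corner12 v) (facet_normal f))%:~R / 12%:R.
  rewrite height_normalE /corner !mxE !inordK // /dot3 !rmorphD !rmorphM /=.
  by field.
have := all_iota (all_iota corners_okP f12) v20; case: ifP => _.
  by move=> /eqP ->; rewrite -[(12%Z)%:~R]/(12%:R) divff ?pnatr_eq0.
by move=> h; rewrite ltr_pdivrMr ?ltr0n // mul1r -[ltRHS]/((12%Z)%:~R) ltr_int.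
Qed.

Definition centre (k i : nat) : 'rV[R]_3 :=
  (size (cell_verts k i))%:R^-1 *: \sum_(v <- cell_verts k i) corner v.

Lemma cell_verts_ok k i : (i < count_cells k)%N ->
  cell_verts k i != [::] /\ all (fun x => (x < 20)%N) (cell_verts k i).
Proof.
by have /andP[cl _] := cell_list_completeP => ik; have /andP[/andP[/andP[? ?] _] _] := all_cellsP cl ik.
Qed.

Lemma inc_vertex v f : (v < 20)%N -> inc 0 v 2 f = (v \in cell_verts 2 f).
Proof.
move=> v20; rewrite /inc; suff -> : cell_verts 0 v = [:: v] by rewrite /= andbT.
have h : all (fun v => cell_verts 0 v == [:: v]) (iota 0 20) by vm_compute.
by apply/eqP; exact: all_iota h v20.
Qed.

Lemma height_centre k i f : (i < count_cells k)%N -> (f < 12)%N ->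
  if inc k i 2 f then ht f (centre k i) = 1 else ht f (centre k i) < 1.
Proof.
move=> ik f12; have [v0 /allP v20] := cell_verts_ok ik.
have hv v : v \in cell_verts k i -> if v \in cell_verts 2 f then ht f (corner v) = 1
    else ht f (corner v) < 1.
  by move=> vin; rewrite -inc_vertex ?v20 //; apply: height_corner; rewrite ?v20.
rewrite /centre heightZ height_sum.
have n0 : 0 < (size (cell_verts k i))%:R :> R by rewrite ltr0n; case: (cell_verts k i) v0.
have sum1 : \sum_(v <- cell_verts k i) (1 : R) = (size (cell_verts k i))%:R.
  by rewrite big_const_seq count_predT iter_addr_0.
rewrite mulrC; case: ifP => [/allP al|/negbT /allPn[v vin vf]].
  rewrite (eq_big_seq (fun=> 1)) ?sum1 ?divff ?gt_eqF // => v vin.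
  by have := hv v vin; rewrite al.
rewrite ltr_pdivrMr // mul1r -sum1.
have le1 w : w \in cell_verts k i -> ht f (corner w) <= 1.
  by move=> win; have := hv w win; case: ifP => _ => [->//|/ltW].
rewrite (big_rem v) //= [ltRHS](big_rem v) //=.
apply: ltr_leD; first by have := hv v vin; rewrite (negbTE vf).
by rewrite big_seq [leRHS]big_seq; apply: ler_sum => w /mem_rem win; exact: le1.
Qed.

Definition polytope : set 'rV[R]_3 := [set x | forall f, (f < 12)%N -> ht f x <= 1].

Lemma polytope_bounded x : polytope x -> forall k, `|x ord0 k| <= 1.
Proof.
move=> Px k.
have H f : (f < 12)%N -> (facet_normal f 0)%:~R * x ord0 (inord 0) +
    (facet_normal f 1)%:~R * x ord0 (inord 1)
    + (facet_normal f 2)%:~R * x ord0 (inord 2) <= 1.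
  by move=> f12; rewrite -height_normalE; exact: Px.
have := (H 0%N isT, H 1%N isT, H 2%N isT, H 3%N isT, H 4%N isT, H 5%N isT).
have := (H 6%N isT, H 7%N isT, H 8%N isT, H 9%N isT, H 10%N isT, H 11%N isT).
rewrite /facet_normal /= ?(rmorphN, rmorph1, rmorph0) /=.
have -> : k = inord k by apply: val_inj; rewrite /= inordK.
set X := x _ _; set Y := x _ _; set Z := x _ _.
case: k => [[|[|[|//]]] _] /=; rewrite -/X -/Y -/Z ler_norml => -[[[[[h6 h7] h8] h9] h10] h11] [[[[[h0 h1] h2] h3] h4] h5]; apply/andP; split; lra.
Qed.

(** If the facets do not meet, the certificate bounds the sum of their heights on the polytope by a
    number below 2, so they cannot both be 1. *)
Lemma polytope_adjacent x f g : polytope x -> (f < 12)%N -> (g < 12)%N ->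
  ht f x = 1 -> ht g x = 1 -> facets_adjacent f g.
Proof.
move=> Px f12 g12 fx gx.
have /orP[//|/hasP[v _ sep]] := all_iota (all_iota separated_facetsP f12) g12.
pose u k := facet_normal f k + facet_normal g k.
pose n0 := facet_normal (nth 0%N (vertex_faces v) 0).
pose n1 := facet_normal (nth 0%N (vertex_faces v) 1).
pose n2 := facet_normal (nth 0%N (vertex_faces v) 2).
pose D := det3 n0 n1 n2.
pose c0 := D * det3 u n1 n2; pose c1 := D * det3 n0 u n2; pose c2 := D * det3 n0 n1 u.
have {sep} : [&& 0 <= c0, 0 <= c1, 0 <= c2, c0 + c1 + c2 < 2%Z * (D * D),
        all (fun k => D * D * u k == c0 * n0 k + c1 * n1 k + c2 * n2 k) (iota 0 3) &
        all (fun f => (f < 12)%N) (vertex_faces v) && (size (vertex_faces v) == 3%N)].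
  exact: sep.
move=> /and5P[c00 c10 c20 cD /and3P[/allP e /allP hl /eqP hs]].
(* The determinants become opaque integers; only the certified relations are used from here on. *)
move: D c0 c1 c2 c00 c10 c20 cD e => D c0 c1 c2 c00 c10 c20 cD e.
have hh j : (j < 3)%N -> ht (nth 0%N (vertex_faces v) j) x <= 1.
  by move=> j3; apply: Px; apply: hl; rewrite mem_nth ?hs.
have E k : k \in iota 0 3 -> (D * D)%:~R * ((facet_normal f k)%:~R + (facet_normal g k)%:~R) =
   c0%:~R * (n0 k)%:~R + c1%:~R * (n1 k)%:~R + c2%:~R * (n2 k)%:~R :> R.
  move=> k3; have /eqP/(congr1 (intmul (1 : R))) := e k k3.
  by rewrite /u !(intrD, intrM).
have := (hh 0%N isT, hh 1%N isT, hh 2%N isT).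
move: fx gx; rewrite !height_normalE -/n0 -/n1 -/n2.
set X := x _ _; set Y := x _ _; set Z := x _ _ => fx gx [[h0 h1] h2].
have c00' : 0 <= c0%:~R :> R by rewrite ler0z.
have c10' : 0 <= c1%:~R :> R by rewrite ler0z.
have c20' : 0 <= c2%:~R :> R by rewrite ler0z.
have cD' : c0%:~R + c1%:~R + c2%:~R < 2 * (D * D)%:~R :> R.
  by move: cD; rewrite -(ltr_int R) !(intrD, intrM).
have := ler_wpM2l c00' h0; have := ler_wpM2l c10' h1; have := ler_wpM2l c20' h2.
have e0 := E 0%N isT; have e1 := E 1%N isT; have e2 := E 2%N isT.
have S : (D * D)%:~R * (((facet_normal f 0)%:~R * X + (facet_normal f 1)%:~R * Y + (facet_normal f 2)%:~R * Z)
      + ((facet_normal g 0)%:~R * X + (facet_normal g 1)%:~R * Y + (facet_normal g 2)%:~R * Z)) =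
  c0%:~R * ((n0 0%N)%:~R * X + (n0 1%N)%:~R * Y + (n0 2%N)%:~R * Z) +
  c1%:~R * ((n1 0%N)%:~R * X + (n1 1%N)%:~R * Y + (n1 2%N)%:~R * Z) +
  c2%:~R * ((n2 0%N)%:~R * X + (n2 1%N)%:~R * Y + (n2 2%N)%:~R * Z) :> R.
  transitivity ((D * D)%:~R * ((facet_normal f 0)%:~R + (facet_normal g 0)%:~R) * X +
    (D * D)%:~R * ((facet_normal f 1)%:~R + (facet_normal g 1)%:~R) * Y +
    (D * D)%:~R * ((facet_normal f 2)%:~R + (facet_normal g 2)%:~R) * Z); first by ring.
  by rewrite e0 e1 e2; ring.
rewrite fx gx in S; move=> k2 k1 k0; exfalso; move: S cD' k0 k1 k2.
by clear; lra.
Qed.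

Lemma polytope_cell x : polytope x -> exists k i, [/\ (k < 4)%N, (i < count_cells k)%N &
  active k i = [seq f <- iota 0 12 | ht f x == 1]].
Proof.
move=> Px; have : has_cell (fun k i => active k i == [seq f <- iota 0 12 | ht f x == 1]).
  rewrite -[[seq f <- _ | _]]/([::] ++ [seq f <- iota 0 12 | ht f x == 1]).
  apply: (forall_cliquesP (P := fun s => has_cell (fun k i => active k i == s)) _ _ cliques_active) => //.
  move=> f g /eqP fx /eqP gx; rewrite !mem_iota => /andP[_ f12] /andP[_ g12].
  exact: polytope_adjacent Px _ _ fx gx.
by move=> /has_cellP[k [i [k4 ik /eqP ai]]]; exists k, i.
Qed.

End Pyritohedron.

(** * The pyritohedron as a regular cell complex *)

Section PyritohedronComplex.
Context (R : realType).
Local Notation ht := (height (@normal R)).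

Definition pyr_cell : finType := {k : 'I_4 & 'I_(count_cells k)}.
Implicit Types c d : pyr_cell.
Definition pyr_dim c : nat := tag c.
Definition pyr_num c : nat := tagged c.

Lemma pyr_numP c : (pyr_num c < count_cells (pyr_dim c))%N.
Proof. exact: ltn_ord. Qed.

Lemma pyr_cell_inj c d : pyr_dim c = pyr_dim d -> pyr_num c = pyr_num d -> c = d.
Proof.
case: c d => [k i] [l j]; rewrite /pyr_dim /pyr_num /= => kl.
have {}kl : k = l by exact: val_inj.
by case: l / kl j => j ij; congr existT; exact: val_inj.
Qed.

Lemma pyr_cell_onto k i : (i < count_cells k)%N ->
  exists2 c, pyr_dim c = k & pyr_num c = i.
Proof.
move=> ik; have k4 : (k < 4)%N by case: k ik => [|[|[|[|]]]].
by exists (existT (fun k : 'I_4 => 'I_(count_cells k)) (Ordinal k4) (Ordinal ik)).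
Qed.

Definition pyr_active c : seq nat := active (pyr_dim c) (pyr_num c).
Definition pyr_centre c : 'rV[R]_3 := centre R (pyr_dim c) (pyr_num c).

(** Every inequality is prescribed as tight or strict, so a point determines the facet set of its
    cell and thereby the cell. *)
Definition pyr_open c : set 'rV[R]_3 := [set x | forall f, (f < 12)%N ->
  if f \in pyr_active c then ht f x = 1 else ht f x < 1].
Definition pyr_closed c : set 'rV[R]_3 := [set x | forall f, (f < 12)%N ->
  if f \in pyr_active c then ht f x = 1 else ht f x <= 1].

Lemma pyr_active_ok c :
  [&& (size (pyr_active c) + pyr_dim c == 3)%N,
    all (fun f => has_cell (fun l j => all (fun g => (g != f) == inc l j 2 g) (pyr_active c)))
      (pyr_active c) &
    all_cells (fun l j => [&& (pyr_active c == active l j) ==> ((pyr_dim c == l) && (pyr_num c == j)),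
       inc (pyr_dim c) (pyr_num c) l j == all (fun f => f \in pyr_active c) (active l j) &
       ((pyr_dim c != l) || (pyr_num c != j)) && all (fun f => f \in pyr_active c) (active l j) ==> (pyr_dim c < l)%N])].
Proof. exact: (all_cellsP active_okP (pyr_numP c)). Qed.

Lemma pyr_active_inj c d : pyr_active c = pyr_active d -> c = d.
Proof.
move=> cd; have /and3P[_ _ h] := pyr_active_ok c.
have /and3P[+ _ _] := all_cellsP h (pyr_numP d).
by rewrite cd eqxx => /andP[/eqP ? /eqP ?]; exact: pyr_cell_inj.
Qed.

Lemma pyr_inc c d : inc (pyr_dim c) (pyr_num c) (pyr_dim d) (pyr_num d) =
  all (fun f => f \in pyr_active c) (pyr_active d).
Proof.
have /and3P[_ _ h] := pyr_active_ok c.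
by have /and3P[_ /eqP -> _] := all_cellsP h (pyr_numP d).
Qed.

Lemma pyr_dim_lt c d : c != d -> all (fun f => f \in pyr_active c) (pyr_active d) ->
  (pyr_dim c < pyr_dim d)%N.
Proof.
have /and3P[_ _ h] := pyr_active_ok c.
have /and3P[_ _ +] := all_cellsP h (pyr_numP d).
move=> /implyP h' cd al; apply: h'; rewrite [X in _ && X]al andbT -negb_and.
by apply: contra cd => /andP[/eqP ? /eqP ?]; apply/eqP; exact: pyr_cell_inj.
Qed.

Lemma pyr_active_lt c f : f \in pyr_active c -> (f < 12)%N.
Proof. by rewrite mem_active => /andP[]. Qed.

Lemma pyr_centre_open c : pyr_open c (pyr_centre c).
Proof.
by move=> f f12; rewrite mem_active f12; exact: height_centre (pyr_numP c) f12.
Qed.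

Lemma pyr_open_active c x : pyr_open c x -> pyr_active c = [seq f <- iota 0 12 | ht f x == 1].
Proof.
move=> cx; apply: eq_in_filter => f; rewrite mem_iota => /andP[_ f12].
have := cx f f12; rewrite mem_active f12 /=.
by case: ifP => _ => [->|h]; rewrite ?eqxx // lt_eqF.
Qed.

Lemma pyr_open_closed c : pyr_open c `<=` pyr_closed c.
Proof. by move=> x cx f f12; have := cx f f12; case: ifP => // _ /ltW. Qed.

Lemma pyr_closed_polytope c : pyr_closed c `<=` @polytope R.
Proof. by move=> x cx f f12; have := cx f f12; case: ifP => // _ ->. Qed.

Lemma pyr_open_sub_closed c d x : pyr_open c x ->
  pyr_closed d x <-> all (fun f => f \in pyr_active c) (pyr_active d).
Proof.
move=> cx; split=> [dx|/allP al f f12].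
  apply/allP => f fd; have f12 := pyr_active_lt fd.
  rewrite (pyr_open_active cx) mem_filter mem_iota f12 /= andbT.
  by have := dx f f12; rewrite fd => ->.
have := cx f f12; case: ifP => fc.
  by case: ifP => _ -> .
by case: ifP => [/al|_ /ltW //]; rewrite fc.
Qed.

Lemma pyr_cover x : polytope x -> exists c, pyr_open c x.
Proof.
move=> Px; have [k [i [k4 ik ae]]] := polytope_cell Px.
have [c ck ci] := pyr_cell_onto ik; exists c => f f12.
rewrite /pyr_active ck ci ae mem_filter mem_iota f12 andbT.
by case: eqVneq => // n; rewrite lt_neqAle n; exact: Px.
Qed.

(** A point of the closed cell is approached along the segment to the centre: tight facets stay
    tight on it, and all other inequalities become strict at once. *)
Lemma pyr_closure c : closure (pyr_open c) = pyr_closed c.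
Proof.
apply/seteqP; split=> x.
  have cl : closed (pyr_closed c).
    have -> : pyr_closed c = \bigcap_(f in [set f | (f < 12)%N])
        (if f \in pyr_active c then ht f @^-1` [set 1] else ht f @^-1` [set y | y <= 1]).
      by apply/seteqP; split=> y h f f12; have := h f f12; case: ifP.
    apply: closed_bigI => f _; case: ifP => _; apply: closed_comp => [y _|].
    - exact: height_continuous.
    - exact: closed_eq.
    - exact: height_continuous.
    - exact: closed_le.
  move=> h; rewrite (iffLR (closure_id _) cl); exact: (closureS (@pyr_open_closed c)).
move=> cx U Ux; have pc := pyr_centre_open c; set p := pyr_centre c in pc.
pose w (t : R) := x + t *: (p - x).
have wc : {for 0, continuous w}.
  apply: (@cvgD R 'rV[R]_3 R^o (nbhs (0 : R)) _ (cst x)); first exact: cvg_cst.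
  exact: scalel_continuous.
have : nbhs (w 0) U by rewrite /w scale0r addr0.
move=> /wc /nbhs_ballP[e /= e0 eU].
pose t := Num.min (e / 2) 1.
have t0 : 0 < t by rewrite lt_min divr_gt0 //= ltr01.
have t1 : t <= 1 by rewrite ge_min lexx orbT.
have te : t < e by rewrite gt_min ltr_pdivrMr // ltr_pMr // ltr1n.
exists (w t); split; last first.
  by apply: eU; rewrite /ball /= sub0r normrN gtr0_norm.
move=> f f12; have := cx f f12; have := pc f f12.
rewrite /w heightD heightZ heightB; case: ifP => _ pf xf; nra.
Qed.

Lemma pyr_adjacent_cell c f : f \in pyr_active c ->
  exists d, forall g, g \in pyr_active c -> (g \in pyr_active d) = (g != f).
Proof.
move=> fc; have /and3P[_ /allP /(_ f fc) /has_cellP[k [i [_ ik /allP h]]] _] := pyr_active_ok c.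
have [d dk di] := pyr_cell_onto ik; exists d => g gc.
by rewrite mem_active (pyr_active_lt gc) dk di andTb -(eqP (h g gc)).
Qed.

Definition active_normals c : 'M[R]_(3, size (pyr_active c)) :=
  \matrix_(k, j) normal R (nth 0%N (pyr_active c) j) k ord0.

Lemma mul_active_normals c (x : 'rV[R]_3) j :
  (x *m active_normals c) ord0 j = ht (nth 0%N (pyr_active c) j) x.
Proof. by rewrite /height !mxE; apply: eq_bigr => k _; rewrite !mxE. Qed.

(* Dropping the facet f from the active ones yields a cell whose centre differs
   from that of c in a direction seen only by the normal of f. *)
Lemma active_normals_rank c : \rank (active_normals c) = size (pyr_active c).
Proof.
set m := size (pyr_active c).
have h (j : 'I_m) : exists z : 'rV[R]_3, forall i : 'I_m,
    ht (nth 0%N (pyr_active c) i) z = (i == j)%:R.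
  set f := nth 0%N (pyr_active c) j.
  have fc : f \in pyr_active c by exact: mem_nth.
  have [d dP] := pyr_adjacent_cell fc.
  have df : ht f (pyr_centre d) < 1.
    by have := pyr_centre_open d (pyr_active_lt fc); rewrite dP // eqxx.
  have cf : ht f (pyr_centre c) = 1.
    by have := pyr_centre_open c (pyr_active_lt fc); rewrite fc.
  exists ((ht f (pyr_centre c - pyr_centre d))^-1 *: (pyr_centre c - pyr_centre d)) => i.
  rewrite heightZ; case: (eqVneq i j) => [->|ij].
    by rewrite mulVf // heightB cf subr_eq0 eq_sym lt_eqF.
  set g := nth 0%N (pyr_active c) i.
  have gc : g \in pyr_active c by exact: mem_nth.
  have gf : g != f by rewrite nth_uniq // ?filter_uniq ?iota_uniq.
  have := pyr_centre_open d (pyr_active_lt gc); rewrite dP // gf => dg.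
  have := pyr_centre_open c (pyr_active_lt gc); rewrite gc => cg.
  by rewrite [ht g _]heightB cg dg subrr mulr0.
have [z zP] := choice h.
rewrite -mxrank_tr; apply/eqP/row_freeP.
exists (\matrix_(k, j) z j ord0 k); apply/matrixP => i j.
rewrite [RHS]mxE -zP -mul_active_normals !mxE.
by apply: eq_bigr => k _; rewrite !mxE mulrC.
Qed.

(** The normals of the facets through the cell are independent, so their common kernel has dimension
    [pyr_dim c]. A basis of it, placed at the centre, is the chart to which [face_ball] applies. *)
Lemma pyr_char c : exists phi : 'rV[R]_(pyr_dim c) -> 'rV[R]_3,
  homeomorphism_on (@closed_unit_ball R (pyr_dim c)) (closure (pyr_open c)) phi
  /\ phi @` @open_unit_ball R (pyr_dim c) = pyr_open c.
Proof.
set N := active_normals c; pose B := row_base (kermx N); pose Q := pinvmx B.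
have -> : pyr_dim c = \rank (kermx N).
  by have /and3P[/eqP h _ _] := pyr_active_ok c; rewrite mxrank_ker active_normals_rank -h addKn.
set p := pyr_centre c; pose G := [seq g <- iota 0 12 | g \notin pyr_active c].
have pc : pyr_open c p := pyr_centre_open c.
have BQ : B *m Q = 1%:M by apply: mulmxVp; exact: row_base_free.
have Gp g : g \in G -> ht g p < 1.
  by rewrite mem_filter mem_iota => /andP[gc /andP[_ g12]]; have := pc g g12; rewrite (negbTE gc).
have pf f : f \in pyr_active c -> ht f p = 1.
  by move=> fc; have := pc f (pyr_active_lt fc); rewrite fc.
have spanP x : (x - p) *m Q *m B = x - p <-> forall f, f \in pyr_active c -> ht f x = 1.
  have -> : (x - p) *m Q *m B = x - p <-> (x - p <= kermx N)%MS.
    have -> : (x - p <= kermx N)%MS = (x - p <= B)%MS by rewrite /B eq_row_base.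
    split=> [<-|]; first exact: submxMl.
    exact: mulmxKpV.
  split=> [/sub_kermxP xN f fc|h].
    have fi : (index f (pyr_active c) < size (pyr_active c))%N by rewrite index_mem.
    have := @mul_active_normals c (x - p) (Ordinal fi).
    rewrite xN mxE /= nth_index // heightB pf // => /eqP.
    by rewrite eq_sym subr_eq0 => /eqP.
  apply/sub_kermxP/rowP => j; rewrite mul_active_normals mxE heightB.
  by rewrite h ?pf ?subrr // mem_nth.
have bodyE : face_body (@normal R) B Q p G = pyr_closed c.
  apply/seteqP; split=> [x [/spanP h hG] f f12|x cx].
    case: ifP => fc; first exact: h.
    by apply: hG; rewrite mem_filter mem_iota fc.
  split; first by apply/spanP => f fc; have := cx f (pyr_active_lt fc); rewrite fc.
  move=> g; rewrite mem_filter mem_iota => /andP[gc /andP[_ g12]].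
  by have := cx g g12; rewrite (negbTE gc).
have interiorE : face_interior (@normal R) B Q p G = pyr_open c.
  apply/seteqP; split=> [x [/spanP h hG] f f12|x cx].
    case: ifP => fc; first exact: h.
    by apply: hG; rewrite mem_filter mem_iota fc.
  split; first by apply/spanP => f fc; have := cx f (pyr_active_lt fc); rewrite fc.
  move=> g; rewrite mem_filter mem_iota => /andP[gc /andP[_ g12]].
  by have := cx g g12; rewrite (negbTE gc).
(* Both points have coordinates between -1 and 1. *)
have bounded x : face_body (@normal R) B Q p G x -> forall k, `|(x - p) ord0 k| <= 2.
  rewrite bodyE => cx k; rewrite mxE [(- p) _ _]mxE; apply: le_trans (ler_normB _ _) _.
  rewrite -[2]/(1 + 1); apply: lerD.
    exact: (polytope_bounded (pyr_closed_polytope cx)).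
  exact: (polytope_bounded (pyr_closed_polytope (pyr_open_closed pc))).
have := face_ball BQ Gp bounded; rewrite bodyE interiorE pyr_closure.
exact.
Qed.

Lemma pyr_disjoint : trivIset [set: pyr_cell] pyr_open.
Proof.
move=> c d _ _ [x [cx dx]]; apply: pyr_active_inj.
by rewrite (pyr_open_active cx) (pyr_open_active dx).
Qed.

Lemma pyr_boundary c : exists A : {set pyr_cell},
    (forall w, w \in A -> (pyr_dim w < pyr_dim c)%N) /\
    closure (pyr_open c) `\` pyr_open c = \bigcup_(w in [set` A]) pyr_open w.
Proof.
exists [set d : pyr_cell | (d != c) && all (fun f => f \in pyr_active d) (pyr_active c)]%SET.
split=> [w|]; first by rewrite inE => /andP[wc]; exact: pyr_dim_lt.
rewrite pyr_closure; apply/seteqP; split=> x.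
  move=> [cx nx]; have [d dx] := pyr_cover (pyr_closed_polytope cx).
  exists d => //=; rewrite inE; apply/andP; split.
    by apply: contra_notN nx => /eqP <-.
  by apply/(pyr_open_sub_closed c dx).
move=> [d /=]; rewrite inE => /andP[dc al] dx; split.
  exact/(pyr_open_sub_closed c dx).
move=> cx; move/eqP: dc; apply.
by apply: pyr_disjoint => //; exists x.
Qed.

Definition pyritohedron : regular_cw R 'rV[R]_3 :=
  RegularCW (@norm_hausdorff R 'rV[R]_3) pyr_disjoint pyr_char pyr_boundary.

Lemma pyritohedron_solid : is_solid_dodecahedron pyritohedron.
Proof.
apply/solid_numbering; exists pyr_num; split.
- exact: pyr_cell_inj.
- exact: pyr_numP.
- exact: pyr_cell_onto.
- move=> c d; rewrite pyr_inc; apply/asboolP/idP => [sub|al x cx].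
    have := sub _ (pyr_centre_open c); rewrite pyr_closure.
    by move/(pyr_open_sub_closed d (pyr_centre_open c)).
  by rewrite pyr_closure; apply/(pyr_open_sub_closed d cx).
Qed.

End PyritohedronComplex.

Theorem theorem7p2 (R : realType) :
  (forall (X : topologicalType) (C : regular_cw R X) (T : template C),
     is_solid_dodecahedron C ->
     [/\ (1 <= face_count T)%N,
         (face_count T <= pole_dist T)%N,
         (pole_dist T <= 2)%N &
         face_count T = 2%N -> pole_dist T = 2%N ->
         [/\ poles_via_shared_edge T,
             #|meridian_circle T| = 8%N &
             meridian_pole_dist T = 3%N]])
  /\
  (forall eta delta : nat,
     (eta, delta) \in [:: (1, 1); (1, 2); (2, 2)]%N ->
     exists (X : topologicalType) (C : regular_cw R X) (T : template C),
       [/\ is_solid_dodecahedron C,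
           (#|cells_in C 2 (west T)| <= #|cells_in C 2 (east T)|)%N,
           face_count T = eta &
           pole_dist T = delta]).
Proof.
split=> [X C T|eta delta]; first exact: template_bounds.
have real p : plan_ok p -> (size (plan_west p) <= size (plan_east p))%N ->
    (distance (plan_north p) (plan_south p) <= 2)%N ->
    exists (X : topologicalType) (C : regular_cw R X) (T : template C),
      [/\ is_solid_dodecahedron C,
           (#|cells_in C 2 (west T)| <= #|cells_in C 2 (east T)|)%N,
           face_count T = size (plan_west p) &
           pole_dist T = distance (plan_north p) (plan_south p)].
  move=> okp we d2; have sd := pyritohedron_solid R.
  have [T [w f d]] := plan_template sd okp we d2.
  by exists 'rV[R]_3, (pyritohedron R), T; split.
have /and3P[ok11 ok12 ok22] := plans_ok.
rewrite !inE => /or3P[] /eqP[-> ->].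
- exact: (real plan11 ok11 isT isT).
- exact: (real plan12 ok12 isT isT).
- exact: (real plan22 ok22 isT isT).
Qed.
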